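(* Assume the setting in the context with $\Phi$ a standard Gaussian matrix and $p\ge2$. Let $\theta_1\le\dots\le\theta_k$ be the principal angles between $\mathcal R(Q)$ and $\mathcal R(U_k)$, and $\varphi_1\le\dots\le\varphi_k$ those between $\mathcal R(P)$ and $\mathcal R(V_k)$. Then for $i=1,\dots,k$, $$\mathbb E\sin\theta_i\le\frac{\delta_i^{2q+2}\omega}{\sqrt{1+\delta_i^{4q+4}\omega^2}},\qquad \mathbb E\sin\varphi_i\le\frac{\delta_i^{2q+1}\omega}{\sqrt{1+\delta_i^{4q+2}\omega^2}}.$$
   Context: Let $A\in\mathbb R^{m\times n}$ with $m\ge n$ have full SVD $A=U\Sigma V^T$, with singular values $\sigma_1\ge\sigma_2\ge\dots\ge\sigma_n\ge 0$. Fix an integer $k\ge1$ with $\sigma_k>0$ (the paper regards $A$ as having numerical rank $k$, i.e. $\sigma_k$ well separated from $\sigma_{k+1}$). Write $U=[U_k\ U_\perp]$ with $U_k\in\mathbb R^{m\times k}$ the first $k$ left singular vectors $u_1,\dots,u_k$, $U_\perp\in\mathbb R^{m\times(m-k)}$ the rest; $V=[V_k\ V_\perp]$ with $V_k\in\mathbb R^{n\times k}$ the first $k$ right singular vectors $v_1,\dots,v_k$; $\Sigma_k=\mathrm{diag}(\sigma_1,\dots,\sigma_k)$ and $\Sigma_\perp$ the remaining diagonal block of $\Sigma$ containing $\sigma_{k+1},\dots,\sigma_n$ (so $\|\Sigma_\perp\|_2=\sigma_{k+1}$, $\|\Sigma_\perp\|_F=(\sum_{i>k}\sigma_i^2)^{1/2}$).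 The notation $\|\cdot\|_{2,F}$ means the statement holds for both the spectral and Frobenius norm. Let $p\ge1$ be an oversampling integer, $d=k+p<n$, and $q\ge0$ an integer (power-iteration parameter). RU-QLP (Randomized Unpivoted QLP): given $\Phi\in\mathbb R^{m\times d}$, let $\bar P\in\mathbb R^{n\times d}$ have orthonormal columns spanning the range of $(A^TA)^qA^T\Phi$ (assumed of rank $d$); compute the thin unpivoted QR factorization $A\bar P=QR$ with $Q\in\mathbb R^{m\times d}$ having orthonormal columns and $R\in\mathbb R^{d\times d}$ upper triangular; compute the thin unpivoted QR factorization $R^T=\widetilde P\widetilde R$; set $P=\bar P\widetilde P\in\mathbb R^{n\times d}$ and $L=\widetilde R^T$ (lower triangular), giving $\hat A=QLP^T$. Partition $R=\begin{bmatrix}R_{11}&R_{12}\\0&R_{22}\end{bmatrix}$ and $L=\begin{bmatrix}L_{11}&0\\L_{21}&L_{22}\end{bmatrix}$ with $R_{11},L_{11}\in\mathbb R^{k\times k}$. Define $\widehat\Phi_1=U_k^T\Phi\in\mathbb R^{k\times d}$ and $\widehat\Phi_2=U_\perp^T\Phi\in\mathbb R^{(m-k)\times d}$, assume $\widehat\Phi_1$ has rank $k$, and let $\dagger$ denote the Moore–Penrose inverse. Set $\delta_i=\sigma_{k+1}/\sigma_i$ for $i=1,\dots,k$ and $\gamma=\sigma_n/\sigma_1$. Principal angles between a subspace $\mathcal X$ and a $k$-dimensional subspace $\mathcal Y$ (with $\dim\mathcal X\ge k$) are the $k$ canonical angles $0\le\alpha_1\le\dots\le\alpha_k\le\pi/2$;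 for orthonormal bases $X$, $Y$, the values $\sin\alpha_i$ are the singular values of $(I-XX^T)Y$. Probabilistic setting: $\Phi\in\mathbb R^{m\times d}$ has i.i.d. standard normal entries (so $\widehat\Phi_1,\widehat\Phi_2$ are independent standard Gaussian matrices, and the rank assumptions hold almost surely); $\mathbb E$ denotes expectation over $\Phi$. Define $\omega_1=\sqrt{m-k}+\sqrt{k+p}+7$, $\omega_2=\frac{4e\sqrt{k+p}}{p+1}$, $\omega=\omega_1\omega_2$, and $C=\sqrt{\frac{k}{p-1}}+\frac{e\sqrt{(m-k)(k+p)}}{p}$, where $e$ is Euler's number. *)

(* Defs.v *)
From HB Require Import structures.
From mathcomp Require Import all_boot all_order all_algebra.
From mathcomp Require Import all_classical all_reals all_analysis.
From mathcomp Require Import normal_distribution.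
Set Implicit Arguments.
Unset Strict Implicit.
Unset Printing Implicit Defensive.
Import Order.TTheory GRing.Theory Num.Theory.
Local Open Scope classical_set_scope.
Local Open Scope ring_scope.

Section Defs.
Variable R : realType.

Definition lead_cols (a b : nat) (k : nat) (M : 'M[R]_(a, b)) : 'M[R]_(a, k) :=
  M *m (pid_mx k : 'M[R]_(b, k)).

Definition upper_tri (a : nat) (M : 'M[R]_a) : Prop :=
  forall i j : 'I_a, (j < i)%N -> M i j = 0.

Definition orthonormal_cols (a b : nat) (X : 'M[R]_(a, b)) : Prop :=
  X^T *m X = 1%:M.

Definition diag_rect (a b : nat) (sigma : nat -> R) : 'M[R]_(a, b) :=
  \matrix_(i < a, j < b) (if (i : nat) == j then sigma i else 0).

Definition sorted_svals (a k : nat) (M : 'M[R]_(a, k)) (s : 'I_k -> R) : Prop :=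
  (forall i, 0 <= s i) /\ (forall i j : 'I_k, (i <= j)%N -> s i <= s j) /\
  exists (W : 'M[R]_(a, k)) (Z : 'M[R]_k),
    orthonormal_cols W /\ orthonormal_cols Z /\
    M = W *m diag_mx (\row_j s j) *m Z^T.

(** sines of the principal angles theta_1 <= ... <= theta_k between R(X)
    (X orthonormal columns) and the k-dimensional R(Y) (Y orthonormal columns):
    the sorted singular values of (I - X X^T) Y. *)
Definition sin_principal_angles (a b k : nat) (X : 'M[R]_(a, b)) (Y : 'M[R]_(a, k))
  (s : 'I_k -> R) : Prop :=
  sorted_svals ((1%:M - X *m X^T) *m Y) s.

(** One run of RU-QLP on input A with test matrix Phi and parameter q:
    Pbar, Q, Rm, Pt, Rt are the intermediate factors, P = Pbar Pt, L = Rt^T. *)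
Definition ruqlp_run (m n d q : nat) (A : 'M[R]_(m, n)) (Phi : 'M[R]_(m, d))
  (Pbar : 'M[R]_(n, d)) (Q : 'M[R]_(m, d)) (Rm : 'M[R]_d)
  (Pt : 'M[R]_d) (Rt : 'M[R]_d) : Prop :=
  orthonormal_cols Pbar /\
  (Pbar^T == (((A^T *m A) ^+ q) *m A^T *m Phi)^T)%MS /\
  A *m Pbar = Q *m Rm /\ orthonormal_cols Q /\ upper_tri Rm /\
  Rm^T = Pt *m Rt /\ orthonormal_cols Pt /\ upper_tri Rt.

Definition iid_std_gaussian_mx {d0 : measure_display} {T : measurableType d0}
  (P : probability T R) (m d : nat) (Phi : T -> 'M[R]_(m, d)) : Prop :=
  (forall i j, measurable_fun setT (fun w => Phi w i j)) /\
  (forall i j (B : set R), measurable B ->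
      P ((fun w => Phi w i j) @^-1` B) = normal_prob 0 1 B) /\
  (forall B : 'I_m -> 'I_d -> set R, (forall i j, measurable (B i j)) ->
      P (\big[setI/setT]_(i < m) \big[setI/setT]_(j < d)
            ((fun w => Phi w i j) @^-1` B i j))
      = (\prod_(i < m) \prod_(j < d) P ((fun w => Phi w i j) @^-1` B i j))%E).

End Defs.

(* Main.v *)
(** Let [Psi = U^T Phi], with blocks [Psi1] (the first [k] rows) and [Psi2], put
    [B = Psi2 Psi1^+] and [g t = t / sqrt (1 + t^2)].  For [v] in the span of
    [e_1, ..., e_i], the range of [Q] contains the image under [U] of a vector
    [(v, z)] with [|z| <= delta_i^(2q+2) |B| |v|], and likewise for [P] with
    exponent [2q+1]; minimax turns this into [sin theta_i <= g (delta_i^(2q+2) |B|)],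
    whichever factors the run of RU-QLP produces.

    [Psi] is again Gaussian.  Let [r] be the integer part of [p/2] and let [x] be
    an independent Gaussian vector.  Testing [B x] in one direction gives
    [(2r-1)!! |B|^(2r) <= E_x |B x|^(2r)], and the mean of the right-hand side is
    estimated by conditioning in turn: [Psi2] is independent of [Psi1], and
    [|Psi1^+ e|^-1] is the distance of a Gaussian vector to an independent
    subspace, whose negative moments follow from the Laplace transform.  This gives
    [E |B x|^(2r) <= (2r-1)!! omega^(2r)].  Finally [g (delta t)] is a concave
    function of [t^(2r)], so Jensen's inequality concludes. *)

(* The exponent [r] is the largest available. The distance from a row of [Psi1] to the span of the
   other [k - 1] rows is the norm of a Gaussian vector in [p + 1] dimensions, and its moment of
   order [-2r] is finite only for [2r <= p]. A large [r] is essential: the second moment would only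
   control the Frobenius norm of [B], while [r] of the order of [p] produces the denominator [p + 1]
   of [omega]. The double factorials on the two sides cancel, so a bound on one moment of [|B|]
   replaces any tail estimate. Independence is always used in the form of an iterated integral over
   two copies of the sample space, one block being read at [w] and the other at [w']; fixing one
   variable is then conditioning. The pseudo-inverse is total, so the moment estimates hold without
   excluding rank-deficient samples; full rank enters only when the sines are compared with [B], on
   almost every sample. Rotation invariance, used throughout, is derived from the plane case by
   Givens rotations. *)
Require Import Defs.
From HB Require Import structures.
From mathcomp Require Import all_boot all_order all_algebra.
From mathcomp Require Import all_classical all_reals all_analysis.
From mathcomp Require Import measurable_realfun normal_distribution.
From mathcomp Require Import ring lra zify.
Import Order.TTheory GRing.Theory Num.Theory.
Set Implicit Arguments.
Unset Strict Implicit.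
Unset Printing Implicit Defensive.
Local Open Scope classical_set_scope.
Local Open Scope ring_scope.

(** * Singular values and principal angles *)

Section LinearAlgebra.
Variable R : realType.

(** The squared Frobenius norm, hence the squared Euclidean norm of a column; squares keep roots out
    of the algebra. *)
Definition sqn (a b : nat) (M : 'M[R]_(a, b)) : R := \sum_i \sum_j M i j ^+ 2.

Lemma sqn_ge0 a b (M : 'M[R]_(a, b)) : 0 <= sqn M.
Proof. by apply: sumr_ge0 => i _; apply: sumr_ge0 => j _; exact: sqr_ge0. Qed.

Lemma sqn_eq0 a b (M : 'M[R]_(a, b)) : (sqn M == 0) = (M == 0).
Proof.
apply/eqP/eqP => [M0|->]; last first.
  by rewrite /sqn big1 // => i _; rewrite big1 // => j _; rewrite mxE expr0n.
apply/matrixP => i j; rewrite mxE.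
have s0 i' : 0 <= \sum_j' M i' j' ^+ 2 by apply: sumr_ge0 => ? _; exact: sqr_ge0.
have /psumr_eq0P /(_ i isT) : \sum_i' \sum_j' M i' j' ^+ 2 = 0 by [].
move=> /(_ (fun i' _ => s0 i')) => /psumr_eq0P /(_ j isT).
by move=> /(_ (fun _ _ => sqr_ge0 _)) /eqP; rewrite sqrf_eq0 => /eqP.
Qed.

Lemma sqn_gt0 a b (M : 'M[R]_(a, b)) : M != 0 -> 0 < sqn M.
Proof. by move=> M0; rewrite lt_neqAle sqn_ge0 eq_sym sqn_eq0 M0. Qed.

Lemma sqn0 a b : sqn (0 : 'M[R]_(a, b)) = 0.
Proof. by apply/eqP; rewrite sqn_eq0. Qed.

Lemma sqn_trmx a b (M : 'M[R]_(a, b)) : sqn M^T = sqn M.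
Proof.
rewrite /sqn exchange_big; apply: eq_bigr => i _.
by apply: eq_bigr => j _; rewrite mxE.
Qed.

Lemma sqn_col_mx a1 a2 b (M : 'M[R]_(a1, b)) (N : 'M[R]_(a2, b)) :
  sqn (col_mx M N) = sqn M + sqn N.
Proof.
rewrite /sqn big_split_ord; congr (_ + _); apply: eq_bigr => i _;
  by apply: eq_bigr => j _; rewrite ?col_mxEu ?col_mxEd.
Qed.

Lemma sqnZ a b (c : R) (M : 'M[R]_(a, b)) : sqn (c *: M) = c ^+ 2 * sqn M.
Proof.
rewrite /sqn mulr_sumr; apply: eq_bigr => i _.
by rewrite mulr_sumr; apply: eq_bigr => j _; rewrite mxE exprMn.
Qed.

Lemma sqnE a b (M : 'M[R]_(a, b)) : sqn M = \tr (M^T *m M).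
Proof.
rewrite /sqn exchange_big /mxtrace; apply: eq_bigr => j _.
by rewrite mxE; apply: eq_bigr => i _; rewrite mxE expr2.
Qed.

Lemma sqn_orthonormal a b c (X : 'M[R]_(a, b)) (M : 'M[R]_(b, c)) :
  orthonormal_cols X -> sqn (X *m M) = sqn M.
Proof. by move=> XX; rewrite !sqnE trmx_mul mulmxA -(mulmxA M^T) XX mulmx1. Qed.

Lemma mul_tr_cV a (v : 'cV[R]_a) : v^T *m v = (sqn v)%:M.
Proof. by rewrite [LHS]mx11_scalar sqnE /mxtrace big_ord1. Qed.

Lemma sqnD a b (M N : 'M[R]_(a, b)) :
  sqn (M + N) = sqn M + sqn N + 2 * \tr (M^T *m N).
Proof.
rewrite !sqnE (raddfD (@trmx R a b)) mulmxDl !mulmxDr !mxtraceD.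
have -> : \tr (N^T *m M) = \tr (M^T *m N).
  by rewrite -mxtrace_tr trmx_mul trmxK.
ring.
Qed.

Lemma cauchy_schwarz_mx a b (M N : 'M[R]_(a, b)) :
  (\tr (M^T *m N)) ^+ 2 <= sqn M * sqn N.
Proof.
have [->|N0] := eqVneq N 0.
  by rewrite mulmx0 mxtrace0 expr0n sqn0 mulr0.
have sN := sqn_gt0 N0.
have := sqn_ge0 (M + (- (\tr (M^T *m N) / sqn N)) *: N).
rewrite sqnD sqnZ -scalemxAr mxtraceZ.
set t := \tr _ => H.
have -> : t ^+ 2 = sqn M * sqn N - sqn N *
   (sqn M + (- (t / sqn N)) ^+ 2 * sqn N + 2 * (- (t / sqn N) * t)).
  by field; rewrite gt_eqF.
by rewrite gerBl mulr_ge0 // ltW.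
Qed.

Lemma orthonormal_cols_tr a (X : 'M[R]_a) :
  orthonormal_cols X -> X *m X^T = 1%:M.
Proof. by move=> /mulmx1C. Qed.

Lemma orthonormal_cols_trmx a (X : 'M[R]_a) :
  orthonormal_cols X -> orthonormal_cols X^T.
Proof. by rewrite /orthonormal_cols trmxK => /mulmx1C. Qed.

Lemma orthonormal_colsM a b c (X : 'M[R]_(a, b)) (Y : 'M[R]_(b, c)) :
  orthonormal_cols X -> orthonormal_cols Y -> orthonormal_cols (X *m Y).
Proof.
rewrite /orthonormal_cols => XX YY.
by rewrite trmx_mul mulmxA -(mulmxA Y^T) XX mulmx1.
Qed.

Lemma orthonormal_cols_row_mx a b c (X : 'M[R]_(a, b)) (Y : 'M[R]_(a, c)) :
  orthonormal_cols X -> orthonormal_cols Y -> X^T *m Y = 0 ->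
  orthonormal_cols (row_mx X Y).
Proof.
rewrite /orthonormal_cols => XX YY XY; rewrite tr_row_mx mul_col_row XX YY XY.
have -> : Y^T *m X = 0 by rewrite -(trmxK (Y^T *m X)) trmx_mul trmxK XY trmx0.
by rewrite -scalar_mx_block.
Qed.

(** Gram-Schmidt, one column at a time. Besides yielding orthonormal bases, it shows that a run of
    RU-QLP exists, without which the assumption on all runs would say nothing. *)
Lemma qr_exists a b (M : 'M[R]_(a, b)) : \rank M = b ->
  exists (Q : 'M[R]_(a, b)) (T : 'M[R]_b),
    [/\ orthonormal_cols Q, upper_tri T & M = Q *m T].
Proof.
elim: b M => [|b IH] M rM.
  exists M, 0; split; [by apply/matrixP => -[]|by case|by apply/matrixP => ? []].
move: M rM; rewrite -addn1 => M rM.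
have rM1 : \rank (lsubmx M) = b.
  apply/eqP; rewrite eqn_leq rank_leq_col /= -(leq_add2r 1) -{1}rM.
  rewrite -{1}(hsubmxK M) -mxrank_tr tr_row_mx -addsmxE.
  rewrite (leq_trans (mxrank_adds_leqif _ _).1) // !mxrank_tr leq_add2l.
  exact: rank_leq_col.
have [Q [T [QQ uT MQT]]] := IH _ rM1.
pose c : 'cV[R]_a := rsubmx M; pose c' : 'cV[R]_a := c - Q *m (Q^T *m c).
have Mrow : M = row_mx (Q *m T) c by rewrite -MQT hsubmxK.
(* Were [c'] zero, [M] would factor through the [b] columns of [Q], against its rank [b + 1]. *)
have c'0 : c' != 0.
  apply/eqP => /eqP; rewrite subr_eq0 => /eqP cE.
  have := mulmx_max_rank Q (row_mx T (Q^T *m c)).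
  by rewrite mul_mx_row -cE -Mrow rM addn1 ltnn.
have s0 : 0 < Num.sqrt (sqn c') by rewrite sqrtr_gt0 sqn_gt0.
pose q : 'cV[R]_a := (Num.sqrt (sqn c'))^-1 *: c'.
have Qc' : Q^T *m c' = 0 by rewrite mulmxBr !mulmxA QQ mul1mx subrr.
exists (row_mx Q q), (block_mx T (Q^T *m c) 0 (Num.sqrt (sqn c'))%:M); split.
- apply: orthonormal_cols_row_mx => //.
    rewrite /orthonormal_cols mul_tr_cV sqnZ exprVn sqr_sqrtr ?sqn_ge0 //.
    by rewrite mulVf // gt_eqF // sqn_gt0.
  by rewrite -scalemxAr Qc' scaler0.
- move=> i j; case: (split_ordP i) => i' ->; case: (split_ordP j) => j' -> /= ij.
  + by rewrite block_mxEul; exact: uT.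
  + by move: ij; rewrite ltnNge ltnW // (leq_trans (ltn_ord i')) // leq_addr.
  + by rewrite block_mxEdl mxE.
  + by move: ij; rewrite !ord1 ltnn.
- rewrite mul_row_block mulmx0 addr0 mul_mx_scalar scalerA mulfV ?gt_eqF //.
  by rewrite scale1r addrC subrK -Mrow.
Qed.

(** The basis is stored as the columns of [E], so that [X *m E] takes coordinates along it. *)
Lemma orthonormal_basis_exists a b (M : 'M[R]_(a, b)) :
  exists2 E : 'M[R]_(b, \rank M), orthonormal_cols E & (E^T == M)%MS.
Proof.
have rB : \rank (row_base M)^T = \rank M.
  by rewrite mxrank_tr; exact/eqP/row_base_free.
have [Q [T [QQ _ MQ]]] := qr_exists rB.
have TU : T^T \in unitmx.
  rewrite unitmx_tr -row_full_unit /row_full eqn_leq rank_leq_row /=.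
  by have := mxrankM_maxr Q T; rewrite -MQ rB.
exists Q => //; apply/eqmxP; apply: eqmx_trans (eq_row_base M).
have -> : row_base M = T^T *m Q^T by rewrite -trmx_mul -MQ trmxK.
by apply/eqmx_sym/eqmxMfull; rewrite row_full_unit.
Qed.

(** An orthonormal basis of the left kernel of [H] supplies the missing columns. *)
Lemma orthonormal_completion n c (H : 'M[R]_(n + c, n)) : orthonormal_cols H ->
  exists K : 'M[R]_(n + c, c), orthonormal_cols (row_mx H K).
Proof.
move=> HH.
have rH : \rank H = n.
  apply/eqP; rewrite eqn_leq rank_leq_col /= -{1}(mxrank1 R n) -HH.
  exact: mxrankM_maxr.
have [E EE EK] := orthonormal_basis_exists (kermx H).
have rK : \rank (kermx H) = c by rewrite mxrank_ker rH addKn.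
move: E EE EK; rewrite rK => K KK EK; exists K.
apply: orthonormal_cols_row_mx => //; rewrite -(trmxK (H^T *m K)) trmx_mul trmxK.
by move/andP: EK => [/sub_kermxP -> _]; rewrite trmx0.
Qed.

Lemma sqn_cV a (v : 'cV[R]_a) : sqn v = \sum_i v i 0 ^+ 2.
Proof. by apply: eq_bigr => i _; rewrite big_ord1. Qed.

(* [v] is chosen in the span of the first [i.+1] basis vectors, orthogonal to
   the first [i] right singular vectors: [k - 1] linear constraints in all. *)
Lemma sorted_svals_le a k (M : 'M[R]_(a, k)) (s : 'I_k -> R) (i : 'I_k) :
  sorted_svals M s ->
  exists v : 'cV[R]_k, [/\ v != 0, forall j : 'I_k, (i < j)%N -> v j 0 = 0 &
    s i ^+ 2 * sqn v <= sqn (M *m v)].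
Proof.
move=> [s0 [smono [W [Z [WW [ZZ ->]]]]]].
(* Column [i] of [N] is zero, so [N] is singular; a left null vector satisfies all the constraints
   at once. *)
pose N := \matrix_(b < k, j < k)
  (if (j < i)%N then Z b j else if (i < j)%N then (b == j)%:R else 0%R).
have /eqP/det0P [v v0 vN] : \det N = 0.
  by rewrite (expand_det_col N i) big1 // => b _; rewrite mxE ltnn mul0r.
have vNj j : \sum_b v 0 b * N b j = 0.
  by move/matrixP: vN => /(_ 0 j); rewrite !mxE.
exists v^T; split.
- by rewrite trmx_eq0.
- move=> j ij; move: (vNj j); rewrite (bigD1 j) //= big1 ?addr0 => [|b bj].
    by rewrite !mxE ltnNge (ltnW ij) /= ij eqxx mulr1.
  by rewrite mxE ltnNge (ltnW ij) /= ij (negbTE bj) mulr0.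
have Zv (j : 'I_k) : (j < i)%N -> (Z^T *m v^T) j 0 = 0.
  move=> ji; rewrite -[RHS](vNj j) mxE; apply: eq_bigr => b _.
  by rewrite !mxE ji mulrC.
rewrite -!mulmxA sqn_orthonormal // -(sqn_orthonormal _ (orthonormal_cols_trmx ZZ)).
rewrite !sqn_cV mulr_sumr; apply: ler_sum => j _.
rewrite mul_diag_mx !mxE exprMn.
have [ji|ij] := ltnP j i; first by have := Zv _ ji; rewrite mxE => ->; rewrite expr0n !mulr0.
by apply: ler_wpM2r; [exact: sqr_ge0|rewrite ler_pXn2r ?nnegrE ?s0 // smono].
Qed.

(** Pythagoras: [u - X *m w] is the residual [r], orthogonal to the columns of [X], plus a vector in
    their span. *)
Lemma sqn_proj_le a b (X : 'M[R]_(a, b)) (u : 'cV[R]_a) (w : 'cV[R]_b) :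
  orthonormal_cols X -> sqn ((1%:M - X *m X^T) *m u) <= sqn (u - X *m w).
Proof.
move=> XX; set r := _ *m u.
have -> : u - X *m w = r + X *m (X^T *m u - w).
  by rewrite /r mulmxBl mul1mx mulmxBr !mulmxA addrA subrK.
have Xr : r^T *m X = 0.
  rewrite -(trmxK (r^T *m X)) trmx_mul trmxK /r mulmxA mulmxBr mulmx1 mulmxA XX.
  by rewrite mul1mx subrr mul0mx trmx0.
by rewrite sqnD mulmxA Xr mul0mx mxtrace0 mulr0 addr0 lerDl sqn_ge0.
Qed.

(** Here [t] bounds the tangent of the angle between [Y *m v] and the vector [Y *m v + z] of the
    range of [X], so [t / sqrt (1 + t^2)] bounds its sine. Minimax needs this only on the span of
    the first [i + 1] basis vectors. *)
Lemma sin_principal_angles_le a b k (X : 'M[R]_(a, b)) (Y : 'M[R]_(a, k))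
    (s : 'I_k -> R) (i : 'I_k) (t : R) :
  orthonormal_cols X -> orthonormal_cols Y -> sin_principal_angles X Y s ->
  0 <= t ->
  (forall v : 'cV[R]_k, (forall j : 'I_k, (i < j)%N -> v j 0 = 0) ->
    exists (z : 'cV[R]_a) (w : 'cV[R]_b),
      [/\ Y *m v + z = X *m w, Y^T *m z = 0 & sqn z <= t ^+ 2 * sqn v]) ->
  s i <= t / Num.sqrt (1 + t ^+ 2).
Proof.
move=> XX YY XYs t0 H.
have si0 : 0 <= s i by case: XYs => + _; exact.
have [v [v0 vi sv]] := sorted_svals_le i XYs.
have [z [w [YvX Yz zt]]] := H v vi.
have Sv := sqn_gt0 v0; have z0 := sqn_ge0 z.
set S := sqn v in Sv sv zt; set Q := sqn z in z0 zt.
(* [c *: (Y *m v + z)] is the point of that line nearest to [Y *m v]; the squared distance is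
   [S Q / (S + Q)]. *)
pose c := S / (S + Q).
have := sqn_proj_le (Y *m v) (c *: w) XX; rewrite mulmxA.
rewrite -scalemxAr -YvX.
have -> : Y *m v - c *: (Y *m v + z) = (1 - c) *: (Y *m v) + (- c) *: z.
  by rewrite scalerDr scalerBl scale1r scaleNr opprD addrA.
rewrite sqnD !sqnZ sqn_orthonormal // -/S -/Q.
have -> : \tr (((1 - c) *: (Y *m v))^T *m (- c *: z)) = 0.
  rewrite (_ : (_ *: _)^T = (1 - c) *: (Y *m v)^T); last exact: linearZ.
  by rewrite -scalemxAr -scalemxAl trmx_mul -mulmxA Yz mulmx0 !scaler0 mxtrace0.
rewrite mulr0 addr0 => /(le_trans sv).
have -> : (1 - c) ^+ 2 * S + (- c) ^+ 2 * Q = S * (Q / (S + Q)).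
  by rewrite /c; field; lra.
rewrite mulrC ler_pM2l // => siQ.
have t1 : 0 < 1 + t ^+ 2 by rewrite ltr_wpDr // sqr_ge0.
rewrite -(ler_pXn2r (_ : (0 < 2)%N)) ?nnegrE ?divr_ge0 ?sqrtr_ge0 //.
rewrite exprMn exprVn (sqr_sqrtr (ltW t1)); apply: (le_trans siQ).
rewrite ler_pdivrMr ?ltr_wpDr // mulrAC ler_pdivlMr //.
nra.
Qed.

End LinearAlgebra.

(** * Sines of the angles of a run, bounded by the ratio of the Gaussian blocks *)

Section Deterministic.
Variable R : realType.

Lemma rank_cols_inj a b (M : 'M[R]_(a, b)) :
  \rank M = b <-> forall v : 'cV[R]_b, M *m v = 0 -> v = 0.
Proof.
rewrite -mxrank_tr; split=> [rM v Mv0|Minj].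
  have /row_free_inj inj : row_free M^T by apply/eqP.
  rewrite -[v]trmxK -[RHS]trmx0; congr trmx; apply: inj.
  by rewrite mul0mx -trmx_mul Mv0 trmx0.
apply/eqP; rewrite -/(row_free _) -kermx_eq0; apply/eqP/row_matrixP => i.
rewrite row0 -[row i _]trmxK; apply: (canLR (@trmxK _ _ _)); rewrite trmx0.
apply: Minj; rewrite -{1}[M]trmxK -trmx_mul -row_mul mulmx_ker row0.
by rewrite trmx0.
Qed.

(* The Moore-Penrose inverse of a matrix of full row rank; the formula is total,
   and measurable in [G], because [0^-1 = 0]. *)
Definition pinv k d (G : 'M[R]_(k, d)) : 'M[R]_(d, k) :=
  G^T *m ((\det (G *m G^T))^-1 *: \adj (G *m G^T)).

Lemma mulmx_pinv k d (G : 'M[R]_(k, d)) :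
  \det (G *m G^T) != 0 -> G *m pinv G = 1%:M.
Proof.
by move=> d0; rewrite mulmxA -scalemxAr mul_mx_adj scale_scalar_mx mulVf.
Qed.

Lemma det_gram_neq0 k d (G : 'M[R]_(k, d)) : \rank G = k -> \det (G *m G^T) != 0.
Proof.
rewrite -mxrank_tr => /rank_cols_inj Ginj.
apply/negP => /det0P [v v0 vG].
have : sqn (v *m G) == 0.
  by rewrite -sqn_trmx sqnE trmxK trmx_mul mulmxA -(mulmxA v) vG mul0mx mxtrace0.
rewrite sqn_eq0 => /eqP vG0; move/negP: v0; apply.
by rewrite -trmx_eq0; apply/eqP/Ginj; rewrite -trmx_mul vG0 trmx0.
Qed.

(** The sum has at most one term, and none when [i >= b], so one formula serves tall and wide
    diagonals. *)
Lemma mul_diag_rectE a b c (s : nat -> R) (M : 'M[R]_(b, c)) i j :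
  (diag_rect a b s *m M) i j = \sum_(h < b | h == i :> nat) s i * M h j.
Proof.
rewrite mxE [RHS]big_mkcond /=; apply: eq_bigr => h _; rewrite mxE eq_sym.
by case: ifP => _ //; rewrite mul0r.
Qed.

Lemma sqn_diag_rect_le a b (s : nat -> R) (t : R) (y : 'cV[R]_b) :
  (forall i, (i < a)%N -> 0 <= s i <= t) ->
  sqn (diag_rect a b s *m y) <= t ^+ 2 * sqn y.
Proof.
move=> st; rewrite !sqn_cV mulr_sumr.
rewrite (bigID (fun h : 'I_b => (h < a)%N)) /=.
apply: ler_wpDr; first by apply: sumr_ge0 => h _; rewrite mulr_ge0 // sqr_ge0.
have E i : (diag_rect a b s *m y) i 0 ^+ 2 =
    \sum_(h < b | h == i :> nat) (s i * y h 0) ^+ 2.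
  rewrite mul_diag_rectE; have [ib|ib] := ltnP i b.
    rewrite !(big_pred1 (Ordinal ib)) // => h.
  by rewrite !big1 ?expr0n // => h /eqP hi; move: (ltn_ord h); rewrite hi ltnNge ib.
under eq_bigr do rewrite E.
rewrite (exchange_big_dep (fun h : 'I_b => (h < a)%N)) /=; last first.
  by move=> i h _ /eqP ->.
apply: ler_sum => h ha.
rewrite (big_pred1 (Ordinal ha)) => [|i]; last by rewrite eq_sym.
have /andP[s0 s1] := st h ha.
by rewrite exprMn ler_wpM2r ?sqr_ge0 // ler_pXn2r ?nnegrE // (le_trans s0).
Qed.

(** One statement for both factors: [X] is [U] or [V], and [tau] the matching power of [sigma]. The
    range of [Q] contains [X diag(tau) Psi y]. With [y = pinv Psi1 x] the upper block of [Psi y] is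
    [x], and dividing by [tau] in advance makes the upper block of the image equal to [v]. The lower
    block is damped by [tau k], while the division costs at most [1 / tau i]. *)
Lemma sin_angle_power_le k l l' d (X : 'M[R]_(k + l')) (tau : nat -> R)
    (Psi : 'M[R]_(k + l, d)) (Q : 'M[R]_(k + l', d)) (T : 'M[R]_d)
    (s : 'I_k -> R) (i : 'I_k) (c : R) :
  orthonormal_cols X ->
  (forall j, (k <= j < k + l')%N -> 0 <= tau j <= tau k) ->
  0 < tau i -> (forall j, (j <= i)%N -> tau i <= tau j) ->
  0 <= tau k ->
  \rank (usubmx Psi) = k ->
  0 <= c ->
  (forall x : 'cV[R]_k,
    sqn (dsubmx Psi *m pinv (usubmx Psi) *m x) <= c ^+ 2 * sqn x) ->
  orthonormal_cols Q ->
  X *m diag_rect (k + l') (k + l) tau *m Psi = Q *m T ->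
  sin_principal_angles Q (lead_cols k X) s ->
  s i <= (tau k / tau i * c) / Num.sqrt (1 + (tau k / tau i * c) ^+ 2).
Proof.
move=> XX tau_le ti taui tk rPsi c0 cB QQ XQ Qs; set t := _ * c.
have pidE (v : 'cV[R]_k) : (pid_mx k : 'M[R]_(k + l', k)) *m v = col_mx v 0.
  by rewrite pid_mx_col mul_col_mx mul1mx mul0mx.
have YY : orthonormal_cols (lead_cols k X).
  apply: orthonormal_colsM => //; rewrite /orthonormal_cols tr_pid_mx.
  by rewrite pid_mx_row pid_mx_col mul_row_col mulmx1 mulmx0 addr0.
apply: (sin_principal_angles_le QQ YY Qs); first by rewrite !mulr_ge0 // invr_ge0 ltW.
move=> v vi.
(* Beyond [i], where [tau j] may vanish, [v j 0] is zero and so is the quotient. *)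
pose x : 'cV[R]_k := \col_j (v j 0 / tau j).
pose y := pinv (usubmx Psi) *m x.
have Psiy : Psi *m y = col_mx x (dsubmx Psi *m y).
  rewrite -{1}(vsubmxK Psi) mul_col_mx mulmxA mulmx_pinv ?mul1mx //.
  exact: det_gram_neq0.
pose S2 := diag_rect l' l (fun j => tau (k + j)%N).
have SE (u : 'cV[R]_l) : diag_rect (k + l') (k + l) tau *m col_mx x u
    = col_mx v (S2 *m u).
  apply/matrixP => a b; rewrite !ord1 mul_diag_rectE.
  case: (split_ordP a) => j ->.
    rewrite col_mxEu (big_pred1 (lshift l j)) => [|h]; last by [].
    rewrite col_mxEu mxE; have [ji|ij] := leqP j i.
      by rewrite mulrCA divff ?mulr1 // gt_eqF // (lt_le_trans ti) // taui.
    by rewrite vi // mul0r mulr0.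
  rewrite col_mxEd mul_diag_rectE.
  rewrite big_split_ord /= big1 ?add0r => [|h /eqP hk]; last first.
    by have := ltn_ord h; rewrite hk ltnNge leq_addr.
  by apply: eq_big => [h|h _]; rewrite ?eqn_add2l ?col_mxEd.
exists (X *m col_mx 0 (S2 *m (dsubmx Psi *m y))), (T *m y); split.
- rewrite /lead_cols -mulmxA pidE -mulmxDr add_col_mx addr0 add0r.
  by rewrite [RHS]mulmxA -XQ -!mulmxA Psiy SE.
- rewrite /lead_cols trmx_mul -mulmxA (mulmxA X^T) XX mul1mx.
  by rewrite tr_pid_mx pid_mx_row mul_row_col mulmx0 mul0mx addr0.
- rewrite sqn_orthonormal // sqn_col_mx sqn0 add0r.
  apply: (le_trans (sqn_diag_rect_le (t := tau k) _ _)).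
    by move=> j jl; apply: tau_le; rewrite leq_addr ltn_add2l.
  have -> : t ^+ 2 * sqn v = tau k ^+ 2 * (c ^+ 2 * ((tau i)^-1 ^+ 2 * sqn v)).
    by rewrite /t; ring.
  rewrite ler_wpM2l ?sqr_ge0 // /y mulmxA (le_trans (cB _)) // ler_wpM2l ?sqr_ge0 //.
  rewrite !sqn_cV mulr_sumr; apply: ler_sum => j _.
  rewrite mxE exprMn mulrC; have [ji|ij] := leqP j i.
    have tj : 0 < tau j by rewrite (lt_le_trans ti) // taui.
    rewrite ler_wpM2r ?sqr_ge0 // ler_pXn2r ?nnegrE ?invr_ge0 ?(ltW ti) ?(ltW tj) //.
    by rewrite lef_pV2 ?posrE // taui.
  by rewrite vi // expr0n !mulr0.
Qed.

Lemma eq_diag_rect a b (s t : nat -> R) :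
  (forall i, (i < a)%N -> (i < b)%N -> s i = t i) ->
  diag_rect a b s = diag_rect a b t.
Proof.
move=> st; apply/matrixP => i j; rewrite !mxE; case: eqP => // ij.
by rewrite st // ij.
Qed.

Lemma tr_diag_rect a b (s : nat -> R) : (diag_rect a b s)^T = diag_rect b a s.
Proof. by apply/matrixP => i j; rewrite !mxE eq_sym; case: eqP => // ->. Qed.

Lemma mul_diag_rect a b c (s t : nat -> R) :
  diag_rect a b s *m diag_rect b c t =
  diag_rect a c (fun i => if (i < b)%N then s i * t i else 0).
Proof.
apply/matrixP => i j; rewrite mul_diag_rectE mxE; have [ib|bi] := ltnP i b.
  rewrite (big_pred1 (Ordinal ib)) // mxE /=.
  by case: eqP => // _; rewrite mulr0.
rewrite big1 ?if_same // => h /eqP hi.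
by have := ltn_ord h; rewrite hi ltnNge bi.
Qed.

Section RUQLP.
Variables (k l l' d q : nat).
Local Notation m := (k + l)%N.
Local Notation n := (k + l')%N.
Variables (A : 'M[R]_(m, n)) (U : 'M[R]_m) (V : 'M[R]_n) (sigma : nat -> R).
Hypotheses (nm : (n <= m)%N) (k0 : (0 < k)%N) (kn : (k < n)%N).
Hypotheses (UU : orthonormal_cols U) (VV : orthonormal_cols V).
Hypothesis sigma_mono : forall i j, (i <= j)%N -> (j < n)%N -> sigma j <= sigma i.
Hypothesis sigma_ge0 : forall i, (i < n)%N -> 0 <= sigma i.
Hypothesis Asvd : A = U *m diag_rect m n sigma *m V^T.
Hypothesis sigmak : 0 < sigma k.-1.

Let B := (A^T *m A) ^+ q *m A^T.

Lemma svd_power :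
  B = V *m diag_rect n m (fun i => sigma i ^+ (2 * q + 1)) *m U^T.
Proof.
have At : A^T = V *m diag_rect n m sigma *m U^T.
  by rewrite Asvd !trmx_mul trmxK tr_diag_rect mulmxA.
rewrite /B; elim: q => [|r IH].
  by rewrite expr0 mul1mx.
rewrite exprS -[_ * _]/(_ *m _) -mulmxA IH {1}At Asvd.
rewrite -!mulmxA (mulmxA U^T) UU mul1mx (mulmxA V^T) VV mul1mx.
congr (V *m _); rewrite !mulmxA; congr (_ *m U^T).
rewrite !mul_diag_rect; apply: eq_diag_rect => i ni mi.
by rewrite ni mi -mulrA -!exprS -addnS; congr (_ ^+ _); lia.
Qed.

(** The range of [A *m B *m Phi] is that of [Q]. Values of [sigma] from [n] on are arbitrary, hence
    the explicit zeros on the [m] by [m] diagonal. *)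
Lemma svd_powerS : A *m B = U *m diag_rect m m
  (fun i => if (i < n)%N then sigma i ^+ (2 * q + 2) else 0) *m U^T.
Proof.
rewrite svd_power Asvd -!mulmxA (mulmxA V^T) VV mul1mx.
congr (U *m _); rewrite !mulmxA mul_diag_rect; congr (_ *m _).
apply: eq_diag_rect => i _ _; case: ifP => // _.
by rewrite -exprS; congr (_ ^+ _); lia.
Qed.

(** [A] is injective on the range of [B]: in singular coordinates, [sigma i ^+ (2 * q + 2)] and
    [sigma i ^+ (2 * q + 1)] vanish together. This gives [A *m Pbar] full column rank, so that its
    QR factorization exists. *)
Lemma rank_mul_range (Phi : 'M[R]_(m, d)) :
  \rank (B *m Phi) = d -> \rank (A *m (B *m Phi)) = d.
Proof.
move=> /rank_cols_inj Binj; apply/rank_cols_inj => v ABv; apply: Binj.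
have Uinj (w : 'cV[R]_m) : U *m w = 0 -> w = 0.
  by move=> Uw; rewrite -[w]mul1mx -UU -mulmxA Uw mulmx0.
rewrite (mulmxA A) svd_powerS -!mulmxA in ABv; move/Uinj/matrixP : ABv => D0.
rewrite svd_power -!mulmxA; set w := U^T *m _ in D0 *.
suff -> : diag_rect n m (fun i => sigma i ^+ (2 * q + 1)) *m w = 0 by rewrite mulmx0.
apply/matrixP => i j; rewrite mul_diag_rectE mxE ord1.
have im : (i < m)%N by rewrite (leq_trans (ltn_ord i)).
have := D0 (Ordinal im) 0; rewrite mul_diag_rectE mxE /= ltn_ord.
rewrite !(big_pred1 (Ordinal im)) // => /eqP; rewrite mulf_eq0 expf_eq0 /=.
by case/orP => [/andP[_ /eqP ->]|/eqP ->]; rewrite ?expr0n ?addn1 /= ?mul0r ?mulr0.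
Qed.

(** The sines are those of every run, so it suffices to build one with [qr_exists] and read both
    angles off it. *)
Lemma ruqlp_sines_le (Phi : 'M[R]_(m, d)) (sin_th sin_ph : 'I_k -> R)
    (i : 'I_k) (c : R) :
  \rank (B *m Phi) = d -> \rank ((lead_cols k U)^T *m Phi) = k ->
  (forall Pbar Q Rm Pt Rt, ruqlp_run q A Phi Pbar Q Rm Pt Rt ->
      sin_principal_angles Q (lead_cols k U) sin_th /\
      sin_principal_angles (Pbar *m Pt) (lead_cols k V) sin_ph) ->
  0 <= c ->
  (forall x : 'cV[R]_k, sqn (dsubmx (U^T *m Phi) *m pinv (usubmx (U^T *m Phi)) *m x)
                        <= c ^+ 2 * sqn x) ->
  let g t := t / Num.sqrt (1 + t ^+ 2) in
  let delta := sigma k / sigma i in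
  sin_th i <= g (delta ^+ (2 * q + 2) * c) /\ sin_ph i <= g (delta ^+ (2 * q + 1) * c).
Proof.
move=> rB rPhi run c0 cB g delta.
have [Pbar [T0 [PP _ BP]]] := qr_exists rB.
have rT0 : \rank T0 = d.
  apply/eqP; rewrite eqn_leq rank_leq_row /= -{1}rB BP.
  exact: mxrankM_maxr.
have T0u : T0^T \in unitmx.
  by rewrite unitmx_tr -row_full_unit /row_full rT0.
have rAP : \rank (A *m Pbar) = d.
  apply/eqP; rewrite eqn_leq rank_leq_col /= -{1}(rank_mul_range rB) BP mulmxA.
  exact: mxrankM_maxl.
have [Q [Rm [QQ uRm AP]]] := qr_exists rAP.
have rRm : \rank Rm^T = d.
  rewrite mxrank_tr; apply/eqP; rewrite eqn_leq rank_leq_row /= -{1}rAP AP.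
  exact: mxrankM_maxr.
have [Pt [Rt [PtPt uRt RPt]]] := qr_exists rRm.
have /run[th ph] : ruqlp_run q A Phi Pbar Q Rm Pt Rt.
  do ![split=> //]; apply/eqmxP; rewrite -/B BP trmx_mul.
  by apply/eqmx_sym/eqmxMfull; rewrite row_full_unit.
have si : 0 < sigma i.
  have kn1 : (k.-1 < n)%N by apply: leq_ltn_trans kn; exact: leq_pred.
  by apply: lt_le_trans sigmak (sigma_mono _ kn1); rewrite -ltnS prednK.
have rPsi : \rank (usubmx (U^T *m Phi)) = k.
  rewrite -[RHS]rPhi; congr (\rank _).
  rewrite /lead_cols trmx_mul tr_pid_mx pid_mx_row -mulmxA -{2}(vsubmxK (_ *m Phi)).
  by rewrite mul_row_col mul1mx mul0mx addr0.
have mono j : (k <= j)%N -> (j < n)%N -> 0 <= sigma j <= sigma k.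
  by move=> kj jn; rewrite sigma_ge0 // sigma_mono.
have mono2 (j : nat) : (j <= i)%N -> sigma i <= sigma j.
  by move=> ji; rewrite sigma_mono // (ltn_trans _ kn).
have i_n : (i < n)%N by rewrite (ltn_trans _ kn).
have k_n : 0 <= sigma k by rewrite sigma_ge0.
rewrite /delta !expr_div_n; split.
- pose tau j := if (j < n)%N then sigma j ^+ (2 * q + 2) else 0.
  have tk : tau k = sigma k ^+ (2 * q + 2) by rewrite /tau kn.
  have ti : tau i = sigma i ^+ (2 * q + 2) by rewrite /tau i_n.
  rewrite -tk -ti.
  apply: (@sin_angle_power_le _ l l d U tau _ Q (Rm *m T0) _ _ _ UU _ _ _ _ rPsi) => //.
  + move=> j /andP[kj _]; rewrite tk /tau; case: ifP => jn.
      have /andP[? ?] := mono j kj jn.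
      by rewrite exprn_ge0 //= lerXn2r ?nnegrE.
    by rewrite lexx exprn_ge0.
  + by rewrite ti exprn_gt0.
  + move=> j ji; rewrite ti /tau (leq_ltn_trans ji i_n).
    by rewrite lerXn2r ?nnegrE ?(ltW si) ?mono2 // (le_trans (ltW si)) // mono2.
  + by rewrite tk exprn_ge0.
  + by rewrite mulmxA -svd_powerS -mulmxA BP !mulmxA AP.
(* [Pt] is square orthogonal, so [Pbar *m Pt] has the range of [Pbar], which is that of [B *m Phi]:
   one factor [A] fewer than for [Q]. *)
- pose tau j := sigma j ^+ (2 * q + 1).
  apply: (@sin_angle_power_le _ l l' d V tau _ (Pbar *m Pt) (Pt^T *m T0)
            _ _ _ VV _ _ _ _ rPsi) => //.
  + move=> j /andP[kj jn]; have /andP[? ?] := mono j kj jn.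
    by rewrite exprn_ge0 //= lerXn2r ?nnegrE.
  + by rewrite exprn_gt0.
  + move=> j ji.
    by rewrite lerXn2r ?nnegrE ?(ltW si) ?mono2 // (le_trans (ltW si)) // mono2.
  + by rewrite exprn_ge0.
  + exact: orthonormal_colsM.
  + rewrite mulmxA -svd_power BP mulmxA -(mulmxA Pbar Pt) orthonormal_cols_tr //.
    by rewrite mulmx1.
Qed.

End RUQLP.

End Deterministic.

(** * Matrices with iid Gaussian entries *)

(* Matrices with the product sigma-algebra; the alias is needed because the
   canonical [pointedType] structure of ['M[T]_(a, b)] asks for a topological [T]. *)
Definition mxspace (R : realType) (a b : nat) : Type := 'M[R]_(a, b).

Section MatrixMeasurable.
Variables (R : realType) (a b : nat).

HB.instance Definition _ := Choice.on (mxspace R a b).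
HB.instance Definition _ := isPointed.Build (mxspace R a b) (0 : 'M[R]_(a, b)).

Definition mx_box (B : 'I_a -> 'I_b -> set R) : set (mxspace R a b) :=
  [set M : 'M[R]_(a, b) | forall i j, B i j (M i j)].

Definition mx_boxes : set (set (mxspace R a b)) :=
  [set X | exists2 B, (forall i j, measurable (B i j)) & X = mx_box B].

HB.instance Definition _ := @isMeasurable.Build (sigma_display mx_boxes)
  (mxspace R a b) <<s mx_boxes >> (@sigma_algebra0 _ setT mx_boxes)
  (@sigma_algebraC _ mx_boxes) (@sigma_algebra_bigcup _ setT mx_boxes).

End MatrixMeasurable.

Section MatrixMeasurableFun.
Variables (R : realType).

Lemma measurable_mx_box a b (B : 'I_a -> 'I_b -> set R) :
  (forall i j, measurable (B i j)) -> measurable (mx_box B).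
Proof. by move=> mB; apply: sub_sigma_algebra; exists B. Qed.

Lemma measurable_coord a b i j :
  measurable_fun setT (fun M : mxspace R a b => M i j : R).
Proof.
move=> _ Y mY; rewrite setTI.
pose B i' j' : set R := if (i' == i) && (j' == j) then Y else setT.
rewrite (_ : _ @^-1` _ = mx_box B); last first.
  apply/seteqP; split => M /=.
    by move=> MY i' j'; rewrite /B; case: ifP => // /andP[/eqP -> /eqP ->].
  by move=> /(_ i j); rewrite /B !eqxx.
by apply: measurable_mx_box => i' j'; rewrite /B; case: ifP.
Qed.

Lemma mx_box_bigsetI a b (B : 'I_a -> 'I_b -> set R) (T : Type)
    (X : T -> mxspace R a b) :
  X @^-1` mx_box B =
  \big[setI/setT]_(i < a) \big[setI/setT]_(j < b) ((fun w => X w i j) @^-1` B i j).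
Proof.
rewrite -bigcap_seq; apply/seteqP; split => w /=.
  by move=> XB i _; rewrite -bigcap_seq => j _; exact: XB.
move=> XB i j; have := XB i; rewrite /= mem_index_enum -bigcap_seq => /(_ isT j).
by rewrite /= mem_index_enum; apply.
Qed.

Lemma measurable_fun_mx d (T : measurableType d) a b (f : T -> mxspace R a b) :
  (forall i j, measurable_fun setT (fun w => f w i j : R)) -> measurable_fun setT f.
Proof.
move=> mf; apply: (measurability (@mx_boxes R a b)) => //.
move=> _ [_ [B mB ->] <-]; rewrite setTI mx_box_bigsetI.
apply: bigsetI_measurable => i _; apply: bigsetI_measurable => j _.
by rewrite -[X in measurable X]setTI; exact: mf.
Qed.

Lemma measurable_fun_coord d (T : measurableType d) a b (f : T -> mxspace R a b) i j :
  measurable_fun setT f -> measurable_fun setT (fun w => f w i j : R).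
Proof. by move=> mf; exact: measurableT_comp (measurable_coord i j) mf. Qed.

Lemma measurable_mulmx d (T : measurableType d) a b c
    (f : T -> mxspace R a b) (g : T -> mxspace R b c) :
  measurable_fun setT f -> measurable_fun setT g ->
  measurable_fun setT (fun w => (f w : 'M[R]_(a, b)) *m g w : mxspace R a c).
Proof.
move=> mf mg; apply: measurable_fun_mx => i j.
under eq_fun do rewrite mxE.
apply: measurable_sum => h.
by apply: measurable_funM; exact: measurable_fun_coord.
Qed.

(** Writing [x^-1] as [x (|x|^-1)^2] reduces the claim to real powers; at [0] both sides are [0]. *)
Lemma measurable_funV d (T : measurableType d) (f : T -> R) :
  measurable_fun setT f -> measurable_fun setT (fun w => (f w)^-1).
Proof.
move=> mf; have E w : (f w)^-1 = f w * (`|f w| `^ (-1)) ^+ 2.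
  rewrite powR_inv1 // exprVn real_normK ?num_real //.
  by have [->|f0] := eqVneq (f w) 0; [rewrite mul0r invr0|field].
under eq_fun do rewrite E.
apply: measurable_funM => //; apply: measurable_funX.
apply: (measurableT_comp (measurable_powR _)).
exact: measurableT_comp.
Qed.

End MatrixMeasurableFun.

Section Tonelli.
Context d1 d2 (T1 : measurableType d1) (T2 : measurableType d2) (R : realType).
Variables (m1 : {sigma_finite_measure set T1 -> \bar R}).
Variables (m2 : {sigma_finite_measure set T2 -> \bar R}).
Variable F : T1 -> T2 -> \bar R.
Hypothesis mF : measurable_fun setT (fun z : T1 * T2 => F z.1 z.2).
Hypothesis F0 : forall x y, (0 <= F x y)%E.

Lemma ge0_integral_swap :
  (\int[m1]_x \int[m2]_y F x y = \int[m2]_y \int[m1]_x F x y)%E.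
Proof. exact: (fubini_tonelli _ mF (fun z => F0 z.1 z.2)). Qed.

Lemma measurable_fun_integralr : measurable_fun setT (fun x => \int[m2]_y F x y)%E.
Proof. exact: (measurable_fun_fubini_tonelli_F _ mF (fun z => F0 z.1 z.2)). Qed.

Lemma measurable_fun_integrall : measurable_fun setT (fun y => \int[m1]_x F x y)%E.
Proof. exact: (measurable_fun_fubini_tonelli_G _ mF (fun z => F0 z.1 z.2)). Qed.

End Tonelli.
Arguments ge0_integral_swap {d1 d2 T1 T2 R m1 m2} F _ _.
Arguments measurable_fun_integralr {d1 d2 T1 T2 R m2} F _ _.
Arguments measurable_fun_integrall {d1 d2 T1 T2 R m1} F _ _.

(** * The law of a Gaussian matrix and the independence of its blocks *)

Section Laws.
Variable R : realType.
Local Notation gamma := (@normal_prob R 0 1).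

Definition gauss_box a b (B : 'I_a -> 'I_b -> set R) : \bar R :=
  (\prod_(i < a) \prod_(j < b) gamma (B i j))%E.

Lemma iid_measurable d (T : measurableType d) (P : probability T R) a b
    (X : T -> mxspace R a b) :
  iid_std_gaussian_mx P X -> measurable_fun setT X.
Proof. by case=> mX _; exact: measurable_fun_mx. Qed.

Lemma iid_box d (T : measurableType d) (P : probability T R) a b
    (X : T -> mxspace R a b) (B : 'I_a -> 'I_b -> set R) :
  iid_std_gaussian_mx P X -> (forall i j, measurable (B i j)) ->
  P (X @^-1` mx_box B) = gauss_box B.
Proof.
move=> [mX [lX jX]] mB; rewrite mx_box_bigsetI jX //.
by apply: eq_bigr => i _; apply: eq_bigr => j _; rewrite lX.
Qed.

(** A box that is full in all coordinates but one recovers a marginal law, so this single family of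
    identities contains both the marginals and the independence. *)
Lemma box_iid d (T : measurableType d) (P : probability T R) a b
    (X : T -> mxspace R a b) : measurable_fun setT X ->
  (forall B, (forall i j, measurable (B i j)) ->
    P (X @^-1` mx_box B) = gauss_box B) ->
  iid_std_gaussian_mx P X.
Proof.
move=> mX H.
have marg i j (B : set R) : measurable B ->
    P ((fun w => X w i j) @^-1` B) = gamma B.
  move=> mB; pose B' i' j' : set R := if (i' == i) && (j' == j) then B else setT.
  rewrite (_ : _ @^-1` _ = X @^-1` mx_box B'); last first.
    apply/seteqP; split => w /=.
      by move=> MY i' j'; rewrite /B'; case: ifP => // /andP[/eqP -> /eqP ->].
    by move=> /(_ i j); rewrite /B' !eqxx.
  rewrite H => [|i' j']; last by rewrite /B'; case: ifP.
  rewrite /gauss_box (bigD1 i) //= (bigD1 j) //= /B' !eqxx /=.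
  rewrite big1 ?mule1 => [|j' /negbTE ->]; last exact: probability_setT.
  rewrite big1 ?mule1 // => i' /negbTE ->.
  by rewrite big1 // => j' _; exact: probability_setT.
split; first by move=> i j; exact: measurable_fun_coord.
split=> [//|B mB]; rewrite -mx_box_bigsetI H //.
by apply: eq_bigr => i _; apply: eq_bigr => j _; rewrite marg.
Qed.

Section SameLaw.
Context d1 d2 (T1 : measurableType d1) (T2 : measurableType d2).
Variables (P : probability T1 R) (Q : probability T2 R) (a b : nat).
Variables (X : T1 -> mxspace R a b) (Y : T2 -> mxspace R a b).
Hypotheses (iX : iid_std_gaussian_mx P X) (iY : iid_std_gaussian_mx Q Y).

Let mX := iid_measurable iX.
Let mY := iid_measurable iY.
HB.instance Definition _ := isMeasurableFun.Build _ _ _ _ X mX.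
HB.instance Definition _ := isMeasurableFun.Build _ _ _ _ Y mY.

(** Boxes are stable under intersection and generate the sigma-algebra, and the two laws agree on
    them. *)
Lemma same_law (A : set (mxspace R a b)) : measurable A ->
  P (X @^-1` A) = Q (Y @^-1` A).
Proof.
move=> mA; rewrite -[LHS]/(pushforward P X A) -[RHS]/(pushforward Q Y A).
apply: (g_sigma_algebra_measure_unique (@mx_boxes R a b) _ (fun=> setT)) => //=.
- by move=> _ [B mB ->]; exact: measurable_mx_box.
- by move=> _; exists (fun _ _ => setT) => //; apply/seteqP; split.
- by apply/seteqP; split => // x _; exists 0%N.
- move=> _ _ [B mB ->] [C mC ->]; exists (fun i j => B i j `&` C i j).
    by move=> i j; exact: measurableI.
  apply/seteqP; split => M /=.
    by move=> [MB MC] i j; split; [exact: MB|exact: MC].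
  by move=> MBC; split=> i j; have [] := MBC i j.
- by move=> _ [B mB ->]; rewrite /pushforward !iid_box.
- by move=> _; rewrite /pushforward preimage_setT probability_setT ltry.
Qed.

Lemma integral_same_law (F : mxspace R a b -> \bar R) :
  measurable_fun setT F -> (forall M, 0 <= F M)%E ->
  (\int[P]_w F (X w) = \int[Q]_w F (Y w))%E.
Proof.
move=> mF F0.
transitivity (\int[pushforward P X]_M F M)%E.
  by rewrite ge0_integral_pushforward.
transitivity (\int[pushforward Q Y]_M F M)%E; last by rewrite ge0_integral_pushforward.
by apply: eq_measure_integral => A mA _; exact: same_law.
Qed.

End SameLaw.

(** An invariance of the Gaussian law can be checked on one convenient model [Y]; below this is a
    product space, whose factors are treated separately. *)
Lemma iid_transfer d1 d2 (T1 : measurableType d1) (T2 : measurableType d2)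
    (P : probability T1 R) (Q : probability T2 R) a b a' b'
    (X : T1 -> mxspace R a b) (Y : T2 -> mxspace R a b)
    (g : mxspace R a b -> mxspace R a' b') :
  iid_std_gaussian_mx P X -> iid_std_gaussian_mx Q Y -> measurable_fun setT g ->
  iid_std_gaussian_mx Q (g \o Y) -> iid_std_gaussian_mx P (g \o X).
Proof.
move=> iX iY mg iY'; apply: box_iid.
  exact: measurableT_comp mg (iid_measurable iX).
move=> B mB; rewrite -(iid_box iY' mB).
apply: (same_law iX iY (A := g @^-1` mx_box B)); rewrite -[X in measurable X]setTI; apply: mg => //.
exact: measurable_mx_box.
Qed.

Lemma measurable_col_mx d (T : measurableType d) a1 a2 b
    (X : T -> mxspace R a1 b) (Y : T -> mxspace R a2 b) :
  measurable_fun setT X -> measurable_fun setT Y ->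
  measurable_fun setT (fun w => col_mx (X w : 'M[R]_(_, _)) (Y w) : mxspace R (a1 + a2) b).
Proof.
move=> mX mY; apply: measurable_fun_mx => i j; case: (split_ordP i) => i' ->.
  under eq_fun do rewrite col_mxEu.
  exact: measurable_fun_coord.
under eq_fun do rewrite col_mxEd.
exact: measurable_fun_coord.
Qed.

Lemma measurable_trmx d (T : measurableType d) a b (X : T -> mxspace R a b) :
  measurable_fun setT X ->
  measurable_fun setT (fun w => (X w : 'M[R]_(_, _))^T : mxspace R b a).
Proof.
move=> mX; apply: measurable_fun_mx => i j; under eq_fun do rewrite mxE.
exact: measurable_fun_coord.
Qed.

Lemma measurable_usubmx a1 a2 b : measurable_fun setT
  (fun M : mxspace R (a1 + a2) b => usubmx (M : 'M[R]_(_, _)) : mxspace R a1 b).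
Proof.
apply: measurable_fun_mx => i j; under eq_fun do rewrite mxE.
exact: measurable_coord.
Qed.

Lemma measurable_dsubmx a1 a2 b : measurable_fun setT
  (fun M : mxspace R (a1 + a2) b => dsubmx (M : 'M[R]_(_, _)) : mxspace R a2 b).
Proof.
apply: measurable_fun_mx => i j; under eq_fun do rewrite mxE.
exact: measurable_coord.
Qed.

Lemma iid_trmx d (T : measurableType d) (P : probability T R) a b
    (X : T -> mxspace R a b) :
  iid_std_gaussian_mx P X ->
  iid_std_gaussian_mx P (fun w => (X w : 'M[R]_(_, _))^T : mxspace R b a).
Proof.
move=> iX; apply: box_iid; first exact/measurable_trmx/iid_measurable/iX.
move=> B mB; rewrite (_ : _ @^-1` _ = X @^-1` mx_box (fun i j => B j i)).
  by rewrite iid_box // /gauss_box exchange_big.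
apply/seteqP; split => w /= XB i j; first by have := XB j i; rewrite mxE.
by rewrite mxE; exact: XB.
Qed.

Lemma gauss_box_split a1 a2 b (B : 'I_(a1 + a2) -> 'I_b -> set R) :
  gauss_box B = (gauss_box (fun i => B (lshift a2 i)) *
                 gauss_box (fun i => B (rshift a1 i)))%E.
Proof. by rewrite /gauss_box big_split_ord. Qed.

Lemma gauss_box_setT a b : gauss_box (fun (i : 'I_a) (j : 'I_b) => @setT R) = 1%E.
Proof.
by rewrite /gauss_box big1 // => i _; rewrite big1 // => j _; exact: probability_setT.
Qed.

Lemma iid_usubmx d (T : measurableType d) (P : probability T R) a1 a2 b
    (X : T -> mxspace R (a1 + a2) b) :
  iid_std_gaussian_mx P X ->
  iid_std_gaussian_mx P (fun w => usubmx (X w : 'M[R]_(_, _)) : mxspace R a1 b).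
Proof.
move=> iX; apply: box_iid.
  apply: measurable_fun_mx => i j; under eq_fun do rewrite mxE.
  exact: measurable_fun_coord (iid_measurable iX).
move=> B mB; pose B' (i : 'I_(a1 + a2)) : 'I_b -> set R :=
  match fintype.split i with inl i' => B i' | inr _ => fun=> setT end.
rewrite (_ : _ @^-1` _ = X @^-1` mx_box B').
  rewrite iid_box // => [|i j]; last by rewrite /B'; case: fintype.split.
  rewrite gauss_box_split -[RHS]mule1; congr (_ * _)%E.
    apply: eq_bigr => i _; apply: eq_bigr => j _.
    by rewrite /B' (unsplitK (inl i)).
  rewrite -(gauss_box_setT a2 b); apply: eq_bigr => i _; apply: eq_bigr => j _.
  by rewrite /B' (unsplitK (inr i)).
apply/seteqP; split => w /= XB i j.
  by rewrite /B'; case: (split_ordP i) => i' -> //; have := XB i' j; rewrite mxE.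
by have := XB (lshift a2 i) j; rewrite /B' (unsplitK (inl i)) mxE.
Qed.

Lemma iid_dsubmx d (T : measurableType d) (P : probability T R) a1 a2 b
    (X : T -> mxspace R (a1 + a2) b) :
  iid_std_gaussian_mx P X ->
  iid_std_gaussian_mx P (fun w => dsubmx (X w : 'M[R]_(_, _)) : mxspace R a2 b).
Proof.
move=> iX; apply: box_iid.
  apply: measurable_fun_mx => i j; under eq_fun do rewrite mxE.
  exact: measurable_fun_coord (iid_measurable iX).
move=> B mB; pose B' (i : 'I_(a1 + a2)) : 'I_b -> set R :=
  match fintype.split i with inl _ => fun=> setT | inr i' => B i' end.
rewrite (_ : _ @^-1` _ = X @^-1` mx_box B').
  rewrite iid_box // => [|i j]; last by rewrite /B'; case: fintype.split.
  rewrite gauss_box_split -[RHS]mul1e; congr (_ * _)%E.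
    rewrite -(gauss_box_setT a1 b); apply: eq_bigr => i _; apply: eq_bigr => j _.
    by rewrite /B' (unsplitK (inl i)).
  apply: eq_bigr => i _; apply: eq_bigr => j _.
  by rewrite /B' (unsplitK (inr i)).
apply/seteqP; split => w /= XB i j.
  by rewrite /B'; case: (split_ordP i) => i' -> //; have := XB i' j; rewrite mxE.
by have := XB (rshift a1 i) j; rewrite /B' (unsplitK (inr i)) mxE.
Qed.

Lemma iid_prod_col_mx d1 d2 (T1 : measurableType d1) (T2 : measurableType d2)
    (P : probability T1 R) (Q : probability T2 R) a1 a2 b
    (X : T1 -> mxspace R a1 b) (Y : T2 -> mxspace R a2 b) :
  iid_std_gaussian_mx P X -> iid_std_gaussian_mx Q Y ->
  iid_std_gaussian_mx (P \x Q)%E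
    (fun w => col_mx (X w.1 : 'M[R]_(_, _)) (Y w.2) : mxspace R (a1 + a2) b).
Proof.
move=> iX iY; apply: box_iid.
  apply: measurable_col_mx.
    exact: measurableT_comp (iid_measurable iX) _.
  exact: measurableT_comp (iid_measurable iY) _.
move=> B mB; rewrite gauss_box_split -(iid_box iX) // -(iid_box iY) //.
rewrite -product_measure1E.
- congr (_ \x _)%E; apply/seteqP; split => w /=.
    by move=> XB; split => i j; [have := XB (lshift a2 i) j|have := XB (rshift a1 i) j];
       rewrite ?col_mxEu ?col_mxEd.
  move=> [XB YB] i j; case: (split_ordP i) => i' ->; rewrite ?col_mxEu ?col_mxEd.
    exact: XB.
  exact: YB.
- rewrite -[X in measurable X]setTI; apply: (iid_measurable iX) => //.
  exact: measurable_mx_box.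
- rewrite -[X in measurable X]setTI; apply: (iid_measurable iY) => //.
  exact: measurable_mx_box.
Qed.

(** Independence of the two row blocks as an iterated integral: fixing [w] amounts to conditioning
    on the upper block. *)
Lemma integral_decouple d (T : measurableType d) (P : probability T R) a1 a2 b
    (X : T -> mxspace R (a1 + a2) b) (F : mxspace R (a1 + a2) b -> \bar R) :
  iid_std_gaussian_mx P X ->
  measurable_fun setT F -> (forall M, 0 <= F M)%E ->
  (\int[P]_w F (X w) = \int[P]_w \int[P]_w'
    F (col_mx (usubmx (X w : 'M[R]_(_, _))) (dsubmx (X w' : 'M[R]_(_, _)))))%E.
Proof.
move=> iX mF F0.
have iY := iid_prod_col_mx (iid_usubmx iX) (iid_dsubmx iX).
rewrite (integral_same_law iX iY mF F0).
rewrite fubini_tonelli1 //=.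
exact: measurableT_comp mF (iid_measurable iY).
Qed.

End Laws.

(** * Integrals against the normal density *)

Section NormalIntegral.
Variable R : realType.
Local Notation gamma := (@normal_prob R 0 1).
Local Notation mu := (@lebesgue_measure R).
Local Notation pdf := (@normal_pdf R 0 1).
Local Open Scope ereal_scope.

Let mpdf : measurable_fun setT (EFin \o pdf).
Proof. by apply/measurable_EFinP; exact: measurable_normal_pdf. Qed.

Let pdf0 x : 0 <= (pdf x)%:E.
Proof. by rewrite lee_fin normal_pdf_ge0. Qed.

Import HBNNSimple.

Let integral_normal_indic E : measurable E ->
  \int[mu]_x ((\1_E x)%:E * (pdf x)%:E) = gamma E.
Proof.
move=> mE; rewrite /normal_prob [RHS]integral_mkcond /=.
apply: eq_integral => x _; rewrite patchE indicE.
by case: (x \in E); rewrite ?mul1e ?mul0e.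
Qed.

Let integral_normal_nnsfun (f : {nnsfun measurableTypeR R >-> R}) :
  \int[gamma]_x (f x)%:E = \int[mu]_x ((f x)%:E * (pdf x)%:E).
Proof.
under [LHS]eq_integral do rewrite fimfunE -fsumEFin//.
rewrite [LHS]ge0_integral_fsum//; last 2 first.
  - by move=> r; exact/measurable_EFinP/measurableT_comp.
  - by move=> n x _; rewrite EFinM nnfun_muleindic_ge0.
under [RHS]eq_integral.
  move=> x xD; rewrite fimfunE -fsumEFin// ge0_mule_fsuml; last first.
    by move=> r; rewrite EFinM nnfun_muleindic_ge0.
  over.
rewrite [RHS]ge0_integral_fsum//; last 2 first.
  - move=> r; apply: emeasurable_funM => //.
    apply/measurable_EFinP. exact/measurable_funM.
  - by move=> n x _; rewrite EFinM mule_ge0// nnfun_muleindic_ge0.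
apply: eq_fsbigr => r _.
rewrite integralZl_indic_nnsfun//= integral_indic// setIT.
under eq_integral do rewrite EFinM -muleA.
have [r0|r0] := leP 0%R r.
  rewrite ge0_integralZl//.
  - by rewrite integral_normal_indic.
  - apply: emeasurable_funM => //; exact/measurable_EFinP/measurable_indic.
  - by move=> x _; rewrite mule_ge0 // lee_fin.
rewrite preimage_nnfun0 // measure0 mule0 integral0_eq // => x _.
by rewrite indicE in_set0 mul0e mule0.
Qed.

(** Indicators first, then simple functions, then monotone convergence. *)
Lemma ge0_integral_normal (f : measurableTypeR R -> \bar R) :
  measurable_fun setT f -> (forall x, 0 <= f x) ->
  \int[gamma]_x f x = \int[mu]_x (f x * (pdf x)%:E).
Proof.
move=> mf f0.
pose f_ := nnsfun_approx measurableT mf.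
transitivity (lim (\int[gamma]_x (f_ n x)%:E @[n --> \oo])).
  rewrite -monotone_convergence//=.
  - apply: eq_integral => ? /[!inE] xD; apply/esym/cvg_lim => //=.
    exact: cvg_nnsfun_approx.
  - by move=> n; exact/measurable_EFinP/measurable_funTS.
  - by move=> n ? _; rewrite lee_fin.
  - by move=> ? _ ? ? mn; rewrite lee_fin; exact/lefP/nd_nnsfun_approx.
rewrite [RHS](_ : _ = lim (\int[mu]_x ((f_ n x)%:E * (pdf x)%:E) @[n --> \oo])).
  by apply: congr_lim; apply/funext => n; exact: integral_normal_nnsfun.
rewrite -monotone_convergence//=.
- apply: eq_integral => x _; apply/esym/cvg_lim => //.
  by apply: cvgeZr => //; exact: cvg_nnsfun_approx.
- move=> n; apply: emeasurable_funM => //.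
  exact/measurable_EFinP/measurable_funTS.
- by move=> n x _; rewrite mule_ge0 // lee_fin.
- move=> x _ n p np; rewrite lee_wpmul2r // lee_fin.
  exact/lefP/nd_nnsfun_approx.
Qed.

End NormalIntegral.

(** * Affine substitutions and plane rotations *)

Section LebesgueAffine.
Variable R : realType.
Local Notation mu := (@lebesgue_measure R).

Lemma measurable_affine (a b : R) :
  measurable_fun setT (fun x : R => a * x + b : measurableTypeR R).
Proof. by apply: measurable_funD => //; exact: measurable_funM. Qed.

Section Affine.
Variables (a b : R).
Hypothesis a0 : a != 0.
Let phi (x : measurableTypeR R) : measurableTypeR R := a * x + b.
Let mphi : measurable_fun setT phi := @measurable_affine a b.
Let nu : {measure set (measurableTypeR R) -> \bar R} :=
  measure_function_pushforward__canonical__measure_function_Measure mu mphi.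
Let na : {nonneg R} := NngNum (normr_ge0 a).

(** Uniqueness of Lebesgue measure: the scaled image measure gives half-open intervals their length.
    A negative [a] reverses the interval and swaps its closed end. *)
Lemma lebesgue_measure_affine (A : set R) : measurable A ->
  mu A = mscale na nu A.
Proof.
move=> mA; apply: (lebesgue_measure_unique (mu := mscale na nu)) mA => _ [[u v]] _ <-.
rewrite -[RHS]/(`|a|%:E * mu (phi @^-1` `]u, v]%classic))%E.
rewrite lebesgue_measure_itv /= lte_fin.
have [a_gt0|a_lt0|a_eq0] := ltgtP 0 a; last by move: a0; rewrite -a_eq0 eqxx.
- rewrite (_ : phi @^-1` _ = `](u - b) / a, (v - b) / a]%classic); last first.
    apply/seteqP; split => x /=; rewrite !in_itv /= /phi.
      by rewrite ltr_pdivrMr // ler_pdivlMr // ltrBlDr lerBrDr mulrC.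
    by rewrite ltr_pdivrMr // ler_pdivlMr // ltrBlDr lerBrDr mulrC.
  rewrite lebesgue_measure_itv /= lte_fin ltr_pM2r ?invr_gt0 // ltrD2r.
  case: ifPn => _; rewrite ?mule0 // -!EFinB -EFinM gtr0_norm //.
  by congr EFin; field.
- rewrite (_ : phi @^-1` _ = `[(v - b) / a, (u - b) / a[%classic); last first.
    apply/seteqP; split => x /=; rewrite !in_itv /= /phi.
      by rewrite ler_ndivrMr // ltr_ndivlMr // ltrBlDr lerBrDr mulrC andbC.
    by rewrite ler_ndivrMr // ltr_ndivlMr // ltrBlDr lerBrDr mulrC andbC.
  rewrite lebesgue_measure_itv /= lte_fin ltr_nM2r ?invr_lt0 // ltrD2r.
  case: ifPn => _; rewrite ?mule0 // -!EFinB -EFinM ltr0_norm //.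
  by congr EFin; field.
Qed.

Lemma ge0_integral_affine (f : R -> \bar R) :
  measurable_fun setT f -> (forall x, 0 <= f x)%E ->
  (\int[mu]_x f x = `|a|%:E * \int[mu]_x f (a * x + b)%R)%E.
Proof.
move=> mf f0.
rewrite (eq_measure_integral (mscale na nu)); last first.
  by move=> A mA _; exact: lebesgue_measure_affine.
by rewrite ge0_integral_mscale //= (ge0_integral_pushforward mphi).
Qed.

End Affine.

Local Open Scope ereal_scope.

(** Two substitutions in one variable. At fixed [y] put [u = c x - s y], which turns the second
    coordinate into [(s / c) u + y / c]; at fixed [u] substitute for [y]. The Jacobians [|c|] and
    [1 / |c|] cancel; dividing by [c] requires it to be nonzero. *)
Lemma ge0_integral_rotation (c s : R) (G : R * R -> \bar R) :
  (c != 0)%R -> (c ^+ 2 + s ^+ 2 = 1)%R ->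
  measurable_fun setT G -> (forall x, 0 <= G x) ->
  \int[mu]_x \int[mu]_y G (c * x - s * y, s * x + c * y)%R =
  \int[mu]_x \int[mu]_y G (x, y).
Proof.
move=> c0 cs mG G0.
have mlin (p q : R) : measurable_fun setT (fun x : R * R => p * x.1 + q * x.2)%R.
  by apply: measurable_funD => //; apply: measurable_funM.
have mrot : measurable_fun setT
    (fun x : R * R => (c * x.1 - s * x.2, s * x.1 + c * x.2)%R).
  apply: measurable_fun_pair => //.
  by under eq_fun do rewrite -mulNr; exact: mlin.
have mGr := measurableT_comp mG mrot.
apply: (eq_trans (ge0_integral_swap (fun x y : measurableTypeR R =>
  G (c * x - s * y, s * x + c * y)%R) mGr (fun _ _ => G0 _))).
transitivity (\int[mu]_y (`|c|^-1%:E * \int[mu]_x G (x, s / c * x + c^-1 * y)%R)).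
  apply: eq_integral => y _.
  pose H (u : R) := G (u, s / c * u + c^-1 * y)%R.
  have mH : measurable_fun setT H.
    apply: measurableT_comp mG _; apply: measurable_fun_pair => //.
    by apply: measurable_funD => //; exact: measurable_funM.
  rewrite [X in _ * X](ge0_integral_affine (- s * y)%R c0 mH (fun _ => G0 _)).
  rewrite muleA -EFinM mulVf ?normr_eq0 //.
  rewrite mul1e; apply: eq_integral => x _; rewrite /H.
  congr (G (_, _)); first by ring.
  have -> : (s / c * (c * x + - s * y) + c^-1 * y =
             s * x + (1 - s ^+ 2) / c * y)%R by field.
  by rewrite -cs addrK expr2 mulfK.
have mG2 : measurable_fun setT
    (fun x : R * R => G (x.2, s / c * x.2 + c^-1 * x.1)%R).
  apply: measurableT_comp mG _; apply: measurable_fun_pair => //.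
  by under eq_fun do rewrite addrC; exact: mlin.
pose K (x y : measurableTypeR R) := G (x, s / c * x + c^-1 * y)%R.
transitivity (`|c|^-1%:E * \int[mu]_y \int[mu]_x K x y).
  have mK := measurable_fun_integralr (m2 := mu) (fun y x => K x y) mG2 (fun _ _ => G0 _).
  apply: ge0_integralZl; [exact: measurableT|exact: mK| |].
    by move=> y _; apply: integral_ge0 => x _; exact: G0.
  by rewrite lee_fin invr_ge0.
rewrite (ge0_integral_swap (fun y x => K x y) mG2 (fun _ _ => G0 _)).
transitivity (\int[mu]_x (`|c|^-1%:E * \int[mu]_y K x y)).
  have mK := measurable_fun_integrall (m1 := mu) (fun y x => K x y) mG2 (fun _ _ => G0 _).
  apply/esym/ge0_integralZl; [exact: measurableT|exact: mK| |].
    by move=> y _; apply: integral_ge0 => x _; exact: G0.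
  by rewrite lee_fin invr_ge0.
apply: eq_integral => x _.
have cV0 : (c^-1 != 0)%R by rewrite invr_eq0.
have mGx : measurable_fun setT (fun v => G (x, v)).
  by apply: measurableT_comp mG _; exact: measurable_fun_pair.
rewrite [RHS](ge0_integral_affine (s / c * x)%R cV0 mGx (fun _ => G0 _)).
rewrite normfV; congr (_ * _); apply: eq_integral => y _.
by rewrite addrC.
Qed.

End LebesgueAffine.

Section Rotation.
Variable R : realType.
Local Notation gamma := (@normal_prob R 0 1).
Local Notation mu := (@lebesgue_measure R).
Local Notation pdf := (@normal_pdf R 0 1).

Lemma normal_pdf01E (x : R) : pdf x = normal_peak 1 * expR (- x ^+ 2 / 2).
Proof.
by rewrite (normal_pdfE _ (oner_neq0 R)) /normal_fun subr0 expr1n.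
Qed.

Lemma normal_pdf01N (x : R) : pdf (- x) = pdf x.
Proof. by rewrite (normal_pdf01E x) (normal_pdf01E (- x)) sqrrN. Qed.

Lemma normal_pdf01M (x y u v : R) :
  x ^+ 2 + y ^+ 2 = u ^+ 2 + v ^+ 2 -> pdf x * pdf y = pdf u * pdf v.
Proof.
move=> E; rewrite (normal_pdf01E x) (normal_pdf01E y) (normal_pdf01E u).
rewrite (normal_pdf01E v) [LHS]mulrACA [RHS]mulrACA -!expRD.
by congr (_ * expR _); rewrite -!mulrDl -!opprD E.
Qed.

Local Open Scope ereal_scope.

Lemma normal_prob01_opp (A : set R) : measurable A ->
  gamma [set x | A (- x)%R] = gamma A.
Proof.
move=> mA; rewrite /normal_prob [LHS]integral_mkcond [RHS]integral_mkcond /=.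
have m1 : (-1 != 0 :> R)%R by rewrite oppr_eq0 oner_eq0.
have mf : measurable_fun setT ((fun x => (pdf x)%:E) \_ A).
  apply/(measurable_restrictT _ mA); apply: measurable_funTS.
  by apply/measurable_EFinP; exact: measurable_normal_pdf.
rewrite [RHS](ge0_integral_affine 0 m1 mf); last first.
  by move=> x; apply: erestrict_ge0 => y _; rewrite lee_fin normal_pdf_ge0.
rewrite normrN1 mul1e; apply: eq_integral => x _.
rewrite addr0 mulN1r !patchE normal_pdf01N.
by congr (if _ then _ else _); apply/idP/idP; rewrite !inE.
Qed.

(** The joint density depends only on [x^2 + y^2], which the rotation preserves. *)
Lemma ge0_integral_normal_rotation (c s : R) (F : R * R -> \bar R) :
  (c != 0)%R -> (c ^+ 2 + s ^+ 2 = 1)%R ->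
  measurable_fun setT F -> (forall x, 0 <= F x) ->
  \int[gamma]_x \int[gamma]_y F (c * x - s * y, s * x + c * y)%R =
  \int[gamma]_x \int[gamma]_y F (x, y).
Proof.
move=> c0 cs mF F0.
have dens (H : R * R -> \bar R) : measurable_fun setT H -> (forall x, 0 <= H x) ->
    \int[gamma]_x \int[gamma]_y H (x, y) =
    \int[mu]_x \int[mu]_y (H (x, y) * (pdf x * pdf y)%:E).
  move=> mH H0.
  have mHx x : measurable_fun setT (fun y => H (x, y)).
    by apply: measurableT_comp mH _; exact: measurable_fun_pair.
  have mH' : measurable_fun setT (fun z : R * R => H (z.1, z.2)).
    by rewrite (_ : (fun z => _) = H) //; apply/funext => -[].
  have mI := measurable_fun_integralr (m2 := gamma)
    (fun x y : measurableTypeR R => H (x, y)) mH' (fun _ _ => H0 _).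
  rewrite (ge0_integral_normal mI); last by move=> x; exact: integral_ge0.
  apply: eq_integral => x _.
  rewrite (ge0_integral_normal (mHx x) (fun y => H0 _)) muleC -ge0_integralZl //.
  - by apply: eq_integral => y _; rewrite muleCA EFinM.
  - apply: emeasurable_funM; first exact: mHx.
    by apply/measurable_EFinP; exact: measurable_normal_pdf.
  - by move=> y _; rewrite mule_ge0 // lee_fin normal_pdf_ge0.
  - by rewrite lee_fin normal_pdf_ge0.
have mlin (p q : R) : measurable_fun setT (fun x : R * R => p * x.1 + q * x.2)%R.
  by apply: measurable_funD => //; apply: measurable_funM.
have mrot : measurable_fun setT
    (fun x : R * R => (c * x.1 - s * x.2, s * x.1 + c * x.2)%R).
  apply: measurable_fun_pair => //.
  by under eq_fun do rewrite -mulNr; exact: mlin.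
have Drot := dens (fun x => F (c * x.1 - s * x.2, s * x.1 + c * x.2)%R)
  (measurableT_comp mF mrot) (fun _ => F0 _).
apply: (eq_trans Drot); rewrite (dens _ mF F0) {Drot dens}.
pose G (x : R * R) := F x * (pdf x.1 * pdf x.2)%:E.
have mG : measurable_fun setT G.
  apply: emeasurable_funM; first exact: mF.
  apply/measurable_EFinP.
  by apply: measurable_funM; exact: measurableT_comp (measurable_normal_pdf _ _) _.
have G0 x : 0 <= G x.
  by rewrite mule_ge0 // lee_fin mulr_ge0 // normal_pdf_ge0.
rewrite -(ge0_integral_rotation c0 cs mG G0); apply: eq_integral => x _.
apply: eq_integral => y _; rewrite /G /=; congr (_ * _%:E).
apply: normal_pdf01M.
rewrite -[LHS]mul1r -cs; ring.
Qed.

End Rotation.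

(** * Invariance of the Gaussian law under orthogonal matrices *)

Section Orthogonal.
Variable R : realType.
Local Notation gamma := (@normal_prob R 0 1).

(** Quantifying over all widths and sample spaces lets the property be applied to the blocks of a
    matrix separately. *)
Definition iid_preserving a (g : 'M[R]_a) := forall b d (T : measurableType d)
  (P : probability T R) (X : T -> mxspace R a b), iid_std_gaussian_mx P X ->
  iid_std_gaussian_mx P (fun w => g *m X w : mxspace R a b).

Lemma measurable_mulmxl a b c (g : 'M[R]_(a, b)) :
  measurable_fun setT (fun M : mxspace R b c => g *m M : mxspace R a c).
Proof. by apply: (@measurable_mulmx _ _ _ _ _ _ (cst g)). Qed.

Lemma iid_preservingM a (g h : 'M[R]_a) :
  iid_preserving g -> iid_preserving h -> iid_preserving (g *m h).
Proof.
move=> gP hP b d T P X iX; have := gP _ _ _ _ _ (hP _ _ _ _ _ iX).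
by congr iid_std_gaussian_mx; apply/funext => w; rewrite mulmxA.
Qed.

Lemma iid_preserving1 a : iid_preserving (1%:M : 'M[R]_a).
Proof.
move=> b d T P X; congr iid_std_gaussian_mx; apply/funext => w.
by rewrite mul1mx.
Qed.

Lemma iid_preserving_block a1 a2 (g : 'M[R]_a1) (h : 'M[R]_a2) :
  iid_preserving g -> iid_preserving h ->
  iid_preserving (block_mx g 0 0 h).
Proof.
move=> gP hP b d T P X iX.
have iY := iid_prod_col_mx (iid_usubmx iX) (iid_dsubmx iX).
apply: (iid_transfer iX iY (measurable_mulmxl _)).
have := iid_prod_col_mx (gP _ _ _ _ _ (iid_usubmx iX)) (hP _ _ _ _ _ (iid_dsubmx iX)).
congr iid_std_gaussian_mx; apply/funext => w /=.
by rewrite mul_block_col !mul0mx addr0 add0r.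
Qed.

(* It suffices to treat column vectors: columns are independent. *)
Lemma iid_preserving_col a (g : 'M[R]_a) :
  (forall d (T : measurableType d) (P : probability T R) (X : T -> mxspace R a 1),
    iid_std_gaussian_mx P X ->
    iid_std_gaussian_mx P (fun w => g *m X w : mxspace R a 1)) ->
  iid_preserving g.
Proof.
move=> g1; elim=> [|b IH] d T P X iX.
  apply: box_iid; first exact: measurableT_comp (measurable_mulmxl g) (iid_measurable iX).
  move=> B mB; rewrite /gauss_box big1 => [|i _]; last by rewrite big_ord0.
  rewrite (_ : _ @^-1` _ = setT) ?probability_setT //.
  by apply/seteqP; split => // w _ i [].
pose X' w : mxspace R (1 + b) a := (X w : 'M[R]_(a, 1 + b))^T.
have iX' : iid_std_gaussian_mx P X' by exact: (iid_trmx iX).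
have iY := iid_prod_col_mx (iid_usubmx iX') (iid_dsubmx iX').
pose gt (M : mxspace R (1 + b) a) : mxspace R (1 + b) a := M *m g^T.
have mgt : measurable_fun setT gt by apply: measurable_mulmx.
have : iid_std_gaussian_mx P (gt \o X').
  apply: (iid_transfer iX' iY mgt).
  have iU := iid_trmx (g1 _ _ _ _ (iid_trmx (iid_usubmx iX'))).
  have iD := iid_trmx (IH _ _ _ _ (iid_trmx (iid_dsubmx iX'))).
  have := iid_prod_col_mx iU iD.
  congr iid_std_gaussian_mx; apply/funext => w /=.
  by rewrite /gt mul_col_mx !trmx_mul !trmxK.
move=> /iid_trmx; congr iid_std_gaussian_mx; apply/funext => w /=.
by rewrite /gt /X' trmx_mul !trmxK.
Qed.

Lemma iid_preserving_sign (c : R) : c ^+ 2 = 1 -> iid_preserving (c%:M : 'M[R]_1).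
Proof.
move=> /eqP; rewrite sqrf_eq1 => /orP[]/eqP ->; first exact: iid_preserving1.
apply: iid_preserving_col => d T P X iX.
apply: box_iid; first exact: measurableT_comp (measurable_mulmxl _) (iid_measurable iX).
move=> B mB; pose B' (i j : 'I_1) : set R := [set x | B i j (- x)].
have mB' i j : measurable (B' i j).
  by have := @oppr_measurable R setT measurableT _ (mB i j); rewrite setTI.
rewrite (_ : _ @^-1` _ = X @^-1` mx_box B'); last first.
  by apply/seteqP; split => w /= H i j; have := H i j; rewrite /B' /= mul_scalar_mx mxE mulN1r.
rewrite iid_box // /gauss_box !big_ord1.
by rewrite normal_prob01_opp.
Qed.

Definition plane_rotation (c s : R) : 'M[R]_(1 + 1) :=
  block_mx c%:M (- s)%:M s%:M c%:M.

Lemma iid_normal11 :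
  iid_std_gaussian_mx gamma (fun x : R => (x%:M : 'M[R]_1) : mxspace R 1 1).
Proof.
apply: box_iid => [|B mB].
  apply: measurable_fun_mx => i j; rewrite !ord1.
  by under eq_fun do rewrite mxE eqxx mulr1n; exact: measurable_id.
rewrite /gauss_box !big_ord1; congr (gamma _).
apply/seteqP; split => x /=; first by move=> /(_ 0 0); rewrite mxE eqxx mulr1n.
by move=> Bx i j; rewrite !ord1 mxE eqxx mulr1n.
Qed.

Lemma iid_preserving_plane_neq0 (c s : R) : c != 0 -> c ^+ 2 + s ^+ 2 = 1 ->
  iid_preserving (plane_rotation c s).
Proof.
move=> c0 cs; apply: iid_preserving_col => d T P X iX.
have iid1 := iid_normal11.
have iY := iid_prod_col_mx iid1 iid1.
apply: (iid_transfer iX iY (measurable_mulmxl _)).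
apply: box_iid; first exact: measurableT_comp (measurable_mulmxl _) (iid_measurable iY).
move=> B mB; rewrite /gauss_box big_split_ord !big_ord1.
set B1 := B _ _; set B2 := B _ _.
pose F (z : R * R) : \bar R := (\1_(B1 `*` B2) z)%:E.
have mBB : measurable (B1 `*` B2) by apply: measurableX; exact: mB.
have mF : measurable_fun setT F by exact/measurable_EFinP/measurable_indic.
have F0 z : (0 <= F z)%E by rewrite lee_fin.
have mrot : measurable_fun setT
    (fun z : R * R => (c * z.1 - s * z.2, s * z.1 + c * z.2)).
  apply: measurable_fun_pair.
    by apply: measurable_funB => //; apply: measurable_funM.
  by apply: measurable_funD => //; apply: measurable_funM.
rewrite (_ : _ @^-1` _ =
    (fun z : R * R => (c * z.1 - s * z.2, s * z.1 + c * z.2)) @^-1` (B1 `*` B2)); last first.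
  apply/seteqP; split => -[x y] /=.
    move=> H; split.
      have := H (lshift 1 0) 0.
      by rewrite mul_block_col col_mxEu -!scalar_mxM -raddfD mxE eqxx mulr1n mulNr.
    have := H (rshift 1 0) 0.
    by rewrite mul_block_col col_mxEd -!scalar_mxM -raddfD mxE eqxx mulr1n.
  move=> [H1 H2] i j; rewrite !ord1; case: (split_ordP i) => i' ->; rewrite !ord1.
    by rewrite mul_block_col col_mxEu -!scalar_mxM -raddfD mxE eqxx mulr1n mulNr.
  by rewrite mul_block_col col_mxEd -!scalar_mxM -raddfD mxE eqxx mulr1n.
have mpre : measurable ((fun z : R * R => (c * z.1 - s * z.2, s * z.1 + c * z.2))
    @^-1` (B1 `*` B2)).
  by rewrite -[X in measurable X]setTI; exact: mrot.
transitivity (\int[gamma]_x \int[gamma]_y F (c * x - s * y, s * x + c * y)%R)%E.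
  rewrite -(setIT (_ @^-1` _)) -integral_indic // fubini_tonelli1 //.
  exact/measurable_EFinP/measurable_indic.
rewrite (ge0_integral_normal_rotation c0 cs mF F0).
rewrite -[RHS](product_measure1E gamma gamma (mB _ _) (mB _ _)).
rewrite -[in RHS](setIT (B1 `*` B2)) -integral_indic // fubini_tonelli1 //.
Qed.

Lemma iid_preserving_plane (c s : R) : c ^+ 2 + s ^+ 2 = 1 ->
  iid_preserving (plane_rotation c s).
Proof.
move=> cs; have [c0|c0] := eqVneq c 0; last exact: iid_preserving_plane_neq0.
(* a quarter turn is the square of an eighth turn *)
move: cs; rewrite c0 expr0n add0r => s1.
pose r : R := (Num.sqrt 2)^-1.
have r2 : r ^+ 2 = 2^-1 by rewrite exprVn sqr_sqrtr.
have r0 : r != 0 by rewrite invr_eq0 gt_eqF // sqrtr_gt0.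
have rot : r ^+ 2 + (s * r) ^+ 2 = 1 by rewrite exprMn s1 mul1r r2; field.
have rr : r * r = 2^-1 by rewrite -expr2.
rewrite (_ : plane_rotation 0 s = plane_rotation r (s * r) *m plane_rotation r (s * r)).
  by apply: iid_preservingM; exact: iid_preserving_plane_neq0.
rewrite /plane_rotation mulmx_block -!scalar_mxM -!raddfD.
have ss : s * s = 1 by rewrite -expr2.
congr block_mx; congr (_%:M).
- by rewrite mulNr mulrACA ss mul1r subrr.
- by rewrite mulrN mulNr -opprD; congr (- _); rewrite mulrCA mulrAC -mulrA rr; field.
- by rewrite mulrCA mulrAC -mulrA rr; field.
- by rewrite mulrN mulrACA ss mul1r addNr.
Qed.

Lemma plane_rotationE (c s : R) (z : 'cV[R]_(1 + 1)) :
  (plane_rotation c s *m z) (rshift 1 0) 0 =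
  s * z (lshift 1 0) 0 + c * z (rshift 1 0) 0.
Proof.
by rewrite -{1}(vsubmxK z) mul_block_col col_mxEd !mul_scalar_mx !mxE.
Qed.

Lemma tr_plane_rotation (c s : R) : (plane_rotation c s)^T = plane_rotation c (- s).
Proof. by rewrite /plane_rotation tr_block_mx !tr_scalar_mx opprK. Qed.

Lemma plane_rotation_orthonormal (c s : R) : c ^+ 2 + s ^+ 2 = 1 ->
  orthonormal_cols (plane_rotation c s).
Proof.
move=> cs; rewrite /orthonormal_cols tr_plane_rotation /plane_rotation.
rewrite mulmx_block -!scalar_mxM -!raddfD opprK scalar_mx_block.
congr block_mx.
- by rewrite -!expr2 cs.
- by rewrite mulrN mulrC addNr raddf0.
- by rewrite mulNr mulrC addNr raddf0.
- by rewrite mulrNN -!expr2 addrC cs.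
Qed.

(** Givens rotations from the bottom up: [h] clears the tail of [v] except for its first entry, then
    [k] rotates the first two coordinates to clear that one. The transpose is included because the
    rotation is undone later. *)
Lemma iid_rotation_e0 n (v : 'cV[R]_n.+1) :
  exists g : 'M[R]_n.+1, [/\ iid_preserving g, iid_preserving g^T,
    orthonormal_cols g & forall i : 'I_n.+1, i != 0 -> (g *m v) i 0 = 0].
Proof.
elim: n v => [|n IH] v.
  exists 1%:M; rewrite trmx1; split; try exact: iid_preserving1.
    by rewrite /orthonormal_cols trmx1 mulmx1.
  by move=> i; rewrite ord1.
pose v1 := usubmx (v : 'cV[R]_(1 + n.+1)).
pose v2 := dsubmx (v : 'cV[R]_(1 + n.+1)).
have [g [gP gtP gO gv]] := IH v2.
pose h : 'M[R]_(1 + n.+1) := block_mx 1%:M 0 0 g.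
have hO : orthonormal_cols h.
  rewrite /orthonormal_cols tr_block_mx !trmx0 trmx1 mulmx_block !mulmx0 !mul0mx.
  rewrite mul1mx !addr0 !add0r gO.
  by rewrite -scalar_mx_block.
pose x := v1 0 0; pose y := (g *m v2) 0 0.
have [c [s [cs sy]]] : exists c s : R, c ^+ 2 + s ^+ 2 = 1 /\ s * x + c * y = 0.
  have [xy0|xy0] := eqVneq (x ^+ 2 + y ^+ 2) 0.
    exists 1, 0; rewrite expr1n expr0n addr0; split=> //.
    have y0 : y = 0 by nra.
    by rewrite y0; ring.
  have xy_gt0 : 0 < x ^+ 2 + y ^+ 2 by rewrite lt_neqAle eq_sym xy0 addr_ge0 // sqr_ge0.
  pose r := Num.sqrt (x ^+ 2 + y ^+ 2).
  have r0 : r != 0 by rewrite gt_eqF // sqrtr_gt0.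
  have r2 : r ^+ 2 = x ^+ 2 + y ^+ 2 by rewrite sqr_sqrtr // ltW.
  exists (x / r), (- y / r); split; last by field.
  by rewrite !expr_div_n sqrrN -mulrDl -r2 divff // expf_neq0.
pose k : 'M[R]_(2 + n) := block_mx (plane_rotation c s) 0 0 1%:M.
have kO : orthonormal_cols k.
  rewrite /orthonormal_cols tr_block_mx !trmx0 trmx1 mulmx_block !mulmx0 !mul0mx.
  rewrite mul1mx !addr0 !add0r plane_rotation_orthonormal //.
  by rewrite -scalar_mx_block.
have hP : iid_preserving h.
  by apply: iid_preserving_block => //; exact: iid_preserving1.
have htP : iid_preserving h^T.
  rewrite /h tr_block_mx !trmx0 trmx1; apply: iid_preserving_block => //.
  exact: iid_preserving1.
have kP : iid_preserving k.
  apply: iid_preserving_block; last exact: iid_preserving1.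
  exact: iid_preserving_plane.
have ktP : iid_preserving k^T.
  rewrite /k tr_block_mx !trmx0 trmx1; apply: iid_preserving_block.
    by rewrite tr_plane_rotation; apply: iid_preserving_plane; rewrite sqrrN.
  exact: iid_preserving1.
exists ((k : 'M[R]_n.+2) *m h); split.
- exact: (@iid_preservingM n.+2 k h kP hP).
- by rewrite trmx_mul; exact: (@iid_preservingM n.+2 h^T k^T htP ktP).
- exact: (@orthonormal_colsM _ n.+2 n.+2 n.+2 k h kO hO).
- move=> i i0.
  pose u : 'cV[R]_n.+2 := h *m v.
  have hv : u = col_mx v1 (g *m v2).
    rewrite /u -[v in LHS](vsubmxK (v : 'cV[R]_(1 + n.+1))) mul_block_col.
    by rewrite mul1mx !mul0mx addr0 add0r.
  have u0 : u (lshift n (lshift 1 (0 : 'I_1)) : 'I_(2 + n)) 0 = x.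
    rewrite (_ : (lshift n (lshift 1 (0 : 'I_1)) : 'I_n.+2) =
      lshift n.+1 (0 : 'I_1)); last exact/val_inj.
    by rewrite hv; exact: (col_mxEu v1 (g *m v2) 0 0).
  have u1 : u (lshift n (rshift 1 (0 : 'I_1)) : 'I_(2 + n)) 0 = y.
    rewrite (_ : (lshift n (rshift 1 (0 : 'I_1)) : 'I_n.+2) =
      rshift 1 (0 : 'I_n.+1)); last exact/val_inj.
    by rewrite hv; exact: (col_mxEd v1 (g *m v2) 0 0).
  have u2 (l : 'I_n) : u (rshift 2 l : 'I_(2 + n)) 0 = 0.
    rewrite (_ : (rshift 2 l : 'I_n.+2) = rshift 1 (lift 0 l : 'I_n.+1)); last exact/val_inj.
    rewrite hv -[RHS](gv (lift 0 l) isT).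
    exact: (col_mxEd v1 (g *m v2) (lift 0 l) 0).
  pose w : 'cV[R]_(2 + n) := u.
  have kw : k *m w = col_mx (plane_rotation c s *m usubmx w) (dsubmx w).
    by rewrite -{1}(vsubmxK w) mul_block_col !mul0mx addr0 add0r mul1mx.
  transitivity ((k *m w) i 0); first by rewrite /w /u mulmxA.
  rewrite kw; move: i0; case: (split_ordP (i : 'I_(2 + n))) => j -> i0; last first.
    by rewrite col_mxEd mxE u2.
  rewrite col_mxEu; case: (split_ordP (j : 'I_(1 + 1))) i0 => l -> i0.
    by move: i0; rewrite ord1.
  rewrite !ord1; apply: etrans (plane_rotationE _ _ _) _.
  by move: sy; rewrite -u0 -u1 ![usubmx w _ _]mxE.
Qed.

(** Once the first column of [g *m O] is a multiple of the first basis vector, orthogonality forces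
    the multiple to be a sign and the rest of the first row to vanish. A smaller orthogonal block
    remains. *)
Theorem iid_preserving_orthonormal n (O : 'M[R]_n) :
  orthonormal_cols O -> iid_preserving O.
Proof.
elim: n O => [|n IH] O OO.
  by rewrite (_ : O = 1%:M); [exact: iid_preserving1|apply/matrixP => -[]].
have [g [gP gtP gO gv]] := iid_rotation_e0 (col 0 O).
pose M : 'M[R]_(1 + n) := g *m O.
have MO : orthonormal_cols M by exact: orthonormal_colsM.
have M0 : dlsubmx M = 0.
  apply/matrixP => i j; rewrite !mxE !ord1.
  have := gv (rshift 1 i) isT; rewrite mxE => E.
  by rewrite -[RHS]E; apply: eq_bigr => l _; rewrite mxE; congr (_ * O _ _); exact/val_inj.
rewrite (_ : O = g^T *m M); last by rewrite mulmxA gO mul1mx.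
apply: iid_preservingM => //.
move: (MO : M^T *m M = 1%:M) => MM.
rewrite -[M]submxK M0 tr_block_mx mulmx_block trmx0 in MM.
rewrite !(mul0mx, mulmx0, addr0) (scalar_mx_block 1 n) in MM.
have [ul ur _ dr] := eq_block_mx MM.
pose c := ulsubmx M 0 0.
have ulE : ulsubmx M = c%:M by exact: mx11_scalar.
move: ul ur; rewrite ulE tr_scalar_mx -scalar_mxM mul_scalar_mx => cc cu.
have c2 : c ^+ 2 = 1.
  by have := congr1 (fun A : 'M[R]_1 => A 0 0) cc; rewrite !mxE eqxx.
have c0 : c != 0 by apply: contra_eq_neq c2 => ->; rewrite expr0n eq_sym oner_neq0.
have ur0 : ursubmx M = 0.
  by rewrite -[LHS]scale1r -(mulVf c0) -scalerA cu scaler0.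
have -> : M = block_mx c%:M 0 0 (drsubmx M) by rewrite -ulE -ur0 -M0 submxK.
apply: (@iid_preserving_block 1 n); first exact: iid_preserving_sign.
by apply: IH; move: dr; rewrite ur0 trmx0 mul0mx add0r.
Qed.

End Orthogonal.

(** * Laplace transform and positive moments of the squared norm *)

Section Moments.
Variable R : realType.
Local Notation gamma := (@normal_prob R 0 1).
Local Notation mu := (@lebesgue_measure R).
Local Notation pdf := (@normal_pdf R 0 1).

Lemma iid_orthonormal_mulmx d (T : measurableType d) (P : probability T R) a b
    (X : T -> mxspace R a b) (O : 'M[R]_a) :
  iid_std_gaussian_mx P X -> orthonormal_cols O ->
  iid_std_gaussian_mx P (fun w => O *m X w : mxspace R a b).
Proof. by move=> iX OO; exact: (iid_preserving_orthonormal OO). Qed.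

(** Complete [H] to a square orthogonal matrix and keep the first columns of the product. *)
Lemma iid_mulmx_orthonormal d (T : measurableType d) (P : probability T R) a b n
    (X : T -> mxspace R a b) (H : 'M[R]_(b, n)) :
  iid_std_gaussian_mx P X -> orthonormal_cols H ->
  iid_std_gaussian_mx P (fun w => (X w : 'M[R]_(a, b)) *m H : mxspace R a n).
Proof.
move=> iX HH.
have nb : (n <= b)%N.
  by rewrite -(mxrank1 R n) -HH (leq_trans (mxrankM_maxr _ _)) // rank_leq_row.
have [c bc] : exists c, b = (n + c)%N by exists (b - n)%N; rewrite subnKC.
subst b; have [K KO] := orthonormal_completion HH.
have := iid_orthonormal_mulmx (iid_trmx iX) (orthonormal_cols_trmx KO).
move=> /iid_usubmx /iid_trmx; congr iid_std_gaussian_mx; apply/funext => w /=.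
by rewrite -trmx_mul mul_mx_row tr_row_mx col_mxKu trmxK.
Qed.

Lemma measurable_sqn d (T : measurableType d) a b (X : T -> mxspace R a b) :
  measurable_fun setT X -> measurable_fun setT (fun w => sqn (X w : 'M[R]_(a, b))).
Proof.
move=> mX; apply: measurable_sum => i; apply: measurable_sum => j.
by apply: measurable_funX; exact: measurable_fun_coord.
Qed.

(** The Laplace transform, at [s], of the square of a standard normal variable. *)
Definition gauss_scale (s : R) := (Num.sqrt (1 + 2 * s))^-1.

(** Rescaling by [t = sqrt (1 + 2 s)] recovers the normal density. Negative [s] will serve the
    positive moments, and [s >= 0] the negative ones. *)
Lemma integral_normal_expN (s : R) : 0 < 1 + 2 * s ->
  (\int[gamma]_x (expR (- s * x ^+ 2))%:E = (gauss_scale s)%:E)%E.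
Proof.
move=> s0; pose t := Num.sqrt (1 + 2 * s).
have t0 : t != 0 by rewrite gt_eqF // sqrtr_gt0.
have t2 : t ^+ 2 = 1 + 2 * s by rewrite sqr_sqrtr // ltW.
have mf : measurable_fun setT (fun x : measurableTypeR R => (expR (- s * x ^+ 2))%:E).
  by apply/measurable_EFinP/measurableT_comp => //; apply: measurable_funM.
rewrite (ge0_integral_normal mf) => [|x]; last by rewrite lee_fin expR_ge0.
have mpdf : measurable_fun setT (fun x : R => (pdf x)%:E).
  by apply/measurable_EFinP; exact: measurable_normal_pdf.
have pdf0 x : (0 <= (pdf x)%:E)%E by rewrite lee_fin normal_pdf_ge0.
have := ge0_integral_affine 0 t0 mpdf pdf0; rewrite integral_normal_pdf => E1.
rewrite -[RHS]mule1 E1 muleA -EFinM ger0_norm ?sqrtr_ge0 // mulVf // mul1e.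
apply: eq_integral => x _; rewrite addr0 -EFinM; congr (_%:E).
rewrite !normal_pdf01E mulrCA -expRD exprMn t2; congr (_ * expR _).
by field.
Qed.

Lemma integral_iid11 d (T : measurableType d) (P : probability T R)
    (X : T -> mxspace R 1 1) (F : R -> \bar R) :
  iid_std_gaussian_mx P X -> measurable_fun setT F -> (forall x, 0 <= F x)%E ->
  (\int[P]_w F (X w 0%R 0%R) = \int[gamma]_x F x)%E.
Proof.
move=> iX mF F0; have iG := @iid_normal11 R.
rewrite (integral_same_law iX iG (F := fun M => F (M 0%R 0%R))) //.
  by apply: eq_integral => x _; rewrite mxE eqxx mulr1n.
exact: measurableT_comp mF (measurable_coord 0 0).
Qed.

Lemma sqn11 (M : 'M[R]_1) : sqn M = M 0 0 ^+ 2.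
Proof. by rewrite /sqn !big_ord1. Qed.

Lemma integral_iid_expN d (T : measurableType d) (P : probability T R) n
    (X : T -> mxspace R n 1) (s : R) :
  iid_std_gaussian_mx P X -> 0 < 1 + 2 * s ->
  (\int[P]_w (expR (- s * sqn (X w : 'M[R]_(n, 1))))%:E = (gauss_scale s ^+ n)%:E)%E.
Proof.
move=> iX s0; elim: n X iX => [|n IH] X iX.
  under eq_integral do rewrite /sqn big_ord0 mulr0 expR0.
  by rewrite integral_cst // mul1e; exact: probability_setT.
pose F (M : mxspace R (1 + n) 1) := (expR (- s * sqn (M : 'M[R]_(1 + n, 1))))%:E.
have mexp a : measurable_fun setT
    (fun M : mxspace R a 1 => (expR (- s * sqn (M : 'M[R]_(a, 1))))%:E).
  apply/measurable_EFinP/measurableT_comp => //; apply: measurable_funM => //.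
  by apply: measurable_sqn; exact: measurable_id.
have F0 M : (0 <= F M)%E by rewrite lee_fin expR_ge0.
rewrite (integral_decouple (a1 := 1) (a2 := n) iX (mexp _) F0).
have i1 := iid_usubmx (a1 := 1) (a2 := n) iX.
have i2 := iid_dsubmx (a1 := 1) (a2 := n) iX.
transitivity (\int[P]_w ((expR (- s * sqn (usubmx (X w : 'M[R]_(1 + n, 1)))))%:E *
    (gauss_scale s ^+ n)%:E))%E.
  apply: eq_integral => w _; rewrite -(IH _ i2) -ge0_integralZl //.
  - by apply: eq_integral => w' _; rewrite /F sqn_col_mx mulrDr expRD EFinM.
  - exact: measurableT_comp (mexp n) (iid_measurable i2).
rewrite ge0_integralZr //.
- under eq_integral do rewrite sqn11.
  rewrite (integral_iid11 (F := fun x => (expR (- s * x ^+ 2))%:E) i1).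
  + by rewrite integral_normal_expN // -EFinM exprS.
  + by apply/measurable_EFinP/measurableT_comp => //; apply: measurable_funM.
  + by move=> x; rewrite lee_fin expR_ge0.
- exact: measurableT_comp (mexp 1%N) (iid_measurable i1).
- by rewrite lee_fin exprn_ge0 // invr_ge0 sqrtr_ge0.
Qed.

(** The inequality [x <= exp (x - 1)] at [x = t / r], raised to the power [r]. *)
Lemma le_expr_expR (r : nat) (t : R) : 0 <= t -> t ^+ r <= r%:R ^+ r * expR (t - r%:R).
Proof.
case: r => [|r] t0; first by rewrite !expr0 mul1r subr0 (le_trans _ (expR_ge1Dx t)) ?lerDl.
have r0 : 0 < r.+1%:R :> R by [].
have : t / r.+1%:R <= expR (t / r.+1%:R - 1).
  by have := expR_ge1Dx (t / r.+1%:R - 1); rewrite addrCA subrr addr0.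
have tr0 : 0 <= t / r.+1%:R by rewrite divr_ge0 // ltW.
move=> /(lerXn2r r.+1); rewrite !nnegrE => /(_ tr0 (expR_ge0 _)).
rewrite -expRM_natl expr_div_n ler_pdivrMr ?exprn_gt0 // [leRHS]mulrC.
by rewrite mulrBr mulr1 mulrCA divff ?gt_eqF // mulr1.
Qed.

(* Chernoff: [t^r <= (r / (e u))^r e^(u t)] with [u = r / (n + 2 r)]. *)
Lemma integral_sqnX_le d (T : measurableType d) (P : probability T R) n r
    (X : T -> mxspace R n 1) : iid_std_gaussian_mx P X -> (0 < n)%N -> (0 < r)%N ->
  (\int[P]_w (sqn (X w : 'M[R]_(n, 1)) ^+ r)%:E <= ((n + 2 * r)%:R ^+ r)%:E)%E.
Proof.
move=> iX n0 r0.
have n0' : 0 < n%:R :> R by rewrite ltr0n.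
have r0' : 0 < r%:R :> R by rewrite ltr0n.
pose N : R := (n + 2 * r)%:R.
have NE : N = n%:R + 2 * r%:R by rewrite /N natrD natrM.
have N0 : 0 < N by rewrite NE; lra.
pose u := r%:R / N.
have u0 : 0 < u by rewrite divr_gt0.
have s0 : 1 + 2 * - u = n%:R / N by rewrite /u NE; field; lra.
have s1 : 0 < 1 + 2 * - u by rewrite s0 divr_gt0.
have mS := measurable_sqn (iid_measurable iX).
apply: (@le_trans _ _ (\int[P]_w ((N ^+ r * expR (- r%:R))%:E *
   (expR (- - u * sqn (X w : 'M[R]_(n, 1))))%:E))%E).
  apply: ge0_le_integral => //.
  - by move=> w _; rewrite lee_fin exprn_ge0 // sqn_ge0.
  - by apply/measurable_EFinP; exact: measurable_funX.
  - apply: emeasurable_funM => //; apply/measurable_EFinP/measurableT_comp => //.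
    exact: measurable_funM.
  - move=> w _; rewrite -EFinM lee_fin opprK; set t := sqn _.
    have ut0 : 0 <= u * t by rewrite mulr_ge0 ?sqn_ge0 // ltW.
    have rr0 : r%:R ^+ r != 0 :> R by rewrite expf_neq0 // gt_eqF.
    have NN0 : N ^+ r != 0 by rewrite expf_neq0 // gt_eqF.
    have -> : t ^+ r = N ^+ r / r%:R ^+ r * (u * t) ^+ r.
      by rewrite /u exprMn expr_div_n; field; rewrite NN0.
    have -> : N ^+ r * expR (- r%:R) * expR (u * t) =
        N ^+ r / r%:R ^+ r * (r%:R ^+ r * expR (u * t - r%:R)).
      by rewrite addrC expRD; field.
    rewrite ler_wpM2l ?le_expr_expR // divr_ge0 // exprn_ge0 //; exact: ltW.
have mE : measurable_fun setT (fun w => (expR (- - u * sqn (X w : 'M[R]_(n, 1))))%:E).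
  by apply/measurable_EFinP/measurableT_comp => //; exact: measurable_funM.
have E0 w : setT w -> (0 <= (expR (- - u * sqn (X w : 'M[R]_(n, 1))))%:E)%E.
  by rewrite lee_fin expR_ge0.
have c0 : (0 <= (N ^+ r * expR (- r%:R))%:E)%E.
  by rewrite lee_fin mulr_ge0 ?expR_ge0 // exprn_ge0 // ltW.
rewrite (ge0_integralZl P measurableT mE E0 c0).
rewrite (integral_iid_expN iX s1) -EFinM lee_fin -mulrA -[leRHS]mulr1.
rewrite ler_wpM2l //; first by rewrite exprn_ge0 // ltW.
rewrite expRN mulrC ler_pdivrMr ?expR_gt0 // mul1r /gauss_scale s0.
(* Since [N / n = 1 + 2 r / n <= exp (2 r / n)], the [n]-th power of the transform is at most
   [exp r], which cancels the factor [exp (- r)]. *)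
have E : (Num.sqrt (n%:R / N))^-1 <= expR (r%:R / n%:R).
  rewrite -sqrtrV; last by rewrite divr_ge0 // ltW.
  rewrite invf_div.
  rewrite -[leRHS]ger0_norm ?expR_ge0 // -sqrtr_sqr; apply: ler_wsqrtr.
  rewrite -expRM_natl; have := expR_ge1Dx (2 * (r%:R / n%:R) : R).
  move=> /(le_trans _); rewrite -mulr_natl; apply.
  by rewrite mulr1 NE mulrDl divff ?gt_eqF // mulrA.
have -> : expR r%:R = expR (r%:R / n%:R) ^+ n :> R.
  by rewrite -expRM_natl -mulr_natl mulrCA divff ?mulr1 // gt_eqF.
by rewrite lerXn2r // nnegrE ?invr_ge0 ?sqrtr_ge0 ?expR_ge0.
Qed.

End Moments.

(** * Moments *)

Section EvenMoments.
Variable R : realType.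
Local Notation gamma := (@normal_prob R 0 1).
Local Notation mu := (@lebesgue_measure R).
Local Notation pdf := (@normal_pdf R 0 1).

(** To first order at [tau = 1] the hypothesis reads [n (tau - 1) a <= (tau - 1) b]. An explicit
    step [eps] stands in for the limit. *)
Lemma le_of_scaling (n : nat) (a b : R) : 0 <= a -> 0 <= b ->
  (forall tau, 1 < tau -> a <= (tau ^+ n)^-1 * a + (tau ^+ 2 - 1) / 2 * b) ->
  n%:R * a <= b.
Proof.
move=> a0 b0 H; apply/ler_addgt0Pr => e e0.
have na0 : 0 <= n%:R * a by rewrite mulr_ge0.
(* Chosen so that the final error [n a (n + 1) eps] is at most [e]; the [1] keeps the denominator
   positive. *)
pose eps := e / (n.+1%:R * (n%:R * a + 1)).
have eps0 : 0 < eps by rewrite divr_gt0 // mulr_gt0 // ltr_wpDl.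
pose tau := 1 + eps.
have tau1 : 1 < tau by rewrite ltrDl.
have tau0 : 0 < tau by rewrite (lt_trans _ tau1).
have tn0 : 0 < tau ^+ n by rewrite exprn_gt0.
have bern : 1 + n%:R * eps <= tau ^+ n.
  elim: (n) => [|k IH]; first by rewrite mul0r addr0 expr0.
  rewrite exprS; apply: le_trans (_ : tau * (1 + k%:R * eps) <= _).
    rewrite /tau -natr1.
    have : 0 <= k%:R * eps * eps.
      exact: (mulr_ge0 (mulr_ge0 (ler0n _ _) (ltW eps0)) (ltW eps0)).
    lra.
  by rewrite ler_wpM2l // ltW.
have step1 : n%:R * a <= tau ^+ n * (1 + eps / 2) * b.
  have H1 : tau ^+ n * a <= a + tau ^+ n * ((tau ^+ 2 - 1) / 2 * b).
    have := ler_wpM2l (ltW tn0) (H _ tau1).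
    by rewrite mulrDr mulVKf ?gt_eqF.
  have H2 : n%:R * eps * a <= tau ^+ n * a - a.
    rewrite (_ : tau ^+ n * a - a = (tau ^+ n - 1) * a); last by ring.
    by rewrite ler_wpM2r //; lra.
  have H3 : (tau ^+ 2 - 1) / 2 = eps * (1 + eps / 2) by rewrite /tau; field.
  rewrite H3 in H1.
  rewrite -(ler_pM2l eps0).
  have -> : eps * (n%:R * a) = n%:R * eps * a by ring.
  apply: (le_trans H2); rewrite lerBlDr addrC.
  by apply: (le_trans H1); rewrite lerD2l le_eqVlt; apply/orP; left; apply/eqP; ring.
have step2 : tau ^+ n * (1 + eps / 2) <= expR (n.+1%:R * eps).
  rewrite expRM_natl exprS mulrC ler_pM ?exprn_ge0 //.
  - by rewrite ltW // ltr_pwDl // ltW // divr_gt0.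
  - exact: ltW.
  - by rewrite (le_trans _ (expR_ge1Dx _)) // lerD2l; lra.
  - by rewrite lerXn2r ?nnegrE ?expR_ge0 ?(ltW tau0) // expR_ge1Dx.
have step3 : n%:R * a * expR (- (n.+1%:R * eps)) <= b.
  rewrite expRN ler_pdivrMr ?expR_gt0 // [leRHS]mulrC; apply: (le_trans step1).
  by rewrite ler_wpM2r.
have step4 : n%:R * a * (1 - n.+1%:R * eps) <= b.
  by apply: le_trans step3; rewrite ler_wpM2l // expR_ge1Dx.
rewrite mulrBr mulr1 lerBlDr in step4; apply: (le_trans step4); rewrite lerD2l.
have na1 : 0 < n%:R * a + 1 by rewrite ltr_wpDl.
have -> : n%:R * a * (n.+1%:R * eps) = n%:R * a / (n%:R * a + 1) * e.
  by rewrite /eps; field; rewrite gt_eqF //= nat1r pnatr_eq0.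
by rewrite ler_piMl ?(ltW e0) // ler_pdivrMr // mul1r lerDl.
Qed.

Lemma measurable_even_pdf r :
  measurable_fun setT (fun x : R => (x ^+ (2 * r))%:E * (pdf x)%:E)%E.
Proof.
apply: emeasurable_funM; first by apply/measurable_EFinP.
by apply/measurable_EFinP; exact: measurable_normal_pdf.
Qed.

Lemma even_moment_le r : (0 < r)%N ->
  (\int[gamma]_x (x ^+ (2 * r))%:E <= ((1 + 2 * r)%:R ^+ r)%:E)%E.
Proof.
move=> r0; have := integral_sqnX_le (@iid_normal11 R) (isT : (0 < 1)%N) r0.
by under eq_integral do rewrite sqn11 mxE eqxx mulr1n -exprM.
Qed.

Lemma even_moment_ge0 r : (0 <= \int[gamma]_x (x ^+ (2 * r))%:E)%E.
Proof. by apply: integral_ge0 => x _; rewrite lee_fin exprM exprn_ge0 ?sqr_ge0. Qed.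

Lemma even_moment_fin r : (\int[gamma]_x (x ^+ (2 * r))%:E)%E \is a fin_num.
Proof.
rewrite ge0_fin_numE ?even_moment_ge0 //; case: r => [|r].
  under eq_integral do rewrite muln0 expr0.
  rewrite [X in (X < _)%E](_ : _ = 1%E) ?ltry // integral_cst // mul1e.
  exact: probability_setT.
by rewrite (le_lt_trans (even_moment_le _)) // ltry.
Qed.

(** The inequality [1 - y <= exp (- y)] for [y = (tau^2 - 1) x^2 / 2], times the density. *)
Lemma normal_pdf_scaling_le (tau x : R) :
  pdf x <= pdf (tau * x) + (tau ^+ 2 - 1) / 2 * x ^+ 2 * pdf x.
Proof.
rewrite !normal_pdf01E; set c := normal_peak _.
have c0 : 0 <= c by exact: normal_peak_ge0.
have -> : - (tau * x) ^+ 2 / 2 = - x ^+ 2 / 2 + - ((tau ^+ 2 - 1) / 2 * x ^+ 2).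
  by field.
rewrite expRD; set y := (tau ^+ 2 - 1) / 2 * x ^+ 2.
have := expR_ge1Dx (- y); set E := expR (- y).
have F0 := expR_ge0 (- x ^+ 2 / 2); set F := expR _ in F0 *.
have cF0 : 0 <= c * F by rewrite mulr_ge0.
nra.
Qed.

(** In place of integration by parts, [normal_pdf_scaling_le] is integrated against [x^(2r)]:
    substitution turns its first term into [tau^-(2r+1)] times the moment, and [le_of_scaling]
    concludes. *)
Lemma even_momentS r : ((2 * r + 1)%:R%:E * \int[gamma]_x (x ^+ (2 * r))%:E <=
  \int[gamma]_x (x ^+ (2 * r.+1))%:E)%E.
Proof.
have aE := fineK (even_moment_fin r); have bE := fineK (even_moment_fin r.+1).
set a := fine _ in aE; set b := fine _ in bE.
have a0 : 0 <= a by rewrite -lee_fin aE even_moment_ge0.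
have b0 : 0 <= b by rewrite -lee_fin bE even_moment_ge0.
rewrite -aE -bE -EFinM lee_fin; apply: le_of_scaling => // tau tau1.
have tau0 : 0 < tau by rewrite (lt_trans _ tau1).
have mpow n : measurable_fun setT (fun x : measurableTypeR R => (x ^+ n)%:E).
  by apply/measurable_EFinP.
have pow_ge0 n x : (0 <= (x ^+ (2 * n))%:E :> \bar R)%E.
  by rewrite lee_fin exprM exprn_ge0 // sqr_ge0.
have pdf_ge0 x : (0 <= (pdf x)%:E)%E by rewrite lee_fin normal_pdf_ge0.
have momE n : (\int[gamma]_x (x ^+ (2 * n))%:E =
    \int[mu]_x ((x ^+ (2 * n))%:E * (pdf x)%:E))%E.
  exact: (ge0_integral_normal (mpow (2 * n)%N) (pow_ge0 n)).
have g0 n x : (0 <= (x ^+ (2 * n))%:E * (pdf x)%:E :> \bar R)%E by rewrite mule_ge0.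
pose S x := ((x ^+ (2 * r))%:E * (pdf (tau * x))%:E)%E.
pose U x := ((x ^+ (2 * r.+1))%:E * (pdf x)%:E)%E.
pose c : R := (tau ^+ 2 - 1) / 2.
have c0 : (0 <= c%:E)%E.
  by rewrite lee_fin divr_ge0 // subr_ge0 expr_ge1 // ltW.
have S0 x : setT x -> (0 <= S x)%E by rewrite mule_ge0.
have U0 x : setT x -> (0 <= U x)%E by rewrite mule_ge0.
have cU0 x : setT x -> (0 <= c%:E * U x)%E by move=> ?; rewrite mule_ge0 // U0.
have mS : measurable_fun setT (S : measurableTypeR R -> \bar R).
  apply: emeasurable_funM; first exact: mpow.
  apply/measurable_EFinP; apply: (measurableT_comp (measurable_normal_pdf _ _)).
  exact: measurable_funM.
have mU : measurable_fun setT (U : measurableTypeR R -> \bar R).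
  exact: measurable_even_pdf.
have mcU : measurable_fun setT (fun x : measurableTypeR R => c%:E * U x)%E.
  exact: emeasurable_funM.
have scaled : (\int[mu]_x S x = ((tau ^+ (2 * r + 1))^-1 * a)%:E)%E.
  have tn0 := lt0r_neq0 tau0.
  have := ge0_integral_affine 0 tn0 (measurable_even_pdf r) (g0 r).
  rewrite -momE -aE (gtr0_norm tau0) => aE'.
  have tr0 : (0 <= (tau ^+ (2 * r))%:E)%E by rewrite lee_fin exprn_ge0 // ltW.
  have E : (\int[mu]_x (((tau * x + 0) ^+ (2 * r))%:E * (pdf (tau * x + 0))%:E) =
     (tau ^+ (2 * r))%:E * \int[mu]_x S x)%E.
    rewrite -(ge0_integralZl mu measurableT mS S0 tr0).
    by apply: eq_integral => x _; rewrite addr0 exprMn EFinM -muleA.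
  rewrite E in aE'; rewrite EFinM aE' !muleA -!EFinM.
  by rewrite addn1 exprS -mulrA mulVf ?mul1e // mulf_neq0 // expf_neq0.
have key : (\int[mu]_x ((x ^+ (2 * r))%:E * (pdf x)%:E) <=
    \int[mu]_x S x + c%:E * \int[mu]_x U x)%E.
  rewrite -(ge0_integralZl mu measurableT mU U0 c0).
  rewrite -(ge0_integralD mu measurableT S0 mS cU0 mcU).
  apply: ge0_le_integral => //.
  - exact: measurable_even_pdf.
  - exact: emeasurable_funD.
  - move=> x _; rewrite /S /U -!EFinM -EFinD lee_fin.
    have := normal_pdf_scaling_le tau x; rewrite -/c => H.
    have x0 : 0 <= x ^+ (2 * r) by rewrite exprM exprn_ge0 // sqr_ge0.
    apply: (le_trans (ler_wpM2l x0 H)); rewrite mulnS addnC exprD.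
    by rewrite le_eqVlt; apply/orP; left; apply/eqP; ring.
by rewrite -lee_fin EFinD [X in (_ <= _ + X)%E]EFinM -scaled aE bE !momE.
Qed.

Lemma even_moment_ge r :
  ((\prod_(j < r) (2 * j + 1))%:R%:E <= \int[gamma]_x (x ^+ (2 * r))%:E)%E.
Proof.
elim: r => [|r IH].
  rewrite big_ord0; under eq_integral do rewrite muln0 expr0.
  rewrite integral_cst // mul1e le_eqVlt; apply/orP; left; apply/eqP.
  by apply: esym; exact: probability_setT.
rewrite big_ord_recr /= mulnC natrM EFinM; apply: le_trans (even_momentS r).
by rewrite lee_wpmul2l.
Qed.

End EvenMoments.

(** * Negative moments of the squared norm *)

Section Laplace.
Import numFieldTopology.Exports numFieldNormedType.Exports.
Variable R : realType.
Local Notation mu := (@lebesgue_measure R).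

Lemma integral_expN_itv (l c : R) : 0 < l ->
  (\int[mu]_(x in `[c, +oo[) (expR (- l * x))%:E = (l^-1 * expR (- l * c))%:E)%E.
Proof.
move=> l0.
pose F (x : R) : R := - l^-1 * expR (- l * x).
have dF (x : R) : is_derive x 1 F (expR (- l * x)).
  rewrite /F; apply: is_derive_eq.
  by rewrite /GRing.scale /= !(mulr0, addr0, mulr1); field; rewrite gt_eqF.
have cexp : continuous (fun x : R => expR (- l * x)).
  by move=> x; apply: differentiable_continuous; apply/derivable1_diffP.
have cF : continuous F.
  by move=> x; apply: differentiable_continuous; apply/derivable1_diffP.
rewrite (ge0_continuous_FTC2y (F := F) (l := 0)).
- by rewrite -EFinB sub0r /F mulNr opprK.
- by move=> x _; rewrite expR_ge0.
- exact: continuous_subspaceT.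
- rewrite -(mulr0 (- l^-1)); apply: cvgM; first exact: cvg_cst.
  rewrite (_ : (fun x => expR (- l * x)) = (fun z => expR (- z)) \o (fun z => l * z)).
    apply: (@cvg_comp _ _ _ _ _ _ (pinfty_nbhs R)); last exact: cvgr_expR.
    exact: gt0_cvgMry.
  by apply: eq_fun => x; rewrite mulNr.
- by move=> x _.
- by apply/cvg_at_right_filter; exact: cF.
- by move=> x _; rewrite derive1E derive_val.
Qed.

(** The least integer power of [gauss_scale] that is integrable at infinity is the third; hence the
    [3] in [2 * a + 3 <= n] below. *)
Lemma integral_gauss_scale3 :
  (\int[mu]_(x in `[0%R, +oo[) (gauss_scale x ^+ 3)%:E = 1)%E.
Proof.
pose F (x : R) : R := - (Num.sqrt (1 + 2 * x))^-1.
have dF (x : R) : 0 < 1 + 2 * x -> is_derive x 1 F (gauss_scale x ^+ 3).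
  move=> x0; rewrite /F /gauss_scale.
  have s0 : Num.sqrt (1 + 2 * x) != 0 by rewrite gt_eqF // sqrtr_gt0.
  have d1 : is_derive x (1 : R) (fun x : R => 1 + 2 * x) 2.
    by apply: is_derive_eq; rewrite /GRing.scale /= add0r mul1r mulr1.
  have d2 := @is_derive1_comp R Num.sqrt (fun x => 1 + 2 * x) x _ _ (is_derive1_sqrt x0) d1.
  have d3 := is_deriveN (@is_deriveV R (Num.sqrt \o (fun x => 1 + 2 * x)) x _ 1 s0 d2).
  apply: is_derive_eq d3 _.
  by rewrite /GRing.scale /=; field.
have pos (x : R) : 0 <= x -> 0 < 1 + 2 * x by move=> ?; lra.
have cF (x : R) : 0 <= x -> {for x, continuous F}.
  move=> /pos x0; apply: differentiable_continuous; apply/derivable1_diffP.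
  by have [] := dF x x0.
have FE x : gauss_scale x ^+ 3 = - F x ^+ 3.
  by rewrite /F /gauss_scale; ring.
rewrite (ge0_continuous_FTC2y (F := F) (l := 0)).
- by rewrite /F mulr0 addr0 sqrtr1 invr1 EFinN oppeK add0e.
- by move=> x _; rewrite exprn_ge0 // invr_ge0 sqrtr_ge0.
- apply: continuous_in_subspaceT => x; rewrite inE /= in_itv /= andbT => x0.
  rewrite (_ : (fun x => _) = (fun x => - F x ^+ 3)); last by apply/funext.
  have [dFx _] := dF x (pos _ x0).
  apply: differentiable_continuous; apply/derivable1_diffP.
  have d3 := @derivableX R R F 3 x 1 dFx.
  exact: derivableN d3.
- rewrite -oppr0; apply: cvgN.
  apply/gtr0_cvgV0.
    by near=> x; rewrite sqrtr_gt0 pos //; near: x; exact: nbhs_pinfty_ge.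
  apply/cvgryPge => A; near=> x.
  apply: (le_trans (ler_norm A)); rewrite -sqrtr_sqr ler_wsqrtr //.
  have : A ^+ 2 <= x by near: x; apply: nbhs_pinfty_ge; exact: num_real.
  have : 0 <= A ^+ 2 by exact: sqr_ge0.
  lra.
- by move=> x /ltW /pos /dF [].
- by apply/cvg_at_right_filter; apply: cF.
- move=> x; rewrite in_itv /= andbT => /ltW /pos /dF d.
  by rewrite derive1E derive_val.
Unshelve. all: by end_near. Qed.

Lemma integral_indic_itv (f : R -> R) :
  (\int[mu]_x (\1_(`[0%R, +oo[%classic : set R) x * f x)%:E =
   \int[mu]_(x in `[0%R, +oo[) (f x)%:E)%E.
Proof.
rewrite [RHS]integral_mkcond; apply: eq_integral => x _.
by rewrite patchE indicE; case: ifP => _; rewrite ?mul1r ?mul0r.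
Qed.

(* [Gamma(a + 1) / t ^ (a + 1)], bounded below by its restriction to [s >= a / t]. *)
Lemma laplace_ge (a : nat) (t y : R) : 0 <= y -> y * t <= 1 ->
  ((a%:R ^+ a * expR (- a%:R) * y ^+ a.+1)%:E <=
   \int[mu]_(s in `[0%R, +oo[) (s ^+ a * expR (- s * t))%:E)%E.
Proof.
move=> y0 yt.
have mf (D : set R) : measurable_fun D (fun s : R => (s ^+ a * expR (- s * t))%:E).
  apply: measurable_funTS; apply/measurable_EFinP; apply: measurable_funM => //.
  by apply: measurableT_comp => //; apply: measurable_funM.
have f0 s : 0 <= s -> 0 <= s ^+ a * expR (- s * t).
  by move=> s0; rewrite mulr_ge0 ?expR_ge0 // exprn_ge0.
have [->|yN0] := eqVneq y 0.
  rewrite expr0n mulr0; apply: integral_ge0 => s /=.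
  by rewrite in_itv /= andbT lee_fin; exact: f0.
have y_gt0 : 0 < y by rewrite lt_neqAle eq_sym yN0.
have ay0 : 0 <= a%:R * y by rewrite mulr_ge0.
apply: (@le_trans _ _ (\int[mu]_(s in `[(a%:R * y)%R, +oo[)
    (s ^+ a * expR (- s * t))%:E)%E); last first.
  apply: ge0_subset_integral => //; first exact: mf.
    by move=> s /=; rewrite in_itv /= andbT lee_fin; exact: f0.
  move=> s /=; rewrite !in_itv /= !andbT; exact: le_trans.
(* On this range [s^a >= (a y)^a], and [t <= 1 / y]; the resulting integral is explicit. *)
apply: (@le_trans _ _ (\int[mu]_(s in `[(a%:R * y)%R, +oo[)
   (((a%:R * y) ^+ a)%:E * (expR (- y^-1 * s))%:E))%E).
  rewrite ge0_integralZl //=.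
  - rewrite integral_expN_itv ?invr_gt0 // invrK -EFinM lee_fin le_eqVlt.
    apply/orP; left; apply/eqP.
    have -> : - y^-1 * (a%:R * y) = - a%:R by field.
    by rewrite exprMn exprS; ring.
  - by apply/measurable_EFinP; apply: measurable_funTS; apply: measurableT_comp => //;
       apply: measurable_funM.
  - by rewrite lee_fin exprn_ge0.
apply: ge0_le_integral => //.
- by move=> s _; rewrite -EFinM lee_fin mulr_ge0 ?expR_ge0 // exprn_ge0.
- apply: emeasurable_funM => //; apply/measurable_EFinP; apply: measurable_funTS.
  by apply: measurableT_comp => //; apply: measurable_funM.
- exact: mf.
- move=> s /=; rewrite in_itv /= andbT => ays.
  have s0 : 0 <= s by exact: le_trans ays.
  rewrite -EFinM lee_fin ler_pM ?exprn_ge0 ?expR_ge0 //.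
    by rewrite lerXn2r ?nnegrE.
  rewrite ler_expR !mulNr lerN2 [leLHS]mulrC ler_wpM2r //.
  by rewrite -[leRHS]mul1r ler_pdivlMr // mulrC.
Qed.

(** Each factor [s] is paired with [gauss_scale s ^+ 2 = 1 / (1 + 2 s)], a product of at most
    [1 / 2]; three powers are left for integrability. *)
Lemma gauss_scaleX_le (a n : nat) (s : R) : 0 <= s -> (2 * a + 3 <= n)%N ->
  s ^+ a * gauss_scale s ^+ n <= (2 ^+ a)^-1 * gauss_scale s ^+ 3.
Proof.
move=> s0 an; have p : 0 < 1 + 2 * s by lra.
have k0 : 0 <= gauss_scale s by rewrite invr_ge0 sqrtr_ge0.
have k1 : gauss_scale s <= 1.
  rewrite invf_le1 ?sqrtr_gt0 // -[leLHS]sqrtr1 ler_wsqrtr //; lra.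
have k2 : gauss_scale s ^+ 2 = (1 + 2 * s)^-1.
  by rewrite exprVn sqr_sqrtr // ltW.
have H : s * gauss_scale s ^+ 2 <= 2^-1 by rewrite k2 ler_pdivrMr //; lra.
apply: (@le_trans _ _ (s ^+ a * gauss_scale s ^+ (2 * a + 3))).
  by rewrite ler_wpM2l ?exprn_ge0 // ler_wiXn2l.
rewrite exprD exprM mulrA -exprMn -exprVn ler_wpM2r ?exprn_ge0 //.
by rewrite lerXn2r ?nnegrE ?invr_ge0 // mulr_ge0 // exprn_ge0.
Qed.

Lemma measurable_laplace_integrand d (T : measurableType d) (S : T -> R) a :
  measurable_fun setT S -> measurable_fun setT (fun z : T * measurableTypeR R =>
    (\1_(`[0%R, +oo[%classic : set R) z.2 * (z.2 ^+ a * expR (- z.2 * S z.1)))%:E).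
Proof.
move=> mS; apply/measurable_EFinP; apply: measurable_funM.
  apply: measurableT_comp => //.
apply: measurable_funM; first exact: measurable_funX.
apply: measurableT_comp => //; apply: measurable_funM.
  by apply: measurableT_comp => //.
exact: measurableT_comp mS _.
Qed.

Lemma laplace_integrand_ge0 (a : nat) (s t : R) :
  (0 <= (\1_(`[0%R, +oo[%classic : set R) s * (s ^+ a * expR (- s * t)))%:E)%E.
Proof.
rewrite lee_fin indicE; case: (boolP (s \in _)) => [|_]; last by rewrite mul0r.
by rewrite inE /= in_itv /= andbT => s0; rewrite mul1r mulr_ge0 ?expR_ge0 // exprn_ge0.
Qed.

Lemma measurable_laplace d (T : measurableType d) (S : T -> R) a :
  measurable_fun setT S -> measurable_fun setT (fun w =>
    \int[mu]_(s in `[0%R, +oo[) (s ^+ a * expR (- s * S w))%:E)%E.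
Proof.
move=> mS; under eq_fun do rewrite -integral_indic_itv.
exact: (measurable_fun_integralr (m2 := mu) (fun w s => _)
  (measurable_laplace_integrand a mS) (fun w s => laplace_integrand_ge0 a s (S w))).
Qed.

(** Tonelli brings the expectation inside, where it is [gauss_scale s ^+ n]. *)
Lemma integral_laplace_iid_le d (T : measurableType d) (P : probability T R) n a
    (X : T -> mxspace R n 1) : iid_std_gaussian_mx P X -> (2 * a + 3 <= n)%N ->
  (\int[P]_w \int[mu]_(s in `[0%R, +oo[)
     (s ^+ a * expR (- s * sqn (X w : 'M[R]_(n, 1))))%:E <= ((2 ^+ a)^-1)%:E)%E.
Proof.
move=> iX an.
pose I : set R := `[0%R, +oo[%classic.
have mI : measurable I by exact: measurable_itv.
pose H w (s : measurableTypeR R) :=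
  (\1_I s * (s ^+ a * expR (- s * sqn (X w : 'M[R]_(n, 1)))))%:E.
have I0 s : s \in I -> 0 <= s by rewrite inE /I /= in_itv /= andbT.
have H0 w s : (0 <= H w s)%E by exact: laplace_integrand_ge0.
have mX := measurable_sqn (iid_measurable iX).
have mH := measurable_laplace_integrand a mX.
under eq_integral do rewrite -integral_indic_itv.
rewrite (ge0_integral_swap (m1 := P) (m2 := mu) H mH H0).
have scale_ge0 s : 0 <= gauss_scale s by rewrite invr_ge0 sqrtr_ge0.
have mscale : measurable_fun setT (fun s : measurableTypeR R => (\1_I s * gauss_scale s ^+ 3)%:E).
  apply/measurable_EFinP; apply: measurable_funM; first exact: measurable_indic.
  apply: measurable_funX; apply: measurable_funV.
  apply: (measurableT_comp (continuous_measurable_fun (@sqrt_continuous R))).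
  by apply: measurable_funD => //; apply: measurable_funM.
apply: (@le_trans _ _ (\int[mu]_s (((2 ^+ a)^-1)%:E * (\1_I s * gauss_scale s ^+ 3)%:E))%E).
  apply: ge0_le_integral => //.
  - by move=> s _; apply: integral_ge0.
  - exact: (measurable_fun_integrall (m1 := P) H mH H0).
  - exact: emeasurable_funM.
  - move=> s _; rewrite /H indicE; case: (boolP (s \in I)) => [/I0 s0|_]; last first.
      under eq_integral do rewrite mul0r.
      by rewrite integral0 mul0r mule0.
    under eq_integral do rewrite mul1r EFinM.
    rewrite ge0_integralZl //.
    + rewrite (integral_iid_expN iX) -?EFinM ?lee_fin ?mul1r ?gauss_scaleX_le //.
      by lra.
    + apply/measurable_EFinP; apply: measurableT_comp => //.
      exact: measurable_funM.
    + by rewrite lee_fin exprn_ge0.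
rewrite ge0_integralZl //.
- by rewrite integral_indic_itv integral_gauss_scale3 mule1.
- by move=> s _; rewrite lee_fin mulr_ge0 ?exprn_ge0 ?scale_ge0 // indicE ler0n.
Qed.

(** [Y] is [1 / |X|^2] or anything smaller; the product form is what [sqn_pinv_row_le] delivers. The
    constant is the bound [2^-a] on the averaged Laplace integral over the factor [a^a exp (- a)] of
    [laplace_ge]. *)
Lemma integral_inv_sqnX_le d (T : measurableType d) (P : probability T R) n a
    (X : T -> mxspace R n 1) (Y : T -> R) :
  iid_std_gaussian_mx P X -> (2 * a + 3 <= n)%N ->
  measurable_fun setT Y -> (forall w, 0 <= Y w) ->
  (forall w, Y w * sqn (X w : 'M[R]_(n, 1)) <= 1) ->
  (\int[P]_w (Y w ^+ a.+1)%:E <= (expR a%:R / (2 * a%:R) ^+ a)%:E)%E.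
Proof.
move=> iX an mY Y0 YX.
pose c : R := a%:R ^+ a * expR (- a%:R).
(* For [a = 0] the factor [a^a] is [0^0 = 1]. *)
have c_gt0 : 0 < c.
  rewrite mulr_gt0 ?expR_gt0 // lt_neqAle exprn_ge0 // andbT eq_sym expf_eq0.
  by case: (a) => // k; rewrite pnatr_eq0.
have c0 : (0 <= c%:E)%E by rewrite lee_fin ltW.
have mYa : measurable_fun setT (fun w => (Y w ^+ a.+1)%:E).
  by apply/measurable_EFinP; exact: measurable_funX.
have Ya0 w : setT w -> (0 <= (Y w ^+ a.+1)%:E)%E by rewrite lee_fin exprn_ge0.
have key : (c%:E * \int[P]_w (Y w ^+ a.+1)%:E <= ((2 ^+ a)^-1)%:E)%E.
  rewrite -(ge0_integralZl P measurableT mYa Ya0 c0).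
  apply: le_trans (integral_laplace_iid_le iX an).
  apply: ge0_le_integral => //.
  - by move=> w _; rewrite mule_ge0 // Ya0.
  - exact: emeasurable_funM.
  - exact: (measurable_laplace a (measurable_sqn (iid_measurable iX))).
  - by move=> w _; rewrite -EFinM; apply: laplace_ge.
have -> : expR a%:R / (2 * a%:R) ^+ a = c^-1 * (2 ^+ a)^-1.
  by rewrite /c invfM -expRN opprK exprMn invfM; ring.
by rewrite EFinM lee_pdivlMl.
Qed.

End Laplace.

(** * The pseudo-inverse of a Gaussian matrix *)

Section PseudoInverse.
Variable R : realType.

Lemma measurable_det d (T : measurableType d) a (X : T -> 'M[R]_a) :
  (forall i j, measurable_fun setT (fun w => X w i j)) ->
  measurable_fun setT (fun w => \det (X w)).
Proof.
move=> mX; apply: measurable_sum => s; apply: measurable_funM => //.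
by apply: measurable_prod => i _; exact: mX.
Qed.

Lemma measurable_pinv d (T : measurableType d) a b (X : T -> mxspace R a b) :
  measurable_fun setT X ->
  measurable_fun setT (fun w => pinv (X w : 'M[R]_(a, b)) : mxspace R b a).
Proof.
move=> mX; have mXt := measurable_trmx mX; have mW := measurable_mulmx mX mXt.
apply: measurable_mulmx => //; apply: measurable_fun_mx => i j.
under eq_fun do rewrite mxE; apply: measurable_funM.
  by apply/measurable_funV/measurable_det => i' j'; exact: measurable_fun_coord.
under eq_fun do rewrite mxE; apply: measurable_funM => //.
apply: measurable_det => i' j'; under eq_fun do rewrite 2!mxE.
exact: (measurable_fun_coord _ _ mW).
Qed.

Lemma mul_pinv_gram a b (G : 'M[R]_(a, b)) (Z : 'M[R]_a) :
  \det (G *m G^T) != 0 -> G *m G^T *m Z = 1%:M -> pinv G = G^T *m Z.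
Proof.
move=> d0 WZ; rewrite /pinv; congr (_ *m _).
set W := G *m G^T in d0 WZ *.
have WV : W *m ((\det W)^-1 *: \adj W) = 1%:M.
  by rewrite -scalemxAr mul_mx_adj scale_scalar_mx mulVf.
by rewrite -[LHS]mulmx1 -WZ mulmxA (mulmx1C WV) mul1mx.
Qed.

Lemma pinv_singular a b (G : 'M[R]_(a, b)) : \det (G *m G^T) = 0 -> pinv G = 0.
Proof. by move=> d0; rewrite /pinv d0 invr0 scale0r mulmx0. Qed.

(** The Gram determinant is unchanged by [O], so the default value [0] in the singular case is
    respected as well. *)
Lemma pinv_orthonormal a b (O : 'M[R]_a) (G : 'M[R]_(a, b)) :
  orthonormal_cols O -> pinv (O *m G) = pinv G *m O^T.
Proof.
move=> OO; have OOt := orthonormal_cols_tr OO.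
have WE : O *m G *m (O *m G)^T = O *m (G *m G^T) *m O^T.
  by rewrite trmx_mul !mulmxA.
have dE : \det (O *m G *m (O *m G)^T) = \det (G *m G^T).
  by rewrite WE !det_mulmx mulrAC -det_mulmx OOt det1 mul1r.
have [d0|d0] := eqVneq (\det (G *m G^T)) 0.
  by rewrite !pinv_singular ?dE // mul0mx.
pose Z := (\det (G *m G^T))^-1 *: \adj (G *m G^T).
have WZ : G *m G^T *m Z = 1%:M.
  by rewrite -scalemxAr mul_mx_adj scale_scalar_mx mulVf.
rewrite (mul_pinv_gram (Z := O *m Z *m O^T)) ?dE //; last first.
  rewrite (_ : _ *m (O *m Z *m O^T) = O *m (G *m G^T *m (O^T *m O) *m Z) *m O^T).
    by rewrite OO mulmx1 WZ mulmx1.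
  by rewrite WE !mulmxA.
rewrite (mul_pinv_gram (Z := Z)) //.
by rewrite trmx_mul !mulmxA -(mulmxA G^T O^T O) OO mulmx1.
Qed.

(** Bessel's inequality, from the squared norm of [y - E E^T y]. *)
Lemma sqn_tr_orthonormal_le a b c (E : 'M[R]_(a, b)) (y : 'M[R]_(a, c)) :
  orthonormal_cols E -> sqn (E^T *m y) <= sqn y.
Proof.
move=> EE; have := sqn_ge0 (y + (- (E *m (E^T *m y)))).
have -> : - (E *m (E^T *m y)) = (-1) *: (E *m (E^T *m y)) by rewrite scaleN1r.
rewrite sqnD sqnZ sqrrN expr1n mul1r sqn_orthonormal // -scalemxAr mxtraceZ.
have -> : \tr (y^T *m (E *m (E^T *m y))) = sqn (E^T *m y).
  by rewrite sqnE trmx_mul trmxK !mulmxA.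
lra.
Qed.

(* With [y] the first column of [pinv G], [|y|^-1] is the distance of the first
   row of [G] to the span of the others, hence at least its component along [E]. *)
Lemma sqn_pinv_row_le k b n (u : 'M[R]_(1, b)) (N : 'M[R]_(k, b)) (E : 'M[R]_(b, n)) :
  orthonormal_cols E -> N *m E = 0 ->
  sqn (pinv (col_mx u N) *m (col_mx 1%:M 0 : 'cV[R]_(1 + k))) * sqn (u *m E) <= 1.
Proof.
move=> EE NE; set G := col_mx u N; set e := col_mx _ _.
have [d0|d0] := eqVneq (\det (G *m G^T)) 0.
  by rewrite pinv_singular // mul0mx sqn0 mul0r ler01.
(* As [y = G^T z] and [G y = e], the number [|y|^2] is the first entry of [z], and [E^T y] is that
   entry times [(u E)^T]. Bessel then gives [s^2 t <= s]. *)
pose z := ((\det (G *m G^T))^-1 *: \adj (G *m G^T)) *m e.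
set y := pinv G *m e.
have yE : y = G^T *m z by rewrite /y /pinv mulmxA.
have Gy : G *m y = e by rewrite /y mulmxA mulmx_pinv // mul1mx.
have ze : z^T *m e = (usubmx z 0 0)%:M.
  rewrite -(vsubmxK z) tr_col_mx mul_row_col mulmx0 addr0 mulmx1.
  by rewrite [LHS]mx11_scalar mxE col_mxKu.
have sy : sqn y = usubmx z 0 0.
  have := mul_tr_cV y; rewrite {1}yE trmx_mul trmxK -mulmxA Gy ze.
  by move=> /(congr1 (fun A : 'M[R]_1 => A 0 0)); rewrite !mxE eqxx !mulr1n.
have Ey : E^T *m y = usubmx z 0 0 *: (u *m E)^T.
  rewrite yE mulmxA -trmx_mul /G mul_col_mx NE tr_col_mx trmx0 -{1}(vsubmxK z).
  by rewrite mul_row_col mul0mx addr0 {1}[usubmx z]mx11_scalar mul_mx_scalar.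
have := sqn_tr_orthonormal_le y EE.
rewrite Ey sqnZ sqn_trmx -sy; set s := sqn y; set t := sqn (u *m E).
have s0 : 0 <= s := sqn_ge0 y; have t0 : 0 <= t := sqn_ge0 _.
have [->|sN0] := eqVneq s 0; first by rewrite mul0r ler01.
have s_gt0 : 0 < s by rewrite lt_neqAle eq_sym sN0.
by rewrite -[leRHS]mulr1 expr2 -mulrA ler_pM2l.
Qed.

End PseudoInverse.

Section GaussianPseudoInverse.
Variable R : realType.
Context d0 (T : measurableType d0) (P : probability T R).

Lemma integral_probability_cst (c : \bar R) : (\int[P]_w c = c)%E.
Proof.
by rewrite integral_cst // -[RHS]mule1; congr (_ * _)%E; exact: probability_setT.
Qed.

(** By rotation invariance [X *m y] is [|y|] times a Gaussian vector of length [l]. *)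
Lemma integral_sqn_mulX_le l d r (X : T -> mxspace R l d) (y : 'cV[R]_d) :
  iid_std_gaussian_mx P X -> (0 < l)%N -> (0 < r)%N ->
  (\int[P]_w (sqn ((X w : 'M[R]_(l, d)) *m y) ^+ r)%:E <=
   (sqn y ^+ r * (l + 2 * r)%:R ^+ r)%:E)%E.
Proof.
move=> iX l0 r0; have [->|y0] := eqVneq y 0.
  under eq_integral do rewrite mulmx0 sqn0 expr0n eqn0Ngt r0.
  by rewrite integral0 lee_fin mulr_ge0 // exprn_ge0 // sqn_ge0.
have sy := sqn_gt0 y0; pose h := (Num.sqrt (sqn y))^-1 *: y.
have s0 : Num.sqrt (sqn y) != 0 by rewrite gt_eqF // sqrtr_gt0.
have hO : orthonormal_cols h.
  rewrite /orthonormal_cols mul_tr_cV sqnZ exprVn sqr_sqrtr ?(ltW sy) //.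
  by rewrite mulVf // gt_eqF.
have iXh := iid_mulmx_orthonormal iX hO.
have yh : y = Num.sqrt (sqn y) *: h by rewrite scalerA mulfV // scale1r.
have E w : sqn ((X w : 'M[R]_(l, d)) *m y) = sqn y * sqn ((X w : 'M[R]_(l, d)) *m h).
  by rewrite {1}yh -scalemxAr sqnZ sqr_sqrtr // ltW.
have m0 := measurable_sqn (iid_measurable iXh).
have sr : (0 <= (sqn y ^+ r)%:E)%E by rewrite lee_fin exprn_ge0 // ltW.
have mr : measurable_fun setT
    (fun w => (sqn ((X w : 'M[R]_(l, d)) *m h) ^+ r)%:E).
  by apply/measurable_EFinP; exact: measurable_funX.
have r0' w : setT w -> (0 <= (sqn ((X w : 'M[R]_(l, d)) *m h) ^+ r)%:E)%E.
  by rewrite lee_fin exprn_ge0 // sqn_ge0.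
under eq_integral do rewrite E exprMn EFinM.
rewrite (ge0_integralZl P measurableT mr r0' sr) EFinM lee_wpmul2l //.
exact: integral_sqnX_le.
Qed.

(** With the last [k] rows [N] fixed, the component of the Gaussian first row orthogonal to them is
    Gaussian in at least [d - k] dimensions, and its negative moment bounds the integrand. *)
Lemma integral_pinv_e0_le k d a (G : T -> mxspace R (1 + k) d) :
  iid_std_gaussian_mx P G -> (k + (2 * a + 3) <= d)%N ->
  (\int[P]_w (sqn (pinv (G w : 'M[R]_(1 + k, d)) *m (col_mx 1%:M 0 : 'cV[R]_(1 + k)))
     ^+ a.+1)%:E <= (expR a%:R / (2 * a%:R) ^+ a)%:E)%E.
Proof.
move=> iG kd.
pose F (M : mxspace R (1 + k) d) :=
  (sqn (pinv (M : 'M[R]_(1 + k, d)) *m (col_mx 1%:M 0 : 'cV[R]_(1 + k))) ^+ a.+1)%:E.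
have mS d1 (T1 : measurableType d1) (X : T1 -> mxspace R (1 + k) d) :
    measurable_fun setT X -> measurable_fun setT (fun w =>
    sqn (pinv (X w : 'M[R]_(1 + k, d)) *m (col_mx 1%:M 0 : 'cV[R]_(1 + k)))).
  move=> mX; apply: measurable_sqn; apply: measurable_mulmx => //.
  exact: measurable_pinv.
have mF : measurable_fun setT F.
  by apply/measurable_EFinP; apply: measurable_funX; apply: mS; exact: measurable_id.
have F0 M : (0 <= F M)%E by rewrite lee_fin exprn_ge0 // sqn_ge0.
rewrite (integral_decouple iG mF F0).
have iu := iid_usubmx iG; have id' := iid_dsubmx iG.
pose H w w' := F (col_mx (usubmx (G w : 'M[R]_(_, _))) (dsubmx (G w' : 'M[R]_(_, _)))).
have mH : measurable_fun setT (fun z : T * T => H z.1 z.2).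
  apply: (measurableT_comp mF); apply: measurable_col_mx.
    exact: measurableT_comp (iid_measurable iu) _.
  exact: measurableT_comp (iid_measurable id') _.
rewrite (ge0_integral_swap (m1 := P) (m2 := P) H mH (fun _ _ => F0 _)).
set D := (_ / _)%:E.
apply: (@le_trans _ _ (\int[P]_w D)%E); last first.
  by rewrite integral_probability_cst.
apply: ge0_le_integral => //.
- by move=> w _; apply: integral_ge0 => w' _; exact: F0.
- exact: (measurable_fun_integrall (m1 := P) H mH (fun _ _ => F0 _)).
- move=> w' _; set N := dsubmx (G w' : 'M[R]_(_, _)).
  (* [E] is chosen for each fixed [w'], and even its width depends on [N]; only the uniform bound
     [D] is integrated over [w']. *)
  have [E EE EK] := orthonormal_basis_exists (kermx N^T).
  have NE : N *m E = 0.
    rewrite -(trmxK (N *m E)) trmx_mul; move/andP: EK => [/sub_kermxP -> _].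
    by rewrite trmx0.
  have iX := iid_trmx (iid_mulmx_orthonormal iu EE).
  apply: (integral_inv_sqnX_le (n := \rank (kermx N^T)) iX).
  + rewrite mxrank_ker mxrank_tr leq_subRL; last exact: rank_leq_col.
    by apply: leq_trans kd; rewrite leq_add2r; exact: rank_leq_row.
  + apply: mS; apply: measurable_col_mx; first exact: (iid_measurable iu).
    exact: measurable_cst.
  + by move=> w; exact: sqn_ge0.
  + by move=> w; rewrite sqn_trmx; exact: sqn_pinv_row_le.
Qed.

(** An orthogonal matrix with first column [x / |x|] reduces this to the first basis vector. One row
    is set apart there, so [2 * a + 3] becomes [2 * a + 2]. *)
Lemma integral_pinv_le k d a (G : T -> mxspace R k d) (x : 'cV[R]_k) :
  iid_std_gaussian_mx P G -> (0 < k)%N -> (k + (2 * a + 2) <= d)%N ->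
  (\int[P]_w (sqn (pinv (G w : 'M[R]_(k, d)) *m x) ^+ a.+1)%:E <=
   (sqn x ^+ a.+1 * (expR a%:R / (2 * a%:R) ^+ a))%:E)%E.
Proof.
move=> iG k0 kd; set D := _ / _.
have D0 : 0 <= D by rewrite divr_ge0 ?expR_ge0 // exprn_ge0 // mulr_ge0.
have [c kc] : exists c, k = (1 + c)%N by exists k.-1; rewrite add1n prednK.
subst k; have [->|x0] := eqVneq x 0.
  under eq_integral do rewrite mulmx0 sqn0 expr0n.
  by rewrite integral0 lee_fin mulr_ge0 // exprn_ge0 // sqn_ge0.
have sx := sqn_gt0 x0; pose h := (Num.sqrt (sqn x))^-1 *: x.
have s0 : Num.sqrt (sqn x) != 0 by rewrite gt_eqF // sqrtr_gt0.
have hO : orthonormal_cols h.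
  rewrite /orthonormal_cols mul_tr_cV sqnZ exprVn sqr_sqrtr ?(ltW sx) //.
  by rewrite mulVf // gt_eqF.
have [K KO] := orthonormal_completion hO; set O := row_mx h K in KO.
have xh : x = Num.sqrt (sqn x) *: (O *m (col_mx 1%:M 0 : 'cV[R]_(1 + c))).
  by rewrite mul_row_col mulmx0 addr0 mulmx1 scalerA mulfV // scale1r.
have Ot := orthonormal_cols_trmx KO.
have iOG := iid_orthonormal_mulmx iG Ot.
have E w : sqn (pinv (G w : 'M[R]_(_, _)) *m x) =
    sqn x * sqn (pinv (O^T *m (G w : 'M[R]_(_, _))) *m (col_mx 1%:M 0 : 'cV[R]_(1 + c))).
  rewrite pinv_orthonormal // trmxK {1}xh -scalemxAr sqnZ sqr_sqrtr ?(ltW sx) //.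
  by rewrite mulmxA.
have mS : measurable_fun setT (fun w => (sqn (pinv (O^T *m (G w : 'M[R]_(1 + c, d))) *m
    (col_mx 1%:M 0 : 'cV[R]_(1 + c))) ^+ a.+1)%:E).
  apply/measurable_EFinP; apply: measurable_funX; apply: measurable_sqn.
  apply: measurable_mulmx => //; exact: (measurable_pinv (iid_measurable iOG)).
have sr : (0 <= (sqn x ^+ a.+1)%:E)%E by rewrite lee_fin exprn_ge0 // ltW.
under eq_integral do rewrite E exprMn EFinM.
rewrite (ge0_integralZl P measurableT mS _ sr); last first.
  by move=> w _; rewrite lee_fin exprn_ge0 // sqn_ge0.
rewrite EFinM lee_wpmul2l //; apply: (integral_pinv_e0_le iOG).
by apply: leq_trans kd; lia.
Qed.

Lemma integral_ratio_le k l d a (Psi : T -> mxspace R (k + l) d) (x : 'cV[R]_k) :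
  iid_std_gaussian_mx P Psi -> (0 < k)%N -> (0 < l)%N -> (k + (2 * a + 2) <= d)%N ->
  (\int[P]_w (sqn (dsubmx (Psi w : 'M[R]_(_, _)) *m
       pinv (usubmx (Psi w : 'M[R]_(_, _))) *m x) ^+ a.+1)%:E <=
   (sqn x ^+ a.+1 *
     ((l + 2 * a.+1)%:R ^+ a.+1 * (expR a%:R / (2 * a%:R) ^+ a)))%:E)%E.
Proof.
move=> iP k0 l0 kd; set D := _ / _.
pose F (M : mxspace R (k + l) d) := (sqn (dsubmx (M : 'M[R]_(_, _)) *m
       (pinv (usubmx (M : 'M[R]_(_, _))) *m x)) ^+ a.+1)%:E.
have mF : measurable_fun setT F.
  apply/measurable_EFinP; apply: measurable_funX; apply: measurable_sqn.
  apply: measurable_mulmx; first exact: measurable_dsubmx.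
  by apply: measurable_mulmx => //; apply: measurable_pinv; exact: measurable_usubmx.
have F0 M : (0 <= F M)%E by rewrite lee_fin exprn_ge0 // sqn_ge0.
under eq_integral do rewrite -mulmxA.
rewrite (integral_decouple iP mF F0).
have iu := iid_usubmx iP; have id' := iid_dsubmx iP.
have mS : measurable_fun setT
    (fun w => (sqn (pinv (usubmx (Psi w : 'M[R]_(_, _))) *m x) ^+ a.+1)%:E).
  apply/measurable_EFinP; apply: measurable_funX; apply: measurable_sqn.
  apply: measurable_mulmx => //; exact: (measurable_pinv (iid_measurable iu)).
have S0 w : setT w ->
    (0 <= (sqn (pinv (usubmx (Psi w : 'M[R]_(_, _))) *m x) ^+ a.+1)%:E)%E.
  by rewrite lee_fin exprn_ge0 // sqn_ge0.
pose c : R := (l + 2 * a.+1)%:R ^+ a.+1.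
have c0 : (0 <= c%:E)%E by rewrite lee_fin exprn_ge0.
pose H w w' := F (col_mx (usubmx (Psi w : 'M[R]_(_, _))) (dsubmx (Psi w' : 'M[R]_(_, _)))).
have mH : measurable_fun setT (fun z : T * T => H z.1 z.2).
  apply: (measurableT_comp mF); apply: measurable_col_mx.
    exact: measurableT_comp (iid_measurable iu) _.
  exact: measurableT_comp (iid_measurable id') _.
apply: (@le_trans _ _ (\int[P]_w (c%:E *
    (sqn (pinv (usubmx (Psi w : 'M[R]_(_, _))) *m x) ^+ a.+1)%:E))%E).
  apply: ge0_le_integral => //.
  - by move=> w _; apply: integral_ge0 => w' _; exact: F0.
  - exact: (measurable_fun_integralr (m2 := P) H mH (fun _ _ => F0 _)).
  - exact: emeasurable_funM.
  - move=> w _; rewrite -EFinM mulrC.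
    under eq_integral do rewrite /F col_mxKu col_mxKd.
    exact: (integral_sqn_mulX_le _ id').
rewrite (ge0_integralZl P measurableT mS S0 c0) mulrCA EFinM lee_wpmul2l //.
exact: integral_pinv_le.
Qed.

(* Averaging over Gaussian directions: [E |B g|^(2r)] controls the operator norm
   of [B], with a constant exponentially better than that of the Frobenius norm. *)
Lemma opnorm_le_average k l r (X : T -> mxspace R k 1) (B : 'M[R]_(l, k))
    (I : R) (v : 'cV[R]_k) : iid_std_gaussian_mx P X ->
  (\int[P]_w (sqn (B *m (X w : 'M[R]_(k, 1))) ^+ r)%:E = I%:E)%E ->
  sqn (B *m v) ^+ r * (\prod_(j < r) (2 * j + 1))%:R <= sqn v ^+ r * I.
Proof.
move=> iX IE; set m : R := _%:R.
have I0 : 0 <= I.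
  by rewrite -lee_fin -IE; apply: integral_ge0 => w _; rewrite lee_fin exprn_ge0 // sqn_ge0.
case: r => [|r] in IE m *.
  move: IE; under eq_integral do rewrite expr0.
  rewrite integral_probability_cst => -[<-].
  by rewrite /m big_ord0 !expr0 mulr1.
have [Bv0|Bv0] := eqVneq (B *m v) 0.
  by rewrite Bv0 sqn0 expr0n mul0r mulr_ge0 // exprn_ge0 // sqn_ge0.
have sB := sqn_gt0 Bv0; set s := sqn (B *m v) in sB *.
(* The test direction is [B v]: the inner product of [B g] with [B v] is that of [g] with [a], a
   normal variable of variance [|a|^2]. Cauchy-Schwarz bounds its square by [|B v|^2 |B g|^2], and
   also gives [|B v|^4 <= |a|^2 |v|^2]. *)
pose a := B^T *m (B *m v).
have av : \tr (a^T *m v) = s.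
  by rewrite /a trmx_mul trmxK -mulmxA -sqnE.
have sa : s ^+ 2 <= sqn a * sqn v by rewrite -av cauchy_schwarz_mx.
have a_gt0 : 0 < sqn a.
  rewrite lt_neqAle sqn_ge0 andbT eq_sym; apply/eqP => a0.
  by move: sa; rewrite a0 mul0r leNgt exprn_gt0.
pose h := (Num.sqrt (sqn a))^-1 *: a.
have s0 : Num.sqrt (sqn a) != 0 by rewrite gt_eqF // sqrtr_gt0.
have hO : orthonormal_cols h.
  rewrite /orthonormal_cols mul_tr_cV sqnZ exprVn sqr_sqrtr ?(ltW a_gt0) //.
  by rewrite mulVf // gt_eqF.
have iXh := iid_mulmx_orthonormal (iid_trmx iX) hO.
pose g w : R := ((X w : 'M[R]_(k, 1))^T *m h) 0 0.
have gE w : sqn a * g w ^+ 2 <= s * sqn (B *m (X w : 'M[R]_(k, 1))).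
  have -> : sqn a * g w ^+ 2 = (\tr ((B *m (X w : 'M[R]_(k, 1)))^T *m (B *m v))) ^+ 2.
    rewrite trmx_mul -mulmxA -/a /mxtrace big_ord1.
    have -> : a = Num.sqrt (sqn a) *: h by rewrite scalerA mulfV // scale1r.
    rewrite -scalemxAr [in RHS]mxE exprMn sqr_sqrtr ?sqn_ge0 //.
    by rewrite {1}scalerA mulfV // scale1r.
  by rewrite mulrC cauchy_schwarz_mx.
have mpow : measurable_fun setT (fun x : R => (x ^+ (2 * r.+1))%:E).
  by apply/measurable_EFinP.
have pow_ge0 (x : R) : (0 <= (x ^+ (2 * r.+1))%:E)%E.
  by rewrite lee_fin exprM exprn_ge0 // sqr_ge0.
have mg : measurable_fun setT (fun w => (g w ^+ (2 * r.+1))%:E).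
  exact: measurableT_comp mpow (measurable_fun_coord _ _ (iid_measurable iXh)).
have sa0 : (0 <= (sqn a ^+ r.+1)%:E)%E by rewrite lee_fin exprn_ge0 // ltW.
have sr0 : (0 <= (s ^+ r.+1)%:E)%E by rewrite lee_fin exprn_ge0 // ltW.
have key : ((sqn a ^+ r.+1 * m)%:E <= (s ^+ r.+1 * I)%:E)%E.
  have mBX : measurable_fun setT (fun w => (sqn (B *m (X w : 'M[R]_(k, 1))) ^+ r.+1)%:E).
    apply/measurable_EFinP; apply: measurable_funX; apply: measurable_sqn.
    by apply: measurable_mulmx => //; exact: iid_measurable iX.
  have BX0 w : setT w -> (0 <= (sqn (B *m (X w : 'M[R]_(k, 1))) ^+ r.+1)%:E)%E.
    by rewrite lee_fin exprn_ge0 // sqn_ge0.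
  rewrite !EFinM -IE -(ge0_integralZl P measurableT mBX BX0 sr0).
  apply: (@le_trans _ _ ((sqn a ^+ r.+1)%:E * \int[P]_w (g w ^+ (2 * r.+1))%:E)%E).
    by rewrite lee_wpmul2l // (integral_iid11 iXh mpow pow_ge0); exact: even_moment_ge.
  rewrite -(ge0_integralZl P measurableT mg (fun w _ => pow_ge0 _) sa0).
  apply: ge0_le_integral => //.
  - by move=> w _; rewrite mule_ge0.
  - exact: emeasurable_funM.
  - exact: emeasurable_funM.
  - move=> w _; rewrite -!EFinM lee_fin exprM -!exprMn lerXn2r ?nnegrE //.
      by rewrite mulr_ge0 ?sqn_ge0 // sqr_ge0.
    by rewrite mulr_ge0 ?sqn_ge0.
rewrite lee_fin in key.
have sv : 0 <= sqn v := sqn_ge0 v.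
rewrite -(ler_pM2l (exprn_gt0 r.+1 sB)) mulrA -exprMn -expr2.
apply: (@le_trans _ _ ((sqn a * sqn v) ^+ r.+1 * m)).
  by rewrite ler_wpM2r // lerXn2r // nnegrE ?mulr_ge0 ?exprn_ge0 ?(ltW sB) ?(ltW a_gt0).
have -> : (sqn a * sqn v) ^+ r.+1 * m = sqn v ^+ r.+1 * (sqn a ^+ r.+1 * m).
  by rewrite exprMn; ring.
by rewrite [leRHS]mulrCA ler_wpM2l // exprn_ge0.
Qed.

End GaussianPseudoInverse.

(** * Averaging the bound *)

Section ScalarBounds.
Variable R : realType.

Lemma expR1_ge2 : 2 <= expR 1 :> R.
Proof. by have := expR_ge1Dx (1 : R); rewrite -[1 + 1]/2%:R. Qed.

(** Induction through [(1 + 1 / r)^r <= e]. *)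
Lemma exprnn_le_fact r : r%:R ^+ r <= expR r%:R * r`!%:R :> R.
Proof.
elim: r => [|r IH]; first by rewrite expr0 expR0 mul1r.
rewrite exprS factS natrM mulrCA ler_wpM2l //.
apply: le_trans (_ : expR 1 * r%:R ^+ r <= _); last first.
  by rewrite -natr1 addrC expRD -mulrA ler_wpM2l // expR_ge0.
case: r {IH} => [|r]; first by rewrite !expr0 mulr1 (le_trans _ expR1_ge2) // ler1n.
have r0 : 0 < r.+1%:R :> R by [].
have -> : r.+2%:R = r.+1%:R * (1 + r.+1%:R^-1) :> R.
  by rewrite mulrDr mulr1 divff ?gt_eqF // natr1.
rewrite exprMn mulrC ler_wpM2r ?exprn_ge0 //.
have -> : expR 1 = expR r.+1%:R^-1 ^+ r.+1 :> R.
  by rewrite -expRM_natl divff // gt_eqF.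
by rewrite lerXn2r ?nnegrE ?expR_ge0 // expR_ge1Dx.
Qed.

Lemma fact_le_odd_prod r : (r`! <= \prod_(j < r) (2 * j + 1))%N.
Proof.
elim: r => [|r IH]; first by rewrite big_ord0.
by rewrite big_ord_recr /= factS mulnC leq_mul //; lia.
Qed.

Lemma addn2_mul3X_le a : ((a + 2) * 3 ^ a <= 4 ^ a.+1)%N.
Proof.
elim: a => [//|[//|a] IH].
have -> : (4 ^ a.+3 = 4 * 4 ^ a.+2)%N by rewrite -expnS.
have -> : (3 ^ a.+2 = 3 * 3 ^ a.+1)%N by rewrite -expnS.
apply: leq_trans (_ : 4 * ((a.+1 + 2) * 3 ^ a.+1) <= _)%N; last by rewrite leq_mul2l.
by rewrite !mulnA leq_mul2r; apply/orP; right; lia.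
Qed.

(** This puts the constant of the negative moment in the shape of [omega]. With [r = a + 1], the
    double factorial is at least [r!], hence at least [(r / e)^r]; a comparison of powers
    remains. *)
Lemma moment_constant_le a :
  expR a%:R / (2 * a%:R) ^+ a <=
  (\prod_(j < a.+1) (2 * j + 1))%:R * (4 * expR 1 ^+ 2 / a.+2%:R ^+ 2) ^+ a.+1 :> R.
Proof.
set M : R := (\prod_(j < a.+1) (2 * j + 1))%:R; set e := expR 1; set r := a.+1.
have e0 : 0 < e by exact: expR_gt0.
have eX n : expR n%:R = e ^+ n :> R by rewrite -expRM_natl mulr1.
have M_ge : r%:R ^+ r / e ^+ r <= M.
  rewrite ler_pdivrMr ?exprn_gt0 // mulrC -eX; apply: (le_trans (exprnn_le_fact r)).
  by rewrite ler_wpM2l ?expR_ge0 // ler_nat fact_le_odd_prod.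
(* For [a >= 1], use [r + 1 <= 2 r] in [r] factors and [r + 1 <= 3 a] in [a] others, then
   [(a + 2) 3^a <= 4^r]; the spare [2] is absorbed by [e]. For [a = 0] the claim is [4 <= 4 e]. *)
have poly : r.+1%:R ^+ (2 * r) <= 4 ^+ r * e * r%:R ^+ r * (2 * a%:R) ^+ a :> R.
  have [a0|a0] := posnP a.
    rewrite /r a0 expr0 mulr1 muln1 !expr1 mulr1.
    have := expR1_ge2; rewrite -/e; lra.
  have -> : r.+1%:R ^+ (2 * r) = r.+1%:R ^+ r * (r.+1%:R * r.+1%:R ^+ a) :> R.
    by rewrite mul2n -addnn exprD -exprS.
  have h1 : r.+1%:R ^+ r <= 2 ^+ r * r%:R ^+ r :> R.
    by rewrite -exprMn lerXn2r ?nnegrE ?mulr_ge0 // -natrM ler_nat /r; lia.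
  have h2 : r.+1%:R * r.+1%:R ^+ a <= (a + 2)%:R * (3 ^+ a * a%:R ^+ a) :> R.
    rewrite -exprMn ler_pM ?exprn_ge0 //; first by rewrite ler_nat /r; lia.
    by rewrite lerXn2r ?nnegrE ?mulr_ge0 // -natrM ler_nat /r; lia.
  apply: (le_trans (ler_pM _ _ h1 h2)); rewrite ?mulr_ge0 ?exprn_ge0 //.
  have h3 : (a + 2)%:R * 3 ^+ a <= 4 ^+ r :> R.
    by rewrite -!natrX -natrM ler_nat addn2_mul3X_le.
  have -> : 4 ^+ r * e * r%:R ^+ r * (2 * a%:R) ^+ a =
      2 ^+ a * r%:R ^+ r * a%:R ^+ a * (e * 4 ^+ r) :> R by rewrite exprMn; ring.
  have -> : 2 ^+ r * r%:R ^+ r * ((a + 2)%:R * (3 ^+ a * a%:R ^+ a)) =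
      2 ^+ a * r%:R ^+ r * a%:R ^+ a * (2 * ((a + 2)%:R * 3 ^+ a)) :> R.
    by rewrite /r exprS; ring.
  rewrite ler_wpM2l ?mulr_ge0 ?exprn_ge0 //.
  by rewrite ler_pM ?mulr_ge0 ?exprn_ge0 // expR1_ge2.
have r20 : 0 < r.+1%:R ^+ 2 :> R by rewrite exprn_gt0.
apply: (@le_trans _ _ (r%:R ^+ r / e ^+ r * (4 * e ^+ 2 / r.+1%:R ^+ 2) ^+ r)); last first.
  by rewrite ler_wpM2r // exprn_ge0 // divr_ge0 ?mulr_ge0 ?exprn_ge0 // ltW.
have D0 : 0 < (2 * a%:R) ^+ a :> R.
  have [->|a0] := posnP a; first by rewrite expr0.
  by rewrite exprn_gt0 // mulr_gt0 // ltr0n.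
rewrite ler_pdivrMr // eX.
rewrite expr_div_n exprMn -!exprM.
have -> : r%:R ^+ r / e ^+ r * (4 ^+ r * e ^+ (2 * r) / r.+1%:R ^+ (2 * r)) * (2 * a%:R) ^+ a
   = e ^+ a * (4 ^+ r * e * r%:R ^+ r * (2 * a%:R) ^+ a) / r.+1%:R ^+ (2 * r).
  have -> : e ^+ (2 * r) = e ^+ r * (e ^+ a * e) by rewrite mul2n -addnn exprD -exprSr.
  by field; rewrite !expf_neq0 // gt_eqF.
by rewrite ler_pdivlMr ?exprn_gt0 // ler_wpM2l // exprn_ge0 // ltW.
Qed.

(** Once [moment_constant_le] is applied, both sides are [r]-th powers up to the double factorial,
    and [om2] compares the bases. It uses [2 r <= p] in the numerators and [p + 1 <= 2 (r + 1)] in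
    the denominator; the latter turns the [4] in [omega] into the [2] that is required. *)
Lemma omega_bound (k l p : nat) (r := (p./2)%N)
  (om : R := (Num.sqrt l%:R + Num.sqrt (k + p)%:R + 7)
            * (4 * expR 1 * Num.sqrt (k + p)%:R / (p + 1)%:R)) : (2 <= p)%N ->
  (k + 2 * r)%:R ^+ r * ((l + 2 * r)%:R ^+ r * (expR r.-1%:R / (2 * r.-1%:R) ^+ r.-1))
  <= (\prod_(j < r) (2 * j + 1))%:R * om ^+ (2 * r).
Proof.
move=> p2.
have r0 : (0 < r)%N by rewrite /r half_gt0.
have rp : (2 * r <= p)%N by rewrite /r mul2n -{2}(odd_double_half p) leq_addl.
have pr : (p <= 2 * r + 1)%N.
  by rewrite /r mul2n -{1}(odd_double_half p) addnC leq_add2l leq_b1.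
have [a ra] : exists a, r = a.+1 by exists r.-1; rewrite prednK.
rewrite ra /=.
set M : R := (\prod_(j < a.+1) (2 * j + 1))%:R; set e := expR 1 in om *.
have e0 : 0 < e by exact: expR_gt0.
have om2 : (k + 2 * a.+1)%:R * (l + 2 * a.+1)%:R * (4 * e ^+ 2 / a.+2%:R ^+ 2) <= om ^+ 2.
  rewrite /om; set x := Num.sqrt l%:R; set y := Num.sqrt (k + p)%:R.
  have x0 : 0 <= x by exact: sqrtr_ge0.
  have y0 : 0 <= y by exact: sqrtr_ge0.
  have x2 : x ^+ 2 = l%:R by rewrite sqr_sqrtr.
  have y2 : y ^+ 2 = (k + p)%:R by rewrite sqr_sqrtr.
  have p10 : 0 < (p + 1)%:R :> R by rewrite addn1.
  have -> : ((x + y + 7) * (4 * e * y / (p + 1)%:R)) ^+ 2 =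
      y ^+ 2 * (x + y + 7) ^+ 2 * (4 * e ^+ 2 * (4 / (p + 1)%:R ^+ 2)).
    by field; rewrite gt_eqF.
  rewrite ler_pM ?mulr_ge0 ?divr_ge0 ?exprn_ge0 ?(ltW e0) ?invr_ge0 ?exprn_ge0 //.
    rewrite ler_pM //; first by rewrite y2 ler_nat leq_add2l -ra.
    apply: (@le_trans _ _ (x ^+ 2 + y ^+ 2)); last by nra.
    rewrite x2 y2 -natrD ler_nat; lia.
  rewrite ler_wpM2l ?mulr_ge0 ?exprn_ge0 ?(ltW e0) //.
  rewrite -[leLHS]mul1r ler_pdivrMr ?exprn_gt0 // mulrAC ler_pdivlMr ?exprn_gt0 // mul1r.
  have -> : 4 * a.+2%:R ^+ 2 = (2 * a.+2%:R) ^+ 2 :> R by ring.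
  by rewrite lerXn2r ?nnegrE ?mulr_ge0 // -natrM ler_nat; lia.
apply: (@le_trans _ _ (M * ((k + 2 * a.+1)%:R * (l + 2 * a.+1)%:R *
    (4 * e ^+ 2 / a.+2%:R ^+ 2)) ^+ a.+1)); last first.
  rewrite exprM ler_wpM2l // lerXn2r ?nnegrE ?sqr_ge0 //.
  by rewrite !mulr_ge0 ?invr_ge0 ?exprn_ge0 // ltW.
rewrite !exprMn [leRHS]mulrCA -mulrA ler_wpM2l ?exprn_ge0 //.
rewrite ler_wpM2l ?exprn_ge0 //; have := moment_constant_le a.
by rewrite !exprMn.
Qed.

(** The tangent at [v] has slope [1 / s^3]. After squaring, the difference of the two sides has the
    factor [(u - v)^2]. *)
Lemma saturation_concave (u v : R) : 0 <= u -> 0 <= v ->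
  u / Num.sqrt (1 + u ^+ 2) <=
  v / Num.sqrt (1 + v ^+ 2) + (u - v) / Num.sqrt (1 + v ^+ 2) ^+ 3.
Proof.
move=> u0 v0; set s := Num.sqrt (1 + v ^+ 2); set t := Num.sqrt (1 + u ^+ 2).
have s2 : s ^+ 2 = 1 + v ^+ 2 by rewrite sqr_sqrtr // addr_ge0 // sqr_ge0.
have t2 : t ^+ 2 = 1 + u ^+ 2 by rewrite sqr_sqrtr // addr_ge0 // sqr_ge0.
have s0 : 0 < s by rewrite sqrtr_gt0 ltr_wpDr // sqr_ge0.
have t0 : 0 < t by rewrite sqrtr_gt0 ltr_wpDr // sqr_ge0.
have -> : v / s + (u - v) / s ^+ 3 = (u + v ^+ 3) / s ^+ 3.
  have -> : v / s = v * s ^+ 2 / s ^+ 3 by field; rewrite gt_eqF.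
  by rewrite s2; ring.
rewrite ler_pdivrMr // mulrAC ler_pdivlMr ?exprn_gt0 //.
have L0 : 0 <= u * s ^+ 3 by rewrite mulr_ge0 // exprn_ge0 // ltW.
have R0 : 0 <= (u + v ^+ 3) * t by rewrite mulr_ge0 ?(ltW t0) // addr_ge0 // exprn_ge0.
rewrite -(ler_pXn2r (_ : (0 < 2)%N)) ?nnegrE // [leRHS]exprMn t2.
have -> : (u * s ^+ 3) ^+ 2 = u ^+ 2 * (s ^+ 2) ^+ 3 by ring.
rewrite s2 -subr_ge0.
have -> : (u + v ^+ 3) ^+ 2 * (1 + u ^+ 2) - u ^+ 2 * (1 + v ^+ 2) ^+ 3 =
    (u - v) ^+ 2 * (u * (u + 2 * v) + v ^+ 3 * (2 * u + v)) by ring.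
by rewrite mulr_ge0 ?sqr_ge0 // addr_ge0 ?mulr_ge0 ?addr_ge0 ?exprn_ge0 ?mulr_ge0.
Qed.

Lemma expr_tangent_le (n : nat) (x y : R) : 0 <= x -> 0 <= y ->
  n.+1%:R * y ^+ n * (x - y) <= x ^+ n.+1 - y ^+ n.+1.
Proof.
move=> x0 y0; rewrite subrXX mulrC.
have [yx|xy] := lerP y x.
  rewrite ler_wpM2l ?subr_ge0 //.
  rewrite (_ : n.+1%:R * y ^+ n = \sum_(i < n.+1) y ^+ n); last first.
    by rewrite sumr_const card_ord mulr_natl.
  apply: ler_sum => i _; rewrite -{1}(subnK (leq_ord i)) exprD.
  by rewrite ler_wpM2r ?exprn_ge0 // lerXn2r ?nnegrE.
rewrite ler_wnM2l ?subr_le0 ?(ltW xy) //.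
rewrite (_ : n.+1%:R * y ^+ n = \sum_(i < n.+1) y ^+ n); last first.
  by rewrite sumr_const card_ord mulr_natl.
apply: ler_sum => i _.
rewrite (_ : y ^+ n = y ^+ (n - i) * y ^+ i); last by rewrite -exprD subnK // leq_ord.
by rewrite ler_wpM2r ?exprn_ge0 // lerXn2r ?nnegrE // ltW.
Qed.

(* The right-hand side is the tangent, at [om], of the left-hand side seen as a
   concave function of [tau ^+ n]. *)
Lemma saturation_tangent (D om : R) (n : nat) : 0 <= D -> 0 < om -> (0 < n)%N ->
  exists b c : R, [/\ 0 <= b, 0 <= c,
    b + c * om ^+ n = D * om / Num.sqrt (1 + (D * om) ^+ 2) &
    forall tau, 0 <= tau ->
      D * tau / Num.sqrt (1 + (D * tau) ^+ 2) <= b + c * tau ^+ n].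
Proof.
case: n => // n D0 om0 _; set s := Num.sqrt (1 + (D * om) ^+ 2).
have s2 : s ^+ 2 = 1 + (D * om) ^+ 2 by rewrite sqr_sqrtr // addr_ge0 // sqr_ge0.
have s0 : 0 < s by rewrite sqrtr_gt0 ltr_wpDr // sqr_ge0.
have n0 : 0 < n.+1%:R :> R by [].
have n1 : 1 <= n.+1%:R :> R by rewrite ler1n.
(* The derivative at [om] of the left-hand side, [D / s^3], over that of [tau ^+ n.+1]. *)
pose c := D / (s ^+ 3 * (n.+1%:R * om ^+ n)).
have on0 : 0 < om ^+ n by rewrite exprn_gt0.
have c0 : 0 <= c by rewrite divr_ge0 // !mulr_ge0 ?exprn_ge0 // ltW.
have cE x : c * (n.+1%:R * om ^+ n * x) = D * x / s ^+ 3.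
  by rewrite /c; field; rewrite !gt_eqF //= nat1r.
exists (D * om / s - c * om ^+ n.+1), c; split => //.
(* This is [0 <= b]: the subtracted term is the value at [om] divided by [s^2 (n + 1)], which is at
   least [1]. *)
- have -> : c * om ^+ n.+1 = D * om / s * ((s ^+ 2)^-1 / n.+1%:R).
    by rewrite /c (exprS om); field; rewrite !gt_eqF //= nat1r.
  rewrite -[X in X - _]mulr1 -mulrBr mulr_ge0 //.
    by rewrite !mulr_ge0 ?invr_ge0 // ltW.
  rewrite subr_ge0 -invfM invf_le1.
    by rewrite -[leLHS]mul1r ler_pM // s2 lerDl sqr_ge0.
  by rewrite mulr_gt0 // exprn_gt0.
- by rewrite subrK.
- move=> tau tau0; have u0 : 0 <= D * tau by rewrite mulr_ge0.
  have v0 : 0 <= D * om by rewrite mulr_ge0 // ltW.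
  apply: (le_trans (saturation_concave u0 v0)); rewrite -/s -addrA lerD2l.
  rewrite -mulrBr -cE addrC -mulrBr ler_wpM2l //.
  exact: expr_tangent_le (ltW om0).
Qed.

End ScalarBounds.

(** * Jensen's inequality through the tangent *)

Section Jensen.
Variable R : realType.
Context d (T : measurableType d) (P : probability T R).

Lemma powR_inv_expr (x : R) n : 0 <= x -> (0 < n)%N -> (x `^ n%:R^-1) ^+ n = x.
Proof.
move=> x0 n0; rewrite -powR_mulrn ?powR_ge0 // -powRrM mulVf ?powRr1 //.
by rewrite pnatr_eq0 -lt0n.
Qed.

(** The tangent is affine in [tau ^+ n], so its mean involves only the mean of [I]. Quantifying over
    [tau] keeps roots out of the hypothesis, which is silent where [I] is infinite; that set is null
    because the mean is finite. *)
Lemma integral_saturation_le (S : T -> R) (I : T -> \bar R) (D om m : R) n :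
  measurable_fun setT S -> measurable_fun setT I -> (forall w, 0 <= I w)%E ->
  0 <= D -> 0 < om -> 0 < m -> (0 < n)%N ->
  {ae P, forall w, forall tau, 0 <= tau -> I w = (m * tau ^+ n)%:E ->
    S w <= D * tau / Num.sqrt (1 + (D * tau) ^+ 2)} ->
  (\int[P]_w I w <= (m * om ^+ n)%:E)%E ->
  (\int[P]_w (S w)%:E <= (D * om / Num.sqrt (1 + (D * om) ^+ 2))%:E)%E.
Proof.
move=> mS mI I0 D0 om0 m0 n0 SI Iom.
have [b [c [b0 c0 bcE bc]]] := saturation_tangent D0 om0 n0.
have cm0 : (0 <= (c / m)%:E)%E by rewrite lee_fin divr_ge0 // ltW.
have mcI : measurable_fun setT (fun w => (c / m)%:E * I w)%E.
  exact: emeasurable_funM.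
have cI0 w : setT w -> (0 <= (c / m)%:E * I w)%E by rewrite mule_ge0.
have b0' w : setT w -> (0 <= (fun _ : T => b%:E) w)%E by rewrite lee_fin.
have mb : measurable_fun setT (fun _ : T => b%:E) by [].
have fI : {ae P, forall w, I w \is a fin_num}.
  have iI : P.-integrable setT I.
    apply/integrableP; split => //; apply: (@le_lt_trans _ _ (m * om ^+ n)%:E).
      by under eq_integral do rewrite gee0_abs //.
    by rewrite ltry.
  by apply: filterS (integrable_ae measurableT iI) => w; exact.
apply: (@le_trans _ _ (\int[P]_w (b%:E + (c / m)%:E * I w))%E); last first.
  rewrite (ge0_integralD P measurableT b0' mb cI0 mcI) integral_probability_cst.
  rewrite (ge0_integralZl P measurableT mI (fun w _ => I0 w) cm0) -bcE EFinD leeD2l //.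
  rewrite (_ : c * om ^+ n = c / m * (m * om ^+ n)); last by field; rewrite gt_eqF.
  by rewrite (EFinM (c / m)) lee_wpmul2l.
(* [S] has no prescribed sign; its positive part allows a comparison of nonnegative integrals. *)
apply: (@le_trans _ _ (\int[P]_w ((fun w => (S w)%:E)^\+ w))%E).
  rewrite integralE -[leRHS]sube0 leeB //; apply: integral_ge0 => w _; exact: funeneg_ge0.
apply: ae_ge0_le_integral => //.
- by apply: measurable_funepos; exact/measurable_EFinP.
- by move=> w _; rewrite adde_ge0 // ?cI0.
- exact: emeasurable_funD.
- apply: filterS2 SI fI => w SI fI _.
  rewrite funeposE ge_max adde_ge0 ?cI0 ?lee_fin // andbT.
  have [x Ix] : exists x, I w = x%:E by exists (fine (I w)); rewrite fineK.
  have x0 : 0 <= x by rewrite -lee_fin -Ix.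
  have xm0 : 0 <= x / m by rewrite divr_ge0 // ltW.
  pose tau := (x / m) `^ n%:R^-1.
  have tE : tau ^+ n = x / m by exact: powR_inv_expr.
  have tau0 : 0 <= tau by exact: powR_ge0.
  have Iw : I w = (m * tau ^+ n)%:E by rewrite Ix tE mulrC divfK // gt_eqF.
  rewrite Ix -EFinM -EFinD lee_fin.
  apply: (le_trans (SI _ tau0 Iw)); apply: (le_trans (bc _ tau0)).
  by rewrite tE mulrAC mulrA.
Qed.

End Jensen.

(* [I w] is the [2r]-th moment of [|B w g|] for an independent Gaussian vector [g]. *)
Lemma gaussian_ratio_moment (R : realType) d0 (T : measurableType d0)
    (P : probability T R) k l p (Psi : T -> mxspace R (k + l) (k + p))
    (B := fun w => dsubmx (Psi w : 'M[R]_(_, _)) *m pinv (usubmx (Psi w : 'M[R]_(_, _))))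
    (n := (2 * p./2)%N) (m : R := (\prod_(j < p./2) (2 * j + 1))%:R)
    (om : R := (Num.sqrt l%:R + Num.sqrt (k + p)%:R + 7)
            * (4 * expR 1 * Num.sqrt (k + p)%:R / (p + 1)%:R)) :
  iid_std_gaussian_mx P Psi -> (0 < k)%N -> (0 < l)%N -> (2 <= p)%N ->
  exists I : T -> \bar R, [/\ measurable_fun setT I, forall w, (0 <= I w)%E,
    (\int[P]_w I w <= (m * om ^+ n)%:E)%E &
    forall w tau (v : 'cV[R]_k), 0 <= tau -> I w = (m * tau ^+ n)%:E ->
      sqn (B w *m v) <= tau ^+ 2 * sqn v].
Proof.
move=> iP k0 l0 p2.
have r0 : (0 < p./2)%N by rewrite half_gt0.
have [a ra] : exists a, p./2 = a.+1 by exists p./2.-1; rewrite prednK.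
have m0 : 0 < m.
  by rewrite ltr0n; apply: prodn_gt0 => j; rewrite addn1.
(* The first column of [Psi1], read at a second sample point, serves as the independent Gaussian
   vector, so [T] itself carries the averaging. *)
pose h : 'cV[R]_(k + p) := delta_mx (lshift p (Ordinal k0)) 0.
have hO : orthonormal_cols h.
  rewrite /orthonormal_cols trmx_delta mul_delta_mx.
  by apply/matrixP => i j; rewrite !ord1 !mxE.
have iX := iid_mulmx_orthonormal (iid_usubmx iP) hO.
set X := (fun w => _) in iX.
pose H w w' := (sqn (B w *m (X w' : 'M[R]_(k, 1))) ^+ p./2)%:E.
have H0 w w' : (0 <= H w w')%E by rewrite lee_fin exprn_ge0 // sqn_ge0.
have mB : measurable_fun setT (B : T -> mxspace R l k).
  apply: measurable_mulmx; first exact: iid_measurable (iid_dsubmx iP).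
  exact: measurable_pinv (iid_measurable (iid_usubmx iP)).
have mH : measurable_fun setT (fun z : T * T => H z.1 z.2).
  apply/measurable_EFinP; apply: measurable_funX; apply: measurable_sqn.
  apply: measurable_mulmx; first exact: measurableT_comp mB _.
  exact: measurableT_comp (iid_measurable iX) _.
exists (fun w => \int[P]_w' H w w')%E; split.
- exact: (measurable_fun_integralr (m2 := P) H mH H0).
- by move=> w; exact: integral_ge0.
- rewrite (ge0_integral_swap (m1 := P) (m2 := P) H mH H0).
  pose c : R := (l + 2 * a.+1)%:R ^+ a.+1 * (expR a%:R / (2 * a%:R) ^+ a).
  have c0 : 0 <= c.
    by rewrite mulr_ge0 ?exprn_ge0 // divr_ge0 ?expR_ge0 // exprn_ge0 // mulr_ge0.
  have mX : measurable_fun setT (fun w => (sqn (X w : 'M[R]_(k, 1)) ^+ p./2)%:E).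
    apply/measurable_EFinP; apply: measurable_funX; apply: measurable_sqn.
    exact: iid_measurable iX.
  have X0 w : setT w -> (0 <= (sqn (X w : 'M[R]_(k, 1)) ^+ p./2)%:E)%E.
    by rewrite lee_fin exprn_ge0 // sqn_ge0.
  apply: (@le_trans _ _ (\int[P]_w (c%:E * (sqn (X w : 'M[R]_(k, 1)) ^+ p./2)%:E))%E).
    apply: ge0_le_integral => //.
    + by move=> w _; apply: integral_ge0.
    + exact: (measurable_fun_integrall (m1 := P) H mH H0).
    + exact: emeasurable_funM.
    + move=> w _; rewrite /H ra -EFinM mulrC; apply: (integral_ratio_le _ iP) => //.
      by have := odd_double_half p; rewrite leq_add2l ra -mul2n; lia.
  rewrite (ge0_integralZl P measurableT mX X0) ?lee_fin //.
  apply: (@le_trans _ _ (c%:E * ((k + 2 * p./2)%:R ^+ p./2)%:E)%E).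
    by rewrite lee_wpmul2l ?lee_fin //; exact: (integral_sqnX_le iX).
  rewrite -EFinM lee_fin mulrC; have := omega_bound R k l p2.
  by rewrite -/m -/om /c /n ra /=.
- move=> w tau v tau0 Iw; have := opnorm_le_average v iX Iw.
  rewrite -/m mulrCA mulrC ler_pM2l // /n exprM -exprMn.
  by rewrite ler_pXn2r ?nnegrE ?mulr_ge0 ?sqr_ge0 ?sqn_ge0 // mulrC.
Qed.

Unset Implicit Arguments.

Theorem theorem7 (R : realType) (d0 : measure_display) (T : measurableType d0)
  (P : probability T R) (m n k p q : nat)
  (A : 'M[R]_(m, n)) (U : 'M[R]_m) (V : 'M[R]_n) (sigma : nat -> R)
  (Phi : T -> 'M[R]_(m, k + p)) (sin_th sin_ph : T -> 'I_k -> R) :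
  (n <= m)%N -> (1 <= k)%N -> (2 <= p)%N -> (k + p < n)%N ->
  (* full SVD A = U Sigma V^T, sigma_1 >= ... >= sigma_n >= 0 *)
  orthonormal_cols U -> orthonormal_cols V ->
  (forall i j, (i <= j)%N -> (j < n)%N -> sigma j <= sigma i) ->
  (forall i, (i < n)%N -> 0 <= sigma i) ->
  A = U *m diag_rect m n sigma *m V^T ->
  0 < sigma k.-1 ->
  (* Phi has i.i.d. standard normal entries *)
  iid_std_gaussian_mx P Phi ->
  (* rank assumptions (hold almost surely) *)
  {ae P, forall w, \rank (((A^T *m A) ^+ q) *m A^T *m Phi w) = (k + p)%N /\
                   \rank ((lead_cols k U)^T *m Phi w) = k} ->
  (* sin_th w, sin_ph w : sines of principal angles for the RU-QLP output *)
  (forall w Pbar Q Rm Pt Rt,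
      \rank (((A^T *m A) ^+ q) *m A^T *m Phi w) = (k + p)%N ->
      ruqlp_run q A (Phi w) Pbar Q Rm Pt Rt ->
      sin_principal_angles Q (lead_cols k U) (sin_th w) /\
      sin_principal_angles (Pbar *m Pt) (lead_cols k V) (sin_ph w)) ->
  (forall i, measurable_fun setT (fun w => sin_th w i)) ->
  (forall i, measurable_fun setT (fun w => sin_ph w i)) ->
  let om := (Num.sqrt (m - k)%:R + Num.sqrt (k + p)%:R + 7)
            * (4 * expR 1 * Num.sqrt (k + p)%:R / (p + 1)%:R) in
  forall i : 'I_k,
    let delta := sigma k / sigma i in
    (\int[P]_w (sin_th w i)%:E
       <= (delta ^+ (2 * q + 2) * om
           / Num.sqrt (1 + delta ^+ (4 * q + 4) * om ^+ 2))%:E)%E /\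
    (\int[P]_w (sin_ph w i)%:E
       <= (delta ^+ (2 * q + 1) * om
           / Num.sqrt (1 + delta ^+ (4 * q + 2) * om ^+ 2))%:E)%E.
Proof.
move=> nm k0 p2 kpn UU VV smono s0 Asvd sk iPhi rk run mth mph om i delta.
have kn : (k < n)%N by apply: leq_ltn_trans kpn; exact: leq_addr.
have [l ml] : exists l, m = (k + l)%N by exists (m - k)%N; lia.
have [l' nl] : exists l', n = (k + l')%N by exists (n - k)%N; lia.
subst m n; have l0 : (0 < l)%N by lia.
have omE : om = (Num.sqrt l%:R + Num.sqrt (k + p)%:R + 7)
            * (4 * expR 1 * Num.sqrt (k + p)%:R / (p + 1)%:R).
  by rewrite /om addKn.
have om0 : 0 < om.
  have s_gt0 : 0 < Num.sqrt (k + p)%:R :> R by rewrite sqrtr_gt0 ltr0n addn_gt0 k0.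
  rewrite omE; apply: mulr_gt0; first by rewrite ltr_wpDl // addr_ge0 // sqrtr_ge0.
  by rewrite divr_gt0 ?addn1 // !mulr_gt0 // expR_gt0.
have iPsi := iid_orthonormal_mulmx iPhi (orthonormal_cols_trmx UU).
have [I [mI I0 Iom Iop]] := gaussian_ratio_moment iPsi k0 l0 p2.
rewrite -omE in Iom.
have p20 : (0 < 2 * p./2)%N by rewrite muln_gt0 half_gt0.
have m0 : 0 < (\prod_(j < p./2) (2 * j + 1))%:R :> R.
  by rewrite ltr0n; apply: prodn_gt0 => j; rewrite addn1.
have delta0 : 0 <= delta.
  by rewrite divr_ge0 ?s0 // (ltn_trans (ltn_ord i)).
(* Any [tau] that solves the power identity bounds the operator norm of [B w]; one [I] serves both
   sines. *)
have pointwise : {ae P, forall w, forall tau, 0 <= tau ->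
    I w = ((\prod_(j < p./2) (2 * j + 1))%:R * tau ^+ (2 * p./2))%:E ->
    let g t := t / Num.sqrt (1 + t ^+ 2) in
    sin_th w i <= g (delta ^+ (2 * q + 2) * tau) /\
    sin_ph w i <= g (delta ^+ (2 * q + 1) * tau)}.
  apply: filterS rk => w [rB rPhi] tau tau0 Iw.
  apply: (ruqlp_sines_le nm k0 kn UU VV smono s0 Asvd sk i rB rPhi _ tau0).
    by move=> Pbar Q Rm Pt Rt; exact: run.
  by move=> x; exact: Iop.
have expr2M a : (a * om) ^+ 2 = a ^+ 2 * om ^+ 2 by exact: exprMn.
split.
- rewrite (_ : (4 * q + 4 = (2 * q + 2) * 2)%N); last by lia.
  rewrite exprM -expr2M.
  apply: (integral_saturation_le (mth i) mI I0 (exprn_ge0 _ delta0) om0 m0 p20) Iom.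
  by apply: filterS pointwise => w pw tau tau0 Iw; have [] := pw _ tau0 Iw.
- rewrite (_ : (4 * q + 2 = (2 * q + 1) * 2)%N); last by lia.
  rewrite exprM -expr2M.
  apply: (integral_saturation_le (mph i) mI I0 (exprn_ge0 _ delta0) om0 m0 p20) Iom.
  by apply: filterS pointwise => w pw tau tau0 Iw; have [] := pw _ tau0 Iw.
Qed.
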